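(* Let $\mathcal H$ be a Hilbert $C^*$-quad module over $(\mathcal A;\mathcal B_1,\mathcal B_2)$ of finite type with finite bases $\{u_1,\dots,u_M\}$ (over $\mathcal B_1$) and $\{v_1,\dots,v_N\}$ (over $\mathcal B_2$). Let $\mathcal D$ be a unital $C^*$-algebra. Suppose that there exist $*$-homomorphisms $\Phi_1:\mathcal B_1\to\mathcal D$, $\Phi_2:\mathcal B_2\to\mathcal D$ such that $\Phi_1(a)=\Phi_2(a)$ for $a\in\mathcal A$, and elements $\widehat S_1,\dots,\widehat S_M,\widehat T_1,\dots,\widehat T_N$ in $\mathcal D$ satisfying $$\sum_{i=1}^M\widehat S_i\widehat S_i^*+\sum_{k=1}^N\widehat T_k\widehat T_k^*=1,\qquad\widehat S_j^*\widehat T_l=0,$$ $$\widehat S_i^*\widehat S_j=\Phi_1(\langle u_i\mid u_j\rangle_{\mathcal B_1}),\qquad\widehat T_k^*\widehat T_l=\Phi_2(\langle v_k\mid v_l\rangle_{\mathcal B_2}),$$ $$\Phi_1(z)\widehat S_j=\sum_{i=1}^M\widehat S_i\Phi_1(\langle u_i\mid\phi_1(z)u_j\rangle_{\mathcal B_1}),\qquad\Phi_1(z)\widehat T_l=\sum_{k=1}^N\widehat T_k\Phi_2(\langle v_k\mid\phi_1(z)v_l\rangle_{\mathcal B_2}),$$ $$\Phi_2(w)\widehat S_j=\sum_{i=1}^M\widehat S_i\Phi_1(\langle u_i\mid\phi_2(w)u_j\rangle_{\mathcal B_1}),\qquad\Phi_2(w)\widehat T_l=\sum_{k=1}^N\widehat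 T_k\Phi_2(\langle v_k\mid\phi_2(w)v_l\rangle_{\mathcal B_2})$$ for $z\in\mathcal B_1$, $w\in\mathcal B_2$, $i,j=1,\dots,M$, $k,l=1,\dots,N$. Let $\widehat{\mathcal O}_{\mathcal H}$ be the $C^*$-subalgebra of $\mathcal D$ generated by $\widehat S_i,\widehat T_k$ ($i=1,\dots,M$, $k=1,\dots,N$) and $\Phi_1(z),\Phi_2(w)$ ($z\in\mathcal B_1,w\in\mathcal B_2$). Assume further that $\widehat{\mathcal O}_{\mathcal H}$ admits a gauge action. If both $*$-homomorphisms $\Phi_i:\mathcal B_i\to\mathcal D$, $i=1,2$, are injective, then there exists a $*$-isomorphism $\Phi:\mathcal O_{\mathcal H}\to\widehat{\mathcal O}_{\mathcal H}$ satisfying $\Phi(S_i)=\widehat S_i$, $\Phi(T_k)=\widehat T_k$, $\Phi(z)=\Phi_1(z)$, $\Phi(w)=\Phi_2(w)$ for $i=1,\dots,M$, $k=1,\dots,N$, $z\in\mathcal B_1$, $w\in\mathcal B_2$.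
   Context: **Quad modules.** $\mathcal A,\mathcal B_1,\mathcal B_2$ are unital $C^*$-algebras with $\mathcal A\subset\mathcal B_1$, $\mathcal A\subset\mathcal B_2$ (common units). For $i=1,2$ there is a right action $\psi_i$ of $\mathcal A$ on $\mathcal B_i$, written $b_i\psi_i(a)\in\mathcal B_i$, making $\mathcal B_i$ a right $\mathcal A$-module, with $\|b_i\psi_i(a)\|\le\|b_i\|\|a\|$ and $b_i\psi_i(aa')=b_i\psi_i(a)\psi_i(a')$. All inner products are linear in the second variable. $\mathcal L_{\mathcal A}(X)$ denotes the bounded adjointable right $\mathcal A$-module maps on a right Hilbert $\mathcal A$-module $X$. A Hilbert $C^*$-bimodule $\mathcal H$ over $\mathcal A$ is a right Hilbert $\mathcal A$-module, with inner product $\langle\cdot\mid\cdot\rangle_{\mathcal A}$, and a $*$-homomorphism $\phi_{\mathcal A}:\mathcal A\to\mathcal L_{\mathcal A}(\mathcal H)$. It is a *Hilbert $C^*$-quad module over $(\mathcal A;\mathcal B_1,\mathcal B_2)$* if for each $i=1,2$ it is also a Hilbert $C^*$-bimodule over $\mathcal B_i$, with right action $\xi\mapsto\xi\varphi_i(b)$, left action $\phi_i$ (a $*$-homomorphism into adjointable operators) and complete $\mathcal B_i$-valued right inner product $\langle\cdot\mid\cdot\rangle_{\mathcal B_i}$, such that: $\phi_i(b)\in\mathcal L_{\mathcal A}(\mathcal H)$, and the adjoint of $\phi_i(b)$ with respect to either $\langle\cdot\mid\cdot\rangle_{\mathcal B_i}$ or $\langle\cdot\mid\cdot\rangle_{\mathcal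 A}$ is $\phi_i(b^* )$; $\phi_i$ is faithful; $[\phi_1(z)\xi]\varphi_2(w)=\phi_1(z)[\xi\varphi_2(w)]$ and $[\phi_2(w)\xi]\varphi_1(z)=\phi_2(w)[\xi\varphi_1(z)]$; $\xi\varphi_1(z\psi_1(a))=[\xi\varphi_1(z)]a$ and $\xi\varphi_2(w\psi_2(a))=[\xi\varphi_2(w)]a$; $\phi_{\mathcal A}(a)=\phi_1(a)=\phi_2(a)$; $\langle\xi\mid\eta a\rangle_{\mathcal B_i}=\langle\xi\mid\eta\rangle_{\mathcal B_i}\psi_i(a)$ (for $\xi,\eta\in\mathcal H$, $z\in\mathcal B_1$, $w\in\mathcal B_2$, $a\in\mathcal A$); and $\mathcal H$ is full for each of the three inner products, i.e. the $C^*$-algebras generated by the values of $\langle\cdot\mid\cdot\rangle_{\mathcal A}$, $\langle\cdot\mid\cdot\rangle_{\mathcal B_1}$, $\langle\cdot\mid\cdot\rangle_{\mathcal B_2}$ are $\mathcal A,\mathcal B_1,\mathcal B_2$. **Finite type.** $\mathcal H$ is of *finite type* if there are finite bases $\{u_1,\dots,u_M\}$ over $\mathcal B_1$ and $\{v_1,\dots,v_N\}$ over $\mathcal B_2$, i.e. $\sum_{i}u_i\varphi_1(\langle u_i\mid\xi\rangle_{\mathcal B_1})=\sum_k v_k\varphi_2(\langle v_k\mid\xi\rangle_{\mathcal B_2})=\xi$ for all $\xi\in\mathcal H$, such that $\langle u_i\mid\phi_2(w)u_j\rangle_{\mathcal B_1}\in\mathcal A$, $\langle v_k\mid\phi_1(z)v_l\rangle_{\mathcal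 B_2}\in\mathcal A$ for all $i,j,k,l$, $w\in\mathcal B_2$, $z\in\mathcal B_1$, and $\sum_i\langle u_i\mid\phi_2(\langle\xi\mid\eta\rangle_{\mathcal B_2})u_i\rangle_{\mathcal B_1}=\langle\xi\mid\eta\rangle_{\mathcal A}=\sum_k\langle v_k\mid\phi_1(\langle\xi\mid\eta\rangle_{\mathcal B_1})v_k\rangle_{\mathcal B_2}$ for all $\xi,\eta\in\mathcal H$. The bases in the claim are such bases. **Relations $(\mathcal H)$ and $\mathcal O_{\mathcal H}$.** The relations $(\mathcal H)$ are $$\sum_{i=1}^M S_iS_i^*+\sum_{k=1}^N T_kT_k^*=1,\quad S_j^*T_l=0,\quad S_i^*S_j=\langle u_i\mid u_j\rangle_{\mathcal B_1},\quad T_k^*T_l=\langle v_k\mid v_l\rangle_{\mathcal B_2},$$ $$zS_j=\sum_{i}S_i\langle u_i\mid\phi_1(z)u_j\rangle_{\mathcal B_1},\quad zT_l=\sum_kT_k\langle v_k\mid\phi_1(z)v_l\rangle_{\mathcal B_2},$$ $$wS_j=\sum_iS_i\langle u_i\mid\phi_2(w)u_j\rangle_{\mathcal B_1},\quad wT_l=\sum_kT_k\langle v_k\mid\phi_2(w)v_l\rangle_{\mathcal B_2}$$ for all $z\in\mathcal B_1$, $w\in\mathcal B_2$, $i,j=1,\dots,M$, $k,l=1,\dots,N$. $\mathcal O_{\mathcal H}$ is the completion of the universal unital $*$-algebra generated by $S_i,T_k$ and (the $*$-algebras) $\mathcal B_1,\mathcal B_2$ subject to $(\mathcal H)$, in the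 supremum of the operator norms over all representations on Hilbert spaces, i.e. over all representations of $\mathcal B_1$ and $\mathcal B_2$ together with operators $S_i,T_k$ satisfying $(\mathcal H)$. **Gauge action.** A gauge action on $\widehat{\mathcal O}_{\mathcal H}$ is a (pointwise norm-continuous) action $\widehat h$ of $\mathbb T=\mathbb R/\mathbb Z$ by $*$-automorphisms with $\widehat h_r(\widehat S_i)=e^{2\pi\sqrt{-1}r}\widehat S_i$, $\widehat h_r(\widehat T_k)=e^{2\pi\sqrt{-1}r}\widehat T_k$, $\widehat h_r(\Phi_1(z))=\Phi_1(z)$, $\widehat h_r(\Phi_2(w))=\Phi_2(w)$. *)

(* Defs.v *)
From HB Require Import structures.
From mathcomp Require Import all_boot all_order all_algebra.
From mathcomp Require Import generic_quotient.
From mathcomp Require Import complex.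
From mathcomp Require Import all_classical all_reals all_analysis.

Set Implicit Arguments.
Unset Strict Implicit.
Unset Printing Implicit Defensive.

Import Order.TTheory GRing.Theory Num.Theory.

Local Open Scope classical_set_scope.
Local Open Scope ring_scope.
Local Open Scope complex_scope.
Local Open Scope quotient_scope.

Definition norm_complete (R : realType) (V : zmodType) (nrm : V -> R) : Prop :=
  forall x : nat -> V,
    (forall e : R, 0 < e -> exists n0 : nat, forall m n : nat,
        (n0 <= m)%N -> (n0 <= n)%N -> nrm (x m - x n) < e) ->
    exists l : V, forall e : R, 0 < e -> exists n0 : nat, forall n : nat,
        (n0 <= n)%N -> nrm (x n - l) < e.

(** HB cannot join rings with normed modules below the existing class of
    numeric domains, so a C*-algebra carries its own real-valued norm instead
    of a [normedModType] structure.  [algType] includes [1 != 0]. *)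

HB.mixin Record hasStar (R : realType) A & GRing.Algebra R[i] A := {
  star : A -> A;
  starD : forall x y : A, star (x + y) = star x + star y;
  starZ : forall (c : R[i]) (x : A), star (c *: x) = (c^*)%C *: star x;
  starM : forall x y : A, star (x * y) = star y * star x;
  starK : forall x : A, star (star x) = x
}.

#[short(type="starAlgType")]
HB.structure Definition StarAlgebra (R : realType) :=
  {A of GRing.Algebra R[i] A & hasStar R A}.

HB.mixin Record isCStar (R : realType) A & StarAlgebra R A := {
  cnorm : A -> R;
  cnormD : forall x y : A, cnorm (x + y) <= cnorm x + cnorm y;
  cnormZ : forall (c : R[i]) (x : A),
    cnorm (c *: x) = complex.Re `|c| * cnorm x;
  cnorm0_eq0 : forall x : A, cnorm x = 0 -> x = 0;
  cnorm_complete : norm_complete cnorm;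
  cnormM : forall x y : A, cnorm (x * y) <= cnorm x * cnorm y;
  cnorm_star : forall x : A, cnorm (star x * x) = cnorm x ^+ 2
}.

#[short(type="cstarType")]
HB.structure Definition CStarAlgebra (R : realType) :=
  {A of StarAlgebra R A & isCStar R A}.

(** *-homomorphisms need not be unital. *)
Record starhom (R : realType) (A B : starAlgType R) (f : A -> B) : Prop := {
  starhomD : forall x y, f (x + y) = f x + f y;
  starhomZ : forall (c : R[i]) x, f (c *: x) = c *: f x;
  starhomM : forall x y, f (x * y) = f x * f y;
  starhom_star : forall x, f (star x) = star (f x)
}.

(** The identification of A with a C*-subalgebra of B having the same unit. *)
Record unital_inclusion (R : realType) (A B : starAlgType R) (f : A -> B)
    : Prop := {
  inclusion_hom : starhom f;
  inclusion1 : f 1 = 1;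
  inclusion_inj : injective f
}.

Section CStar.
Variables (R : realType) (A : cstarType R).

Definition cpositive (x : A) : Prop := exists y : A, x = star y * y.

Definition cclosure (V : set A) : set A :=
  [set x | forall e : R, 0 < e -> exists2 y, V y & cnorm (x - y) < e].

Record cstar_subalgebra (V : set A) : Prop := {
  csub0 : V 0;
  csubD : forall x y, V x -> V y -> V (x + y);
  csubZ : forall (c : R[i]) x, V x -> V (c *: x);
  csubM : forall x y, V x -> V y -> V (x * y);
  csub_star : forall x, V x -> V (star x);
  csub_closed : cclosure V `<=` V
}.

Definition cstar_generated (G : set A) : set A := smallest cstar_subalgebra G.

End CStar.

Record right_hilbert (R : realType) (B : cstarType R) (H : lmodType R[i]) :=
    RightHilbert {
  ract : H -> B -> H;
  ip : H -> H -> B;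
  ractDl : forall x y b, ract (x + y) b = ract x b + ract y b;
  ractDr : forall x b b', ract x (b + b') = ract x b + ract x b';
  ractZl : forall (c : R[i]) x b, ract (c *: x) b = c *: ract x b;
  ractZr : forall (c : R[i]) x b, ract x (c *: b) = c *: ract x b;
  ractM : forall x b b', ract x (b * b') = ract (ract x b) b';
  ract1 : forall x, ract x 1 = x;
  ipDr : forall x y z, ip x (y + z) = ip x y + ip x z;
  ipZr : forall (c : R[i]) x y, ip x (c *: y) = c *: ip x y;
  ip_ract : forall x y b, ip x (ract y b) = ip x y * b;
  ip_star : forall x y, star (ip x y) = ip y x;
  ip_ge0 : forall x, cpositive (ip x x);
  ip_eq0 : forall x, ip x x = 0 -> x = 0;
  ip_complete : norm_complete (fun x => Num.sqrt (cnorm (ip x x)))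
}.

Section Adjointable.
Variables (R : realType) (B : cstarType R) (H : lmodType R[i]).
Variable X : right_hilbert B H.

Definition mnorm (x : H) : R := Num.sqrt (cnorm (ip X x x)).

Definition adjoint_pair (f g : H -> H) : Prop :=
  forall x y, ip X (f x) y = ip X x (g y).

(** [adjointable f] is membership of f in L_B(H). *)
Record adjointable (f : H -> H) : Prop := {
  adjointableD : forall x y, f (x + y) = f x + f y;
  adjointableZ : forall (c : R[i]) x, f (c *: x) = c *: f x;
  adjointable_ract : forall x b, f (ract X x b) = ract X (f x) b;
  adjointable_bounded : exists c : R, forall x, mnorm (f x) <= c * mnorm x;
  adjointable_adjoint : exists g : H -> H, adjoint_pair f g
}.

(** [phi] is a *-homomorphism from C to L_B(H). *)
Record left_action (C : cstarType R) (phi : C -> H -> H) : Prop := {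
  lact_adjointable : forall c, adjointable (phi c);
  lactD : forall c d x, phi (c + d) x = phi c x + phi d x;
  lactZ : forall (k : R[i]) c x, phi (k *: c) x = k *: phi c x;
  lactM : forall c d x, phi (c * d) x = phi c (phi d x);
  lact_star : forall c, adjoint_pair (phi c) (phi (star c))
}.

Definition full : Prop :=
  cstar_generated [set b | exists x y, b = ip X x y] = setT.

End Adjointable.

(** [psi b a] is b psi(a). *)
Record right_action (R : realType) (A B : cstarType R) (psi : B -> A -> B)
    : Prop := {
  psiDl : forall b b' a, psi (b + b') a = psi b a + psi b' a;
  psiDr : forall b a a', psi b (a + a') = psi b a + psi b a';
  psiZl : forall (c : R[i]) b a, psi (c *: b) a = c *: psi b a;
  psiZr : forall (c : R[i]) b a, psi b (c *: a) = c *: psi b a;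
  psiM : forall b a a', psi b (a * a') = psi (psi b a) a';
  psi1 : forall b, psi b 1 = b;
  psi_norm : forall b a, cnorm (psi b a) <= cnorm b * cnorm a
}.

Record coefficients (R : realType) (A B1 B2 : cstarType R) := Coefficients {
  inc1 : A -> B1;
  inc2 : A -> B2;
  inc1P : unital_inclusion inc1;
  inc2P : unital_inclusion inc2;
  psi_1 : B1 -> A -> B1;
  psi_2 : B2 -> A -> B2;
  psi_1P : right_action psi_1;
  psi_2P : right_action psi_2
}.

Record quad_module (R : realType) (A B1 B2 : cstarType R)
    (E : coefficients A B1 B2) (H : lmodType R[i]) := QuadModule {
  hilbA : right_hilbert A H;
  hilb1 : right_hilbert B1 H;
  hilb2 : right_hilbert B2 H;
  phiA : A -> H -> H;
  phi1 : B1 -> H -> H;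
  phi2 : B2 -> H -> H;
  phiA_left : left_action hilbA phiA;
  phi1_left : left_action hilb1 phi1;
  phi2_left : left_action hilb2 phi2;
  phi1_leftA : left_action hilbA phi1;
  phi2_leftA : left_action hilbA phi2;
  phi1_inj : injective phi1;
  phi2_inj : injective phi2;
  phi1_ract2 : forall z w x,
    ract hilb2 (phi1 z x) w = phi1 z (ract hilb2 x w);
  phi2_ract1 : forall z w x,
    ract hilb1 (phi2 w x) z = phi2 w (ract hilb1 x z);
  ract1_psi : forall x z a,
    ract hilb1 x (psi_1 E z a) = ract hilbA (ract hilb1 x z) a;
  ract2_psi : forall x w a,
    ract hilb2 x (psi_2 E w a) = ract hilbA (ract hilb2 x w) a;
  phiA_1 : forall a x, phiA a x = phi1 (inc1 E a) x;
  phiA_2 : forall a x, phiA a x = phi2 (inc2 E a) x;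
  ip1_psi : forall x y a,
    ip hilb1 x (ract hilbA y a) = psi_1 E (ip hilb1 x y) a;
  ip2_psi : forall x y a,
    ip hilb2 x (ract hilbA y a) = psi_2 E (ip hilb2 x y) a;
  fullA : full hilbA;
  full1 : full hilb1;
  full2 : full hilb2
}.

Section QuadModule.
Variables (R : realType) (A B1 B2 : cstarType R) (E : coefficients A B1 B2).
Variables (H : lmodType R[i]) (X : quad_module E H).

Definition ipA (x y : H) : A := ip (hilbA X) x y.
Definition ip1 (x y : H) : B1 := ip (hilb1 X) x y.
Definition ip2 (x y : H) : B2 := ip (hilb2 X) x y.

Variables (M N : nat) (u : 'I_M -> H) (v : 'I_N -> H).

(** [u] and [v] witness that X is of finite type. *)
Record finite_bases : Prop := {
  basis1 : forall x, \sum_(i < M) ract (hilb1 X) (u i) (ip1 (u i) x) = x;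
  basis2 : forall x, \sum_(k < N) ract (hilb2 X) (v k) (ip2 (v k) x) = x;
  basis1_A : forall i j w, range (inc1 E) (ip1 (u i) (phi2 X w (u j)));
  basis2_A : forall k l z, range (inc2 E) (ip2 (v k) (phi1 X z (v l)));
  basis1_ip : forall x y,
    \sum_(i < M) ip1 (u i) (phi2 X (ip2 x y) (u i)) = inc1 E (ipA x y);
  basis2_ip : forall x y,
    \sum_(k < N) ip2 (v k) (phi1 X (ip1 x y) (v k)) = inc2 E (ipA x y)
}.

(** The relations (H) in a unital *-algebra Q, for the images of B1, B2 under
    [f1], [f2] and for the elements [S], [T]. *)
Record relationsH (Q : starAlgType R) (f1 : B1 -> Q) (f2 : B2 -> Q)
    (S : 'I_M -> Q) (T : 'I_N -> Q) : Prop := {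
  relH_unit :
    \sum_(i < M) S i * star (S i) + \sum_(k < N) T k * star (T k) = 1;
  relH_ST : forall j l, star (S j) * T l = 0;
  relH_SS : forall i j, star (S i) * S j = f1 (ip1 (u i) (u j));
  relH_TT : forall k l, star (T k) * T l = f2 (ip2 (v k) (v l));
  relH_1S : forall z j,
    f1 z * S j = \sum_(i < M) S i * f1 (ip1 (u i) (phi1 X z (u j)));
  relH_1T : forall z l,
    f1 z * T l = \sum_(k < N) T k * f2 (ip2 (v k) (phi1 X z (v l)));
  relH_2S : forall w j,
    f2 w * S j = \sum_(i < M) S i * f1 (ip1 (u i) (phi2 X w (u j)));
  relH_2T : forall w l,
    f2 w * T l = \sum_(k < N) T k * f2 (ip2 (v k) (phi2 X w (v l)))
}.

End QuadModule.

(** The universal unital *-algebra generated by S, T, B1, B2 subject to (H),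
    [univ_alg] below, is the set of formal *-polynomials in the generators, two
    of which are identified when they take the same value in every unital
    *-algebra in which B1 and B2 are interpreted by *-homomorphisms and the
    generators satisfy (H). *)

Inductive starpoly (R : realType) (B1 B2 : Type) (M N : nat) :=
  | PS of 'I_M
  | PT of 'I_N
  | PB1 of B1
  | PB2 of B2
  | POne
  | PAdd of starpoly R B1 B2 M N & starpoly R B1 B2 M N
  | PScale of R[i] & starpoly R B1 B2 M N
  | PMul of starpoly R B1 B2 M N & starpoly R B1 B2 M N
  | PStar of starpoly R B1 B2 M N.

HB.instance Definition _ R B1 B2 M N := gen_eqMixin (starpoly R B1 B2 M N).
HB.instance Definition _ R B1 B2 M N := gen_choiceMixin (starpoly R B1 B2 M N).

Fixpoint peval (R : realType) (B1 B2 : Type) (M N : nat) (Q : starAlgType R)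
    (f1 : B1 -> Q) (f2 : B2 -> Q) (S : 'I_M -> Q) (T : 'I_N -> Q)
    (p : starpoly R B1 B2 M N) : Q :=
  match p with
  | PS i => S i
  | PT k => T k
  | PB1 z => f1 z
  | PB2 w => f2 w
  | POne => 1
  | PAdd p q => peval f1 f2 S T p + peval f1 f2 S T q
  | PScale c p => c *: peval f1 f2 S T p
  | PMul p q => peval f1 f2 S T p * peval f1 f2 S T q
  | PStar p => star (peval f1 f2 S T p)
  end.

Section UniversalAlgebra.
Variables (R : realType) (A B1 B2 : cstarType R) (E : coefficients A B1 B2).
Variables (H : lmodType R[i]) (X : quad_module E H).
Variables (M N : nat) (u : 'I_M -> H) (v : 'I_N -> H).

Let poly := starpoly R B1 B2 M N.

Definition peqv (p q : poly) : Prop :=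
  forall (Q : starAlgType R) (f1 : B1 -> Q) (f2 : B2 -> Q)
    (S : 'I_M -> Q) (T : 'I_N -> Q),
    starhom f1 -> starhom f2 -> relationsH X u v f1 f2 S T ->
    peval f1 f2 S T p = peval f1 f2 S T q.

Definition peqvb (p q : poly) : bool := `[< peqv p q >].

Lemma peqvb_equiv : equiv_class_of peqvb.
Proof.
split=> [p | p q | q p r].
- by apply/asboolP.
- by apply/asboolP/asboolP => h Q f1 f2 S T h1 h2 hH; rewrite (h _ f1 f2 S T).
- move=> /asboolP hpq /asboolP hqr; apply/asboolP => Q f1 f2 S T h1 h2 hH.
  by rewrite (hpq _ f1 f2 S T) // (hqr _ f1 f2 S T).
Qed.

Canonical peqvb_rel := EquivRelPack peqvb_equiv.

Definition univ_alg := {eq_quot peqvb_rel}.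
HB.instance Definition _ := Choice.on univ_alg.
HB.instance Definition _ := EqQuotient.on univ_alg.

Implicit Types p q r : univ_alg.

Definition univ_class (t : poly) : univ_alg := \pi_univ_alg t.

Definition ueval (Q : starAlgType R) (f1 : B1 -> Q) (f2 : B2 -> Q)
    (S : 'I_M -> Q) (T : 'I_N -> Q) p : Q := peval f1 f2 S T (repr p).

Definition uS (i : 'I_M) : univ_alg := univ_class (PS _ _ _ _ i).
Definition uT (k : 'I_N) : univ_alg := univ_class (PT _ _ _ _ k).
Definition uB1 (z : B1) : univ_alg := univ_class (PB1 _ _ _ _ z).
Definition uB2 (w : B2) : univ_alg := univ_class (PB2 _ _ _ _ w).
Definition uone : univ_alg := univ_class (POne _ _ _ _ _).
Definition uadd p q : univ_alg := univ_class (PAdd (repr p) (repr q)).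
Definition uscale (c : R[i]) p : univ_alg := univ_class (PScale c (repr p)).
Definition umul p q : univ_alg := univ_class (PMul (repr p) (repr q)).
Definition ustar p : univ_alg := univ_class (PStar (repr p)).

Lemma univ_eqP p q :
  (forall (Q : starAlgType R) (f1 : B1 -> Q) (f2 : B2 -> Q)
     (S : 'I_M -> Q) (T : 'I_N -> Q),
     starhom f1 -> starhom f2 -> relationsH X u v f1 f2 S T ->
     ueval f1 f2 S T p = ueval f1 f2 S T q) -> p = q.
Proof.
by move=> h; rewrite -[p]reprK -[q]reprK; apply/eqmodP/asboolP.
Qed.

Section Eval.
Variables (Q : starAlgType R) (f1 : B1 -> Q) (f2 : B2 -> Q).
Variables (S : 'I_M -> Q) (T : 'I_N -> Q).
Hypotheses (f1P : starhom f1) (f2P : starhom f2).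
Hypothesis (STP : relationsH X u v f1 f2 S T).

Let ev := ueval f1 f2 S T.

Lemma ueval_class (t : poly) : ev (univ_class t) = peval f1 f2 S T t.
Proof.
have /eqmodP/asboolP : repr (univ_class t) = t %[mod univ_alg] by rewrite reprK.
exact.
Qed.

Lemma uevalS i : ev (uS i) = S i. Proof. exact: ueval_class. Qed.
Lemma uevalT k : ev (uT k) = T k. Proof. exact: ueval_class. Qed.
Lemma uevalB1 z : ev (uB1 z) = f1 z. Proof. exact: ueval_class. Qed.
Lemma uevalB2 w : ev (uB2 w) = f2 w. Proof. exact: ueval_class. Qed.
Lemma ueval_one : ev uone = 1. Proof. exact: ueval_class. Qed.
Lemma ueval_add p q : ev (uadd p q) = ev p + ev q.
Proof. exact: ueval_class. Qed.
Lemma ueval_scale c p : ev (uscale c p) = c *: ev p.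
Proof. exact: ueval_class. Qed.
Lemma ueval_mul p q : ev (umul p q) = ev p * ev q.
Proof. exact: ueval_class. Qed.
Lemma ueval_star p : ev (ustar p) = star (ev p).
Proof. exact: ueval_class. Qed.

Definition uevalE := (uevalS, uevalT, uevalB1, uevalB2, ueval_one, ueval_add,
  ueval_scale, ueval_mul, ueval_star).
End Eval.

Local Ltac univ_law :=
  let h1 := fresh in let h2 := fresh in let h3 := fresh in
  move=> *; apply: univ_eqP => ? ? ? ? ?; intros h1 h2 h3;
  rewrite ?(uevalE h1 h2 h3).

Lemma uaddA : associative uadd.
Proof. by univ_law; rewrite addrA. Qed.
Lemma uaddC : commutative uadd.
Proof. by univ_law; rewrite addrC. Qed.
Lemma uadd0 : left_id (uscale 0 uone) uadd.
Proof. by univ_law; rewrite scale0r add0r. Qed.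
Lemma uaddN : left_inverse (uscale 0 uone) (uscale (-1)) uadd.
Proof. by univ_law; rewrite scaleN1r addNr scale0r. Qed.

HB.instance Definition _ := GRing.isZmodule.Build univ_alg
  uaddA uaddC uadd0 uaddN.

Lemma umulA : associative umul.
Proof. by univ_law; rewrite mulrA. Qed.
Lemma umul1l : left_id uone umul.
Proof. by univ_law; rewrite mul1r. Qed.
Lemma umul1r : right_id uone umul.
Proof. by univ_law; rewrite mulr1. Qed.
Lemma umulDl : left_distributive umul (+%R : univ_alg -> univ_alg -> univ_alg).
Proof. by univ_law; rewrite mulrDl. Qed.
Lemma umulDr : right_distributive umul (+%R : univ_alg -> univ_alg -> univ_alg).
Proof. by univ_law; rewrite mulrDr. Qed.

HB.instance Definition _ := GRing.Zmodule_isPzRing.Build univ_alg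
  umulA umul1l umul1r umulDl umulDr.

Lemma uscaleA c d p : uscale c (uscale d p) = uscale (c * d) p.
Proof. by univ_law; rewrite scalerA. Qed.
Lemma uscale1 : left_id 1 uscale.
Proof. by univ_law; rewrite scale1r. Qed.
Lemma uscaleDr : right_distributive uscale +%R.
Proof. by univ_law; rewrite scalerDr. Qed.
Lemma uscaleDl p : {morph uscale^~ p : c d / c + d}.
Proof. by univ_law; rewrite scalerDl. Qed.

HB.instance Definition _ := GRing.Zmodule_isLmodule.Build R[i] univ_alg
  uscaleA uscale1 uscaleDr uscaleDl.

End UniversalAlgebra.

HB.mixin Record isHilbert (R : realType) K & GRing.Lmodule R[i] K := {
  dot : K -> K -> R[i];
  dotDr : forall x y z : K, dot x (y + z) = dot x y + dot x z;
  dotZr : forall (c : R[i]) (x y : K), dot x (c *: y) = c * dot x y;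
  dot_conj : forall x y : K, (dot x y)^*%C = dot y x;
  dot_ge0 : forall x : K, 0 <= dot x x;
  dot_eq0 : forall x : K, dot x x = 0 -> x = 0;
  dot_complete : norm_complete (fun x : K => Num.sqrt (complex.Re (dot x x)))
}.

#[short(type="hilbertType")]
HB.structure Definition Hilbert (R : realType) :=
  {K of GRing.Lmodule R[i] K & isHilbert R K}.

Definition hnorm (R : realType) (K : hilbertType R) (x : K) : R :=
  Num.sqrt (complex.Re (dot x x)).

Definition opnorm (R : realType) (K : hilbertType R) (f : K -> K) : R :=
  sup [set hnorm (f x) | x in [set x | hnorm x <= 1]].

Section OH.
Variables (R : realType) (A B1 B2 : cstarType R) (E : coefficients A B1 B2).
Variables (H : lmodType R[i]) (X : quad_module E H).
Variables (M N : nat) (u : 'I_M -> H) (v : 'I_N -> H).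

(** Unital *-representations of the universal *-algebra by bounded operators
    on the Hilbert space K. *)
Record hilbert_rep (K : hilbertType R) (rho : univ_alg X u v -> K -> K)
    : Prop := {
  rep_linear : forall p (c : R[i]) x y,
    rho p (c *: x + y) = c *: rho p x + rho p y;
  rep_bounded : forall p, exists c : R, forall x,
    hnorm (rho p x) <= c * hnorm x;
  repD : forall p q x, rho (p + q) x = rho p x + rho q x;
  repZ : forall (c : R[i]) p x, rho (c *: p) x = c *: rho p x;
  repM : forall p q x, rho (p * q) x = rho p (rho q x);
  rep1 : forall x, rho 1 x = x;
  rep_star : forall p x y, dot (rho p x) y = dot x (rho (ustar p) y)
}.

(** The supremum is over a bounded set: *-homomorphisms out of the C*-algebras
    B1 and B2 are contractive, and (H) bounds the S and T by 1. *)
Definition univ_norm (p : univ_alg X u v) : R :=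
  sup [set r | exists (K : hilbertType R) (rho : univ_alg X u v -> K -> K),
                 hilbert_rep rho /\ r = opnorm (rho p)].

(** [kappa] exhibits the C*-algebra O as the completion of the universal
    *-algebra in [univ_norm]; elements of norm zero are killed by [kappa]. *)
Record is_OH (O : cstarType R) (kappa : univ_alg X u v -> O) : Prop := {
  OH_D : forall p q, kappa (p + q) = kappa p + kappa q;
  OH_Z : forall (c : R[i]) p, kappa (c *: p) = c *: kappa p;
  OH_M : forall p q, kappa (p * q) = kappa p * kappa q;
  OH_1 : kappa 1 = 1;
  OH_star : forall p, kappa (ustar p) = star (kappa p);
  OH_norm : forall p, cnorm (kappa p) = univ_norm p;
  OH_dense : cclosure (range kappa) = setT
}.

End OH.

Section Gauge.
Variables (R : realType) (B1 B2 D : cstarType R) (M N : nat).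
Variables (f1 : B1 -> D) (f2 : B2 -> D) (S : 'I_M -> D) (T : 'I_N -> D).

Definition hatO : set D := cstar_generated
  (range S `|` range T `|` range f1 `|` range f2).

Definition expi2pi (r : R) : R[i] := cos (2 * pi * r) +i* sin (2 * pi * r).

(** An action of R/Z is an action h of R with h 1 the identity; only the
    restriction of each [h r] to [hatO] is relevant. *)
Record gauge_action (h : R -> D -> D) : Prop := {
  gauge_stable : forall r x, hatO x -> hatO (h r x);
  gaugeD : forall r x y, hatO x -> hatO y -> h r (x + y) = h r x + h r y;
  gaugeZ : forall r (c : R[i]) x, hatO x -> h r (c *: x) = c *: h r x;
  gaugeM : forall r x y, hatO x -> hatO y -> h r (x * y) = h r x * h r y;
  gauge_star : forall r x, hatO x -> h r (star x) = star (h r x);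
  gauge_id : forall x, hatO x -> h 0 x = x;
  gauge_add : forall r s x, hatO x -> h (r + s) x = h r (h s x);
  gauge_period : forall x, hatO x -> h 1 x = x;
  gauge_continuous : forall x, hatO x -> forall (r e : R), 0 < e ->
    exists2 d : R, 0 < d &
      forall s, `|s - r| < d -> cnorm (h s x - h r x) < e;
  gauge_S : forall r i, h r (S i) = expi2pi r *: S i;
  gauge_T : forall r k, h r (T k) = expi2pi r *: T k;
  gauge_f1 : forall r z, h r (f1 z) = f1 z;
  gauge_f2 : forall r w, h r (f2 w) = f2 w
}.

End Gauge.

(* Main.v *)
Require Import Defs.
From HB Require Import structures.
From mathcomp Require Import all_boot all_order all_algebra.
From mathcomp Require Import generic_quotient complex.
From mathcomp Require Import all_classical all_reals all_analysis.
From mathcomp Require Import zify ring lra.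

Set Implicit Arguments.
Unset Strict Implicit.
Unset Printing Implicit Defensive.

Import Order.TTheory GRing.Theory Num.Theory.
Import numFieldNormedType.Exports.

Local Open Scope classical_set_scope.
Local Open Scope ring_scope.
Local Open Scope complex_scope.

(** Write [ev p] and [kappa p] for the values of a formal *-polynomial [p] in
    the given algebra [D] and in the universal C*-algebra. The theorem amounts
    to |kappa p| = |ev p| for all [p]: the isomorphism is then the extension by
    continuity of [kappa p |-> ev p] ([isometric_extension]).

    One inequality, |ev p| <= |kappa p|, says that [D] is one of the solutions
    over which the universal norm is a supremum ([ueval_le_univ_norm]). That
    supremum is over Hilbert spaces, so the norm of [ev p] has to be attained
    in a representation of [D]: some state takes the value |ev p|^2 at
    [star (ev p) * ev p], and its GNS representation does it.

    The other inequality compares two C*-seminorms, [p1] (the norm of the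
    universal algebra) and [p0] (the norm of [D]), on the *-algebra generated by
    the pairs of corresponding generators. By the C*-identity, a C*-seminorm
    raises to the power 2^(j+1) along the elements (x^* x)^(2^j). Hence
    an inequality [p1 <= C_j * p0] at these elements, with [C_j] growing at
    most like 2^j, already gives [p1 x <= p0 x] ([csemi_le_of_growth]), and
    only crude estimates are called for.

    In degree zero: since the sum of all [g_a * star g_a] is 1, where [g_a] runs
    through the generators S and T, an element [x] is recovered from its
    compressions [star g_a * x * g_b]. By the relations, a finite number of
    compressions leads from an element of degree zero to elements of the images
    of B1 and B2. There [p1 <= p0], because homomorphisms are contractive
    and injective ones isometric. This gives [p1 <= C * p0] with a constant that
    depends only on the number of compressions, hence [p1 <= p0] in degree zero.
    Applied to [star x * x], this yields [p1 x <= p0 x] for homogeneous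
    [x] of any degree ([homogeneous_le]).

    In general: let [x] be the sum of its homogeneous components of degrees
    -d, ..., d. The gauge action bounds each component by [x] for [p0], as an
    average of translates over a finite cyclic group. So [p1 x <= (2d+1) * p0 x],
    and the degree of (x^* x)^(2^j) grows only like 2^j
    ([gauge_invariant_le]).

    The C*-algebra theory behind this rests on one analytic construction, the
    square root of [1 - x] for self-adjoint [x] with |x| <= 1, obtained by
    iteration. It yields a cone of positive elements stable under sums, which
    contains all [star y * y], the contractivity and isometry statements, and
    (with the Hahn--Banach theorem) the states. *)

(** * Norms and approximate square roots in a C*-algebra *)

Section ComplexModulus.
Variable R : realType.
Implicit Types z w : R[i].

Definition cmod z : R := complex.Re `|z|.

Lemma cmodE z : `|z| = (cmod z)%:C.
Proof. by rewrite /cmod normc_def. Qed.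

Lemma cmod_ge0 z : 0 <= cmod z.
Proof. by rewrite -ler0c -cmodE. Qed.

Lemma cmodD z w : cmod (z + w) <= cmod z + cmod w.
Proof. by rewrite -lecR rmorphD /= -!cmodE ler_normD. Qed.

Lemma cmodM z w : cmod (z * w) = cmod z * cmod w.
Proof. by apply: complexI; rewrite rmorphM /= -!cmodE normrM. Qed.

Lemma cmodN z : cmod (- z) = cmod z.
Proof. by rewrite /cmod normrN. Qed.

Lemma cmod_real (t : R) : cmod t%:C = `|t|.
Proof. by rewrite /cmod normc_def /= expr0n /= addr0 sqrtr_sqr. Qed.

Lemma cmod_sqr z : cmod z ^+ 2 = complex.Re z ^+ 2 + complex.Im z ^+ 2.
Proof.
by rewrite /cmod normc_def /= sqr_sqrtr // addr_ge0 // sqr_ge0.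
Qed.

Lemma cmod_conj z : cmod (z^*)%C = cmod z.
Proof. by case: z => a b; rewrite /cmod !normc_def /= sqrrN. Qed.

Lemma cmod_eq0 z : cmod z = 0 -> z = 0.
Proof. by move=> z0; apply/eqP; rewrite -normr_eq0 cmodE z0. Qed.

Lemma Re_le_cmod z : `|complex.Re z| <= cmod z.
Proof.
rewrite -ler_sqr ?nnegrE ?cmod_ge0 // cmod_sqr real_normK ?num_real //.
by rewrite lerDl sqr_ge0.
Qed.

Lemma Im_le_cmod z : `|complex.Im z| <= cmod z.
Proof.
rewrite -ler_sqr ?nnegrE ?cmod_ge0 // cmod_sqr real_normK ?num_real //.
by rewrite lerDr sqr_ge0.
Qed.

Lemma cmod_le_ReIm z : cmod z <= `|complex.Re z| + `|complex.Im z|.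
Proof.
rewrite -ler_sqr ?nnegrE ?cmod_ge0 ?addr_ge0 // cmod_sqr sqrrD.
rewrite !real_normK ?num_real // lerD2r lerDl.
by rewrite mulrn_wge0 // mulr_ge0.
Qed.

End ComplexModulus.

Section StarAlgebra.
Variables (R : realType) (A : starAlgType R).

Lemma star0 : star (0 : A) = 0.
Proof. by rewrite -(scale0r (0 : A)) starZ conjc0 !scale0r. Qed.

End StarAlgebra.

Section CStarBasics.
Variables (R : realType) (D : cstarType R).
Implicit Types (x y : D) (t : R).

Lemma cnormZr t x : cnorm (t%:C *: x) = `|t| * cnorm x.
Proof. by rewrite cnormZ -/(cmod _) cmod_real. Qed.

Lemma cnorm0 : cnorm (0 : D) = 0.
Proof. by have := cnormZr 0 (0 : D); rewrite scaler0 normr0 mul0r. Qed.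

Lemma cnormN x : cnorm (- x) = cnorm x.
Proof. by rewrite -scaleN1r -(rmorphN1 (real_complex R)) cnormZr normrN1 mul1r. Qed.

Lemma cnorm_ge0 x : 0 <= cnorm x.
Proof.
have := cnormD x (- x); rewrite subrr cnormN cnorm0; lra.
Qed.

Lemma cnorm_distC x y : cnorm (x - y) = cnorm (y - x).
Proof. by rewrite -cnormN opprB. Qed.

Lemma cnorm_sub_trans y x z : cnorm (x - z) <= cnorm (x - y) + cnorm (y - z).
Proof. by rewrite -{1}(subrK y x) -addrA; apply: cnormD. Qed.

Lemma starN x : star (- x) = - star x.
Proof. by apply/eqP; rewrite -addr_eq0 -starD addNr star0. Qed.

Lemma starB x y : star (x - y) = star x - star y.
Proof. by rewrite starD starN. Qed.

Lemma star1 : star (1 : D) = 1.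
Proof. by rewrite -[LHS]mulr1 -{2}(starK 1) -starM mulr1 starK. Qed.

Lemma starZr t x : star (t%:C *: x) = t%:C *: star x.
Proof. by rewrite starZ conjc_real. Qed.

Lemma cnorm_starE x : cnorm (star x) = cnorm x.
Proof.
have le_star y : cnorm y <= cnorm (star y).
  have [->|y0] := eqVneq (cnorm y) 0; first exact: cnorm_ge0.
  have y_gt0 : 0 < cnorm y by rewrite lt_neqAle eq_sym y0 cnorm_ge0.
  by rewrite -(ler_pM2r y_gt0) -expr2 -cnorm_star cnormM.
by apply/le_anti/andP; split; [rewrite -{2}(starK x)|]; exact: le_star.
Qed.

Lemma cnorm1 : cnorm (1 : D) = 1.
Proof.
have := cnorm_star (1 : D); rewrite star1 mulr1 => h.
have n0 : cnorm (1 : D) != 0.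
  by apply/eqP => /cnorm0_eq0 /eqP; rewrite oner_eq0.
by apply: (mulfI n0); rewrite -expr2 -h mulr1.
Qed.

Lemma cnorm_sqr x : star x = x -> cnorm (x * x) = cnorm x ^+ 2.
Proof. by move=> xs; rewrite -cnorm_star xs. Qed.

Lemma cnorm_alg t : cnorm (t%:C%:A : D) = `|t|.
Proof. by rewrite cnormZr cnorm1 mulr1. Qed.

Lemma star_alg t : star (t%:C%:A : D) = t%:C%:A.
Proof. by rewrite starZr star1. Qed.

Lemma cnorm_eq0 x : (forall e : R, 0 < e -> cnorm x <= e) -> x = 0.
Proof.
move=> h; apply: cnorm0_eq0; apply/eqP; rewrite eq_le cnorm_ge0 andbT.
by apply/ler_addgt0Pl => e e0; rewrite addr0 h.
Qed.

(** Iteration for the equation y = (x + y^2) / 2, whose solution is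
    y = 1 - sqrt (1 - x). The numerical iteration [sqrt_bound] is the case x = 1,
    which majorizes all others. *)
Fixpoint sqrt_approx x n : D :=
  if n is n'.+1 then
    (2^-1)%:C *: (x + sqrt_approx x n' * sqrt_approx x n') else 0.

Fixpoint sqrt_bound n : R :=
  if n is n'.+1 then 2^-1 * (1 + sqrt_bound n' ^+ 2) else 0.

Lemma sqrt_bound_range n : 0 <= sqrt_bound n <= 1.
Proof. by elim: n => [|n IH] /=; [rewrite lexx ler01 | nra]. Qed.

Lemma sqrt_bound_nd : nondecreasing_seq sqrt_bound.
Proof.
apply/nondecreasing_seqP; elim=> [|n IH] /=; first lra.
have := sqrt_bound_range n; move: IH => /=; nra.
Qed.

Lemma sqrt_approx_comm x z n : x * z = z * x ->
  sqrt_approx x n * z = z * sqrt_approx x n.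
Proof.
move=> xz; elim: n => [|n IH] /=; first by rewrite mul0r mulr0.
by rewrite -scalerAl -scalerAr mulrDl mulrDr xz -mulrA IH mulrA IH mulrA.
Qed.

Lemma sqrt_approx_star x n : star x = x ->
  star (sqrt_approx x n) = sqrt_approx x n.
Proof.
by move=> xs; elim: n => [|n IH] /=; rewrite ?star0 // starZr starD starM xs IH.
Qed.

Lemma sqrt_approx_bound x n : cnorm x <= 1 ->
  cnorm (sqrt_approx x n) <= sqrt_bound n.
Proof.
move=> x1; elim: n => [|n IH] /=; first by rewrite cnorm0.
rewrite cnormZr ger0_norm ?invr_ge0 // ler_pM2l ?invr_gt0 //.
apply: le_trans (cnormD _ _) _; apply: lerD => //.
apply: le_trans (cnormM _ _) _; rewrite expr2.
by apply: ler_pM; rewrite ?cnorm_ge0.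
Qed.

(** The approximations are polynomials in [x] with nonnegative coefficients, and
    so are their increments. The increments at the number 1 thus bound those at
    any [x] of the unit ball, boundary included. *)
Lemma sqrt_approx_step x n : cnorm x <= 1 ->
  cnorm (sqrt_approx x n.+1 - sqrt_approx x n)
    <= sqrt_bound n.+1 - sqrt_bound n.
Proof.
move=> x1; elim: n => [|n IH].
  by rewrite /= subr0 mulr0 addr0 cnormZr ger0_norm ?invr_ge0 //; lra.
set a := sqrt_approx x n.+1 in IH *; set b := sqrt_approx x n in IH *.
have ab : a * b = b * a.
  by apply/sqrt_approx_comm; apply/esym/sqrt_approx_comm.
have -> : sqrt_approx x n.+2 - a = (2^-1)%:C *: ((a - b) * (a + b)).
  rewrite [sqrt_approx x n.+2]/= -/a [in X in _ - X]/a /= -/b -scalerBr.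
  congr (_ *: _); rewrite mulrDr !mulrBl ab opprD addrACA subrr add0r addrA.
  by rewrite subrK.
rewrite cnormZr ger0_norm ?invr_ge0 //.
have ha : cnorm a <= sqrt_bound n.+1 by apply: sqrt_approx_bound.
have hb : cnorm b <= sqrt_bound n by apply: sqrt_approx_bound.
have hab := cnormD a b; have hm := cnormM (a - b) (a + b).
have := cnorm_ge0 (a - b); have := cnorm_ge0 (a + b).
have -> : sqrt_bound n.+2 = 2^-1 * (1 + sqrt_bound n.+1 ^+ 2) by [].
have e1 : sqrt_bound n.+1 = 2^-1 * (1 + sqrt_bound n ^+ 2) by [].
have le2 : cnorm (a - b) * cnorm (a + b) <=
   (sqrt_bound n.+1 - sqrt_bound n) * (sqrt_bound n.+1 + sqrt_bound n).
  by apply: ler_pM; rewrite ?cnorm_ge0 //; lra.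
move: hm le2; set p := cnorm (_ * _); set q := _ * _; move=> hm le2 _ _.
rewrite mulrDl !mulrDr in le2. nra.
Qed.

Lemma sqrt_approx_cauchy x : cnorm x <= 1 ->
  forall e : R, 0 < e -> exists n0 : nat, forall m n : nat,
    (n0 <= m)%N -> (n0 <= n)%N ->
    cnorm (sqrt_approx x m - sqrt_approx x n) < e.
Proof.
move=> x1 e e0.
have hle m k :
    cnorm (sqrt_approx x (k + m) - sqrt_approx x m)
      <= sqrt_bound (k + m) - sqrt_bound m.
  elim: k => [|k IH]; first by rewrite add0n !subrr cnorm0.
  rewrite addSn; apply: le_trans (cnorm_sub_trans (sqrt_approx x (k + m)) _ _) _.
  by have := sqrt_approx_step (k + m) x1; lra.
have cv : cvgn sqrt_bound.
  apply: nondecreasing_is_cvgn; first exact: sqrt_bound_nd.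
  by exists 1 => _ [n _ <-]; have /andP[] := sqrt_bound_range n.
have /cvgrPdist_lt /(_ (e / 4)) := cv.
rewrite divr_gt0 // => /(_ isT) [n0 _ hn0].
exists n0 => m n hm hn.
apply: le_lt_trans (cnorm_sub_trans (sqrt_approx x n0) _ _) _.
rewrite (cnorm_distC _ (sqrt_approx x n)).
have := hle n0 (m - n0)%N; have := hle n0 (n - n0)%N; rewrite !subnK //.
have := hn0 _ (leqnn n0); have := hn0 m hm; have := hn0 n hn => /=.
rewrite !ltr_distl => /andP[? ?] /andP[? ?] /andP[? ?]; lra.
Qed.

End CStarBasics.

(** * Square roots and positive elements *)

Section Positivity.
Variables (R : realType) (D : cstarType R).
Implicit Types (a b h k x y z : D) (s t : R).

Lemma cnorm_small x (C : R) :
  (forall e : R, 0 < e -> cnorm x <= C * e) -> x = 0.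
Proof.
move=> h; apply: cnorm_eq0 => e e0.
have C1 : 0 < `|C| + 1 by rewrite ltr_wpDl.
apply: le_trans (h (e / (`|C| + 1)) _) _; first by rewrite divr_gt0.
rewrite mulrA ler_pdivrMr //.
have := ler_norm C; nra.
Qed.

Lemma cauchy_limit (s : nat -> D) :
  (forall e : R, 0 < e -> exists n0 : nat, forall m n : nat,
     (n0 <= m)%N -> (n0 <= n)%N -> cnorm (s m - s n) < e) ->
  exists l : D, forall e : R, 0 < e -> exists n0 : nat, forall n : nat,
     (n0 <= n)%N -> cnorm (s n - l) < e.
Proof. exact: cnorm_complete. Qed.

Lemma one_sub_square x y : y + y = x + y * y -> (1 - y) * (1 - y) = 1 - x.
Proof.
move=> yy; rewrite mulrBl mul1r mulrBr mulr1 opprB [y * y - y]addrC addrA.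
by rewrite -[1 - y - y]addrA -opprD yy opprD -!addrA addNr addr0.
Qed.

(** The square root of [1 - x] is [1 - y]. The equation is written without the
    unit, in the form that survives a homomorphism that does not preserve 1;
    likewise, [y] lies in every closed subalgebra containing [x], with or without
    unit. *)
Lemma sqrt_exists x : star x = x -> cnorm x <= 1 ->
  exists y, [/\ star y = y, cnorm y <= 1, y + y = x + y * y,
    forall z, x * z = z * x -> y * z = z * y
    & forall V : set D, cstar_subalgebra V -> V x -> V y].
Proof.
move=> xs x1; have [y yP] := cauchy_limit (sqrt_approx_cauchy x1).
have near_y (e : R) : 0 < e -> exists n, cnorm (sqrt_approx x n - y) < e /\
    cnorm (sqrt_approx x n.+1 - y) < e.
  move=> /yP[n hn]; exists n; split; apply: hn => //; exact: leqnSn.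
have bnd n : cnorm (sqrt_approx x n) <= 1.
  by apply: le_trans (sqrt_approx_bound n x1) _; case/andP: (sqrt_bound_range R n).
have y1 : cnorm y <= 1.
  apply/ler_addgt0Pl => e /near_y[n [hn _]].
  rewrite -(subrK (sqrt_approx x n) y); apply: le_trans (cnormD _ _) _.
  rewrite cnorm_distC; have := bnd n; lra.
exists y; split=> //.
- apply/eqP; rewrite -subr_eq0; apply/eqP; apply: (@cnorm_small _ 2) => e /near_y.
  move=> [n [hn _]]; apply: le_trans (cnorm_sub_trans (sqrt_approx x n) _ _) _.
  rewrite -{1}(sqrt_approx_star n xs) -starB cnorm_starE cnorm_distC; lra.
- have fixy : 2%:C *: y = x + y * y.
    apply/eqP; rewrite -subr_eq0; apply/eqP.
    apply: (@cnorm_small _ 4) => e /near_y[n [hn hn1]].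
    set z := sqrt_approx x n in hn.
    have zE : x + z * z = 2%:C *: sqrt_approx x n.+1.
      by rewrite /= scalerA -rmorphM /= divff // scale1r.
    apply: le_trans (cnorm_sub_trans (x + z * z) _ _) _.
    rewrite {1}zE -scalerBr cnormZr opprD addrACA subrr add0r.
    have -> : z * z - y * y = (z - y) * z + y * (z - y).
      by rewrite mulrBl mulrBr addrA subrK.
    have := cnormD ((z - y) * z) (y * (z - y)).
    have := cnormM (z - y) z; have := cnormM y (z - y).
    have bz : cnorm z <= 1 by exact: bnd.
    have := cnorm_ge0 (z - y); have := cnorm_ge0 y; have := cnorm_ge0 z.
    rewrite (cnorm_distC y) ger0_norm //; nra.
  by rewrite -fixy (rmorph_nat (real_complex R)) scaler_nat mulr2n.
- move=> z xz; apply/eqP; rewrite -subr_eq0; apply/eqP.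
  apply: (@cnorm_small _ (2 * cnorm z)) => e /near_y[n [hn _]].
  apply: le_trans (cnorm_sub_trans (sqrt_approx x n * z) _ _) _.
  rewrite -mulrBl sqrt_approx_comm // -mulrBr.
  have := cnormM (y - sqrt_approx x n) z; have := cnormM z (sqrt_approx x n - y).
  rewrite (cnorm_distC y); have := cnorm_ge0 z; nra.
- move=> V hV Vx; apply: (csub_closed hV) => e /near_y[n [hn _]].
  exists (sqrt_approx x n); last by rewrite cnorm_distC.
  elim: n {hn} => [|n IH] /=; first exact: csub0 hV.
  by apply: (csubZ hV); apply: (csubD hV) => //; apply: (csubM hV).
Qed.

(** For [w = h + i k] one has [star w * w = h * h + k * k], and [h] is the real
    part of [w]. *)
Lemma commuting_squares_norm h k : star h = h -> star k = k -> h * k = k * h ->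
  cnorm h ^+ 2 <= cnorm (h * h + k * k).
Proof.
move=> hs ks hk; pose w := h + 'i *: k.
have ws : star w = h - 'i *: k.
  rewrite starD starZ hs ks; congr (_ + _); rewrite -scaleNr; congr (_ *: _).
  by apply/eqP; rewrite eq_complex /= oppr0 !eqxx.
have ww : star w * w = h * h + k * k.
  rewrite ws /w mulrDr !mulrBl -!scalerAl -!scalerAr hk scalerA.
  have -> : 'i * 'i = -1 :> R[i] by rewrite -expr2 sqr_i.
  by rewrite scaleN1r opprK addrA subrK.
have hw : 2%:C *: h = w + star w.
  by rewrite ws addrACA subrr addr0 (rmorph_nat (real_complex R)) scaler_nat mulr2n.
have := cnormD w (star w); rewrite -hw cnormZr cnorm_starE ger0_norm //.
rewrite -ww cnorm_star => le2; rewrite ler_sqr ?nnegrE ?cnorm_ge0 //; lra.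
Qed.

Lemma cnorm_1_sub_sqr h : star h = h -> cnorm h <= 1 -> cnorm (1 - h * h) <= 1.
Proof.
move=> hs h1; have hhs : star (h * h) = h * h by rewrite starM hs.
have hh1 : cnorm (h * h) <= 1.
  by rewrite cnorm_sqr //; have := cnorm_ge0 h; nra.
have [y [ys _ /one_sub_square yE yC _]] := sqrt_exists hhs hh1.
have ks : star (1 - y) = 1 - y by rewrite starB star1 ys.
rewrite -yE cnorm_sqr //; apply: le_trans (commuting_squares_norm ks hs _) _.
  by rewrite mulrBl mulrBr mul1r mulr1 yC // mulrA.
by rewrite yE subrK cnorm1.
Qed.

(** Squares of self-adjoint elements. By [cpos_norm] and [cposP], these are also
    the self-adjoint [a] with |t - a| <= t for some number [t], a condition that
    visibly defines a convex cone. *)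
Definition cpos a := exists2 b, star b = b & a = b * b.

Lemma cpos_star a : cpos a -> star a = a.
Proof. by move=> [b bs ->]; rewrite starM bs. Qed.

Lemma cposZ t a : 0 <= t -> cpos a -> cpos (t%:C *: a).
Proof.
move=> t0 [b bs ->]; exists ((Num.sqrt t)%:C *: b); first by rewrite starZr bs.
by rewrite -scalerAl -scalerAr scalerA -rmorphM /= -[X in _ = X%:C *: _]expr2 sqr_sqrtr.
Qed.

Lemma cpos_norm a t : cpos a -> cnorm a <= t -> cnorm (t%:C%:A - a) <= t.
Proof.
move=> [b bs ->]; rewrite cnorm_sqr // => bt.
have t0 : 0 <= t by apply: le_trans bt; rewrite sqr_ge0.
have [t00|tn0] := eqVneq t 0.
  rewrite t00 in bt *.
  have b0 : b = 0.
    apply: cnorm0_eq0; apply/eqP; rewrite -sqrf_eq0; apply/eqP/le_anti.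
    by rewrite bt sqr_ge0.
  by rewrite b0 mulr0 subr0 scale0r cnorm0.
have tp : 0 < t by rewrite lt_neqAle eq_sym tn0.
have sp : 0 < Num.sqrt t by rewrite sqrtr_gt0.
pose h := ((Num.sqrt t)^-1)%:C *: b.
have hs : star h = h by rewrite starZr bs.
have h1 : cnorm h <= 1.
  rewrite cnormZr gtr0_norm ?invr_gt0 // mulrC ler_pdivrMr // mul1r.
  by rewrite -ler_sqr ?nnegrE ?cnorm_ge0 ?sqrtr_ge0 // sqr_sqrtr.
have -> : t%:C%:A - b * b = t%:C *: (1 - h * h).
  rewrite scalerBr -scalerAl -scalerAr !scalerA -!rmorphM /=.
  by rewrite -mulrA -invfM -[X in _ / X]expr2 sqr_sqrtr // divff // scale1r.
rewrite cnormZr ger0_norm //; have := cnorm_1_sub_sqr hs h1; nra.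
Qed.

Lemma cpos_of_norm a t : star a = a -> cnorm (t%:C%:A - a) <= t -> 
  exists b, [/\ star b = b, a = b * b, cnorm ((Num.sqrt t)%:C%:A - b) <= Num.sqrt t
    & forall z, a * z = z * a -> b * z = z * b].
Proof.
move=> sa ta; have t0 : 0 <= t by apply: le_trans ta; exact: cnorm_ge0.
have [t00|tn0] := eqVneq t 0.
  exists 0; move: ta; rewrite t00 scale0r sub0r cnormN => a0.
  have a00 : a = 0 by apply: cnorm0_eq0; apply/le_anti; rewrite a0 cnorm_ge0.
  rewrite star0 a00 mulr0 sqrtr0 scale0r subr0 cnorm0; split=> //.
have tp : 0 < t by rewrite lt_neqAle eq_sym tn0.
pose x := 1 - (t^-1)%:C *: a.
have xs : star x = x by rewrite starB starZr star1 sa.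
have tx : t%:C *: x = t%:C%:A - a.
  by rewrite scalerBr scalerA -rmorphM divff //= scale1r.
have x1 : cnorm x <= 1.
  by rewrite -(ler_pM2l tp) mulr1 -{1}(gtr0_norm tp) -cnormZr tx.
have [y [ys y1 /one_sub_square yE yC _]] := sqrt_exists xs x1.
have ss : star (1 - y) = 1 - y by rewrite starB star1 ys.
exists ((Num.sqrt t)%:C *: (1 - y)); split.
- by rewrite starZr ss.
- rewrite -scalerAl -scalerAr scalerA -rmorphM /= -[X in X%:C]expr2 sqr_sqrtr // yE scalerBr.
  by rewrite tx opprB addrC subrK.
- rewrite scalerBr opprB addrC subrK cnormZr ger0_norm ?sqrtr_ge0 //.
  by have := sqrtr_ge0 t; nra.
- move=> z az; rewrite -scalerAl -scalerAr mulrBl mulrBr mul1r mulr1 yC //.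
  by rewrite mulrBl mulrBr mul1r mulr1 -scalerAl -scalerAr az.
Qed.

Lemma cposP a t : star a = a -> cnorm (t%:C%:A - a) <= t -> cpos a.
Proof. by move=> sa /(cpos_of_norm sa)[b [bs ab _ _]]; exists b. Qed.

Lemma cpos_sqrt a : cpos a -> exists b, [/\ cpos b, a = b * b
    & forall z, a * z = z * a -> b * z = z * b].
Proof.
move=> ap; have [b [bs ab bp bc]] :=
  cpos_of_norm (cpos_star ap) (cpos_norm ap (lexx _)).
by exists b; split=> //; exact: cposP bp.
Qed.

Lemma cposD a b : cpos a -> cpos b -> cpos (a + b).
Proof.
move=> ap bp; apply: (@cposP _ (cnorm a + cnorm b)).
  by rewrite starD !cpos_star.
rewrite rmorphD /= scalerDl opprD addrACA; apply: le_trans (cnormD _ _) _.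
by apply: lerD; apply: cpos_norm.
Qed.

Lemma cpos_alg_sub a t : star a = a -> cnorm a <= t -> cpos (t%:C%:A - a).
Proof.
move=> sa at_; apply: (@cposP _ t); first by rewrite starB star_alg sa.
by rewrite opprB addrC subrK.
Qed.

Lemma cposM a b : cpos a -> cpos b -> a * b = b * a -> cpos (a * b).
Proof.
move=> /cpos_sqrt[p [pp -> pc]] /cpos_sqrt[q [qp -> qc]] ab.
have pq : p * q = q * p by apply/pc/esym/qc/esym.
exists (p * q); first by rewrite starM !cpos_star.
by rewrite -!mulrA; congr (_ * _); rewrite !mulrA pq.
Qed.

(** The square roots of [a] and [s - a] commute, and their squares add up to
    [s]. *)
Lemma cpos_norm_le a s : 0 <= s -> cpos a -> cpos (s%:C%:A - a) -> cnorm a <= s.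
Proof.
move=> s0 /cpos_sqrt[b [bp ab bc]] /cpos_sqrt[c [cp cE cc]].
have bs := cpos_star bp.
rewrite ab cnorm_sqr //; apply: le_trans (commuting_squares_norm bs (cpos_star cp) _) _.
  apply: bc; apply/esym/cc; rewrite mulrBl mulrBr mulr_algl mulr_algr; congr (_ - _).
by rewrite -cE -ab addrC subrK cnorm_alg ger0_norm.
Qed.

Lemma cpos_anti a : cpos a -> cpos (- a) -> a = 0.
Proof.
move=> ap an; apply: cnorm0_eq0; apply/le_anti; rewrite cnorm_ge0 andbT.
by apply: (cpos_norm_le (lexx 0) ap); rewrite scale0r sub0r.
Qed.

(** Normalize to |z| = 1 and put [n = - (star z * z)], a positive element of norm
    1. Then [n + n * n = - (star z * (1 - z * star z) * z)] has norm at most 1, so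
    that [1 - n - n * n] is positive. Adding the positive [n - n * n] gives
    2 |n * n| <= 1, whereas |n * n| = 1. *)
Lemma cpos_neg_square_eq0 z : cpos (z * star z) -> cpos (- (star z * z)) -> z = 0.
Proof.
move=> pz nz; apply/eqP; apply: contraT => z0.
have zp : 0 < cnorm z.
  rewrite lt_neqAle cnorm_ge0 andbT eq_sym; apply/eqP => /cnorm0_eq0/eqP.
  by rewrite (negPf z0).
pose c := (cnorm z)^-1; have c0 : 0 <= c by rewrite invr_ge0 cnorm_ge0.
wlog z1 : z pz nz {z0 zp c c0} / cnorm z = 1.
  move=> /(_ (c%:C *: z)); apply.
  - by rewrite starZr -scalerAl -scalerAr; apply: (cposZ c0); apply: cposZ.
  - by rewrite starZr -scalerAl -scalerAr -!scalerN; apply: (cposZ c0); apply: cposZ.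
  - by rewrite cnormZr ger0_norm // mulVf // gt_eqF.
pose n := - (star z * z).
have ns : star n = n by rewrite starN starM starK.
have n1 : cnorm n = 1 by rewrite cnormN cnorm_star z1 expr1n.
have nE : n + n * n = - (star z * (1 - z * star z) * z).
  by rewrite mulrBr mulr1 mulrBl opprB mulrNN addrC !mulrA.
have le1 : cnorm (n + n * n) <= 1.
  rewrite nE cnormN; apply: le_trans (cnormM _ _) _; rewrite z1 mulr1.
  apply: le_trans (cnormM _ _) _; rewrite cnorm_starE z1 mul1r.
  have := @cpos_norm _ 1 pz; rewrite scale1r; apply.
  by have := cnorm_star (star z); rewrite starK cnorm_starE z1 expr1n => ->.
have p1 : cpos (1%:C%:A - (n + n * n)).
  by apply: cpos_alg_sub => //; rewrite starD starM ns.
have p2 : cpos (n * (1%:C%:A - n)).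
  apply: cposM => //; first by apply: cpos_alg_sub; rewrite ?n1.
  by rewrite scale1r mulrBl mulrBr mul1r mulr1.
have p3 : cpos (1%:C%:A - (n * n + n * n)).
  have := cposD p1 p2; rewrite mulrBr scale1r mulr1 addrA opprD addrA.
  by rewrite [X in cpos (X - _) -> _]addrAC subrK opprD addrA.
have nn : cpos (n * n) by exists n.
have := cpos_norm_le ler01 (cposD nn nn) p3.
rewrite -mulr2n -scaler_nat -(rmorph_nat (real_complex R)) cnormZr cnorm_sqr //.
by rewrite n1 expr1n ger0_norm //; lra.
Qed.

Lemma cpos_abs a : star a = a ->
  exists c, [/\ cpos c, c * c = a * a & forall z, a * z = z * a -> c * z = z * c].
Proof.
move=> sa; have [|c [cp cE cc]] := @cpos_sqrt (a * a); first by exists a.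
exists c; split=> // z az; apply: cc; by rewrite -mulrA az mulrA az mulrA.
Qed.

(** The Kelley--Vaught theorem. With [a = star y * y] and [m = |a| - a], twice the
    negative part of [a], the element [z = y * m] has
    [star z * z = - (|a| * m * m)], which is negative. As
    [z * star z + star z * z] is a sum of squares, [z * star z] is positive, which
    forces [z = 0] and then [m = 0]. *)
Lemma cpos_star_mul y : cpos (star y * y).
Proof.
set a := star y * y; have sa : star a = a by rewrite starM starK.
have [c [cp cE cc]] := cpos_abs sa; have ac := esym (cc a erefl).
pose m := c - a.
have ms : star m = m by rewrite starB sa cpos_star.
have am : a * m = m * a by rewrite mulrBl mulrBr ac.
have cm : c * m = m * c by rewrite mulrBl mulrBr ac.
have amE : a * m = - (c * m).
  by rewrite !mulrBr cE ac opprB.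
have mmE : m * m = 2%:C *: (c * m).
  rewrite {1}/m mulrBl amE opprK (rmorph_nat (real_complex R)) scaler_nat.
  by rewrite mulr2n.
(* Then [star z * z = m * a * m], in which all factors commute with [c]. *)
pose z := y * m.
have zz : star z * z = - (c * m * m).
  by rewrite starM ms mulrA -(mulrA m) -am amE mulNr.
have np : cpos (c * m * m).
  rewrite -mulrA; apply: cposM => //; first by exists m.
  by rewrite mulrA cm -mulrA cm mulrA.
have zp : cpos (z * star z).
  pose p := z + star z; pose q := 'i *: (z - star z).
  have ps : star p = p by rewrite starD starK addrC.
  have qs : star q = q.
    rewrite starZ starB starK -opprB scalerN -scaleNr; congr (_ *: _).
    by apply/eqP; rewrite eq_complex /= oppr0 opprK !eqxx.
  have qq : q * q = - ((z - star z) * (z - star z)).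
    rewrite -scalerAl -scalerAr scalerA -expr2 sqr_i scaleN1r //.
  have E : p * p + q * q + 2%:C *: (c * m * m) = 2%:C *: (z * star z).
    have -> : c * m * m = - (star z * z) by rewrite zz opprK.
    have pp : p * p =
        (z * z + star z * star z) + (z * star z + star z * z).
      by rewrite mulrDl !mulrDr [star z * z + _]addrC addrACA.
    have {}qq : q * q =
        (z * star z + star z * z) - (z * z + star z * star z).
      rewrite qq -[RHS]opprB; congr (- _).
      by rewrite mulrBl !mulrBr opprB addrACA -opprD.
    rewrite pp qq [X in X + (_ - _)]addrC addrACA subrr addr0.
    by rewrite addrACA scalerN !(rmorph_nat (real_complex R)) !scaler_nat !mulr2n addrK.
  have -> : z * star z = (2^-1)%:C *: (2%:C *: (z * star z)).
    by rewrite scalerA -rmorphM mulVf // scale1r.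
  rewrite -E; apply: cposZ; first by rewrite invr_ge0.
  apply: cposD; last by apply: cposZ.
  by apply: cposD; [exists p | exists q].
have z0 : z = 0 by apply: cpos_neg_square_eq0; rewrite ?zz ?opprK.
have mm0 : m * m = 0.
  have mmm : m * m * m = 0.
    rewrite mmE -scalerAl; apply/eqP; rewrite scaler_eq0; apply/orP; right.
    by rewrite -oppr_eq0 -zz z0 mulr0.
  apply: cnorm0_eq0; apply/eqP; rewrite -sqrf_eq0 -cnorm_sqr ?starM ?ms //.
  by rewrite mulrA mmm mul0r cnorm0.
have m0 : m = 0.
  by apply: cnorm0_eq0; apply/eqP; rewrite -sqrf_eq0 -cnorm_sqr // mm0 cnorm0.
by rewrite -(subrK a c) -/m m0 add0r in cp.
Qed.

End Positivity.

(** * Homomorphisms of C*-algebras *)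

Section StarHom.
Variables (R : realType) (B D : cstarType R).

(** Homomorphisms defined on a subalgebra only, such as a gauge action. *)
Record starhom_on (V : set B) (f : B -> D) : Prop := {
  starhom_onD : forall x y, V x -> V y -> f (x + y) = f x + f y;
  starhom_onZ : forall (c : R[i]) x, V x -> f (c *: x) = c *: f x;
  starhom_onM : forall x y, V x -> V y -> f (x * y) = f x * f y;
  starhom_on_star : forall x, V x -> f (star x) = star (f x)
}.

Lemma cpos_cube_eq0 (x : B) : star x = x -> x * x * x = 0 -> x = 0.
Proof.
move=> xs x3; have xx0 : x * x = 0.
  apply: cnorm0_eq0; apply/eqP; rewrite -sqrf_eq0 -cnorm_sqr ?starM ?xs //.
  by rewrite mulrA x3 mul0r cnorm0.
by apply: cnorm0_eq0; apply/eqP; rewrite -sqrf_eq0 -cnorm_sqr // xx0 cnorm0.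
Qed.

(** The element [e] is twice the positive part of [c], that is, [|c| + c]. *)
Lemma positive_part (c : B) : star c = c -> exists e,
  [/\ star e = e, e * e = e * c + e * c, cpos (e * c * e) & e = 0 -> cpos (- c)].
Proof.
move=> sc; have [d [dp dE dc]] := cpos_abs sc.
have cd : c * d = d * c by rewrite dc.
exists (d + c).
have de : d * (d + c) = (d + c) * d by rewrite mulrDr mulrDl cd.
have ce : c * (d + c) = d * (d + c) by rewrite !mulrDr dE cd addrC.
have ec : (d + c) * c = c * (d + c) by rewrite mulrDr mulrDl cd.
have se : star (d + c) = d + c by rewrite starD sc cpos_star.
split=> //.
- by rewrite {2}[d + c]addrC mulrDr -de -ce -ec.
- rewrite ec ce -mulrA; apply: cposM => //; first by exists (d + c).
  by rewrite mulrA de -mulrA de mulrA.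
- by move=> /eqP; rewrite addr_eq0 => /eqP <-.
Qed.

(** It suffices to treat a self-adjoint [a] with |a| <= 1. If [1 - y] is the square
    root of [1 - a * a], then [f a * f a + (1 - f y) * (1 - f y) = 1] with commuting
    self-adjoint terms, which bounds [f a] by 1. *)
Lemma starhom_on_contractive (V : set B) (f : B -> D) x :
  cstar_subalgebra V -> starhom_on V f -> V x -> cnorm (f x) <= cnorm x.
Proof.
move=> hV fP Vx; have [_ VD VZ VM VS _] := hV; have [fD fZ fM fS] := fP.
have unit_ball a : V a -> star a = a -> cnorm a <= 1 -> cnorm (f a) <= 1.
  move=> Va sa a1; have Vaa := VM _ _ Va Va.
  have saa : star (a * a) = a * a by rewrite starM sa.
  have aa1 : cnorm (a * a) <= 1.
    by rewrite cnorm_sqr //; have := cnorm_ge0 a; nra.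
  have [y [ys _ yy yC yV]] := sqrt_exists saa aa1.
  have Vy := yV V hV Vaa.
  have fyy : f y + f y = f a * f a + f y * f y.
    by rewrite -fD // yy fD // ?fM //; apply: VM.
  have sfy : star (1 - f y) = 1 - f y by rewrite starB star1 -fS // ys.
  have sfa : star (f a) = f a by rewrite -fS // sa.
  have comm : f a * (1 - f y) = (1 - f y) * f a.
    by rewrite mulrBr mulrBl mulr1 mul1r -!fM // yC // mulrA.
  have := commuting_squares_norm sfa sfy comm.
  have -> : f a * f a + (1 - f y) * (1 - f y) = 1.
    by rewrite (one_sub_square fyy) addrC subrK.
  by rewrite cnorm1 => h; have := cnorm_ge0 (f a); nra.
have f0 : f 0 = 0 by rewrite -(scale0r x) fZ // !scale0r.
have [x0|x0] := eqVneq (cnorm x) 0; first by rewrite (cnorm0_eq0 _ x0) f0 !cnorm0.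
have xp : 0 < cnorm x by rewrite lt_neqAle eq_sym x0 cnorm_ge0.
pose t := cnorm x ^+ 2; have tp : 0 < t by rewrite exprn_gt0.
have Va : V (star x * x) by apply: VM => //; apply: VS.
have := unit_ball ((t^-1)%:C *: (star x * x)).
rewrite fZ // fM //; last exact: VS.
rewrite fS // starZr starM starK !cnormZr !cnorm_star -/t.
rewrite gtr0_norm ?invr_gt0 // mulVf ?gt_eqF // => /(_ (VZ _ _ Va) erefl (lexx _)).
by rewrite mulrC ler_pdivrMr // mul1r ler_sqr ?nnegrE ?cnorm_ge0.
Qed.

Lemma starhom_setT (f : B -> D) : starhom f -> starhom_on setT f.
Proof. by case=> fD fZ fM fS; split=> *; rewrite ?fD ?fZ ?fM ?fS. Qed.

Lemma cstar_subalgebra_setT : cstar_subalgebra (setT : set B).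
Proof. by []. Qed.

Lemma starhom_contractive (f : B -> D) x : starhom f -> cnorm (f x) <= cnorm x.
Proof.
move=> /starhom_setT fP.
exact: (starhom_on_contractive cstar_subalgebra_setT fP).
Qed.

(** For positive [a], put s = |f a|. The positive part of [a - s] is killed by
    [f], as [f a <= s]; by injectivity it vanishes, that is, [a <= s]. *)
Lemma starhom_isometric (f : B -> D) x :
  starhom f -> injective f -> cnorm (f x) = cnorm x.
Proof.
move=> fP finj; have [fD fZ fM fS] := fP.
have f0 : f 0 = 0 by rewrite -(scale0r (0 : B)) fZ scale0r.
have fN a : f (- a) = - f a by rewrite -scaleN1r fZ scaleN1r.
have fcpos a : cpos a -> cpos (f a).
  by move=> [b bs ->]; exists (f b); rewrite ?fM // -fS bs.
have below a : cpos a -> cnorm a <= cnorm (f a).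
  move=> ap; set s := cnorm (f a); have s0 : 0 <= s := cnorm_ge0 _.
  pose c := a - s%:C%:A.
  have sc : star c = c by rewrite starB star_alg cpos_star.
  have [e [se ee pece ec0]] := positive_part sc.
  (* [f (e * c * e)] is positive since [e * c * e] is, and negative since
     [f c <= 0]. *)
  have fece : f (e * c * e) = - (star (f e) * (s%:C%:A - f a) * f e).
    rewrite !fM -fS se fD fN fZ !mulrDr !mulrDl !mulrN !mulNr.
    rewrite -scalerAr -scalerAl -[f e * f 1]fM mulr1.
    by rewrite mulr_algr -scalerAl opprB.
  have nece : cpos (- f (e * c * e)).
    have /cpos_alg_sub : star (f a) = f a by rewrite cpos_star //; apply: fcpos.
    move=> /(_ s (lexx _)) [g sg gE].
    have -> : - f (e * c * e) = star (g * f e) * (g * f e).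
      by rewrite fece opprK gE starM sg !mulrA.
    exact: cpos_star_mul.
  have ece0 : e * c * e = 0.
    by apply: finj; rewrite f0; apply: cpos_anti => //; apply: fcpos.
  have e0 : e = 0.
    apply: cpos_cube_eq0 => //.
    by rewrite ee mulrDl ece0 addr0.
  by apply: cpos_norm_le => //; rewrite -opprB; apply: ec0.
apply/le_anti; rewrite starhom_contractive //=.
rewrite -ler_sqr ?nnegrE ?cnorm_ge0 // -!cnorm_star -fS -fM.
exact/below/cpos_star_mul.
Qed.

End StarHom.

(** * The Hahn--Banach theorem and states *)

Section HahnBanach.
Variables (R : realType) (V : lmodType R[i]) (p : V -> R).
Hypothesis pD : forall x y, p (x + y) <= p x + p y.
Hypothesis pZ : forall (t : R) x, 0 <= t -> p (t%:C *: x) = t * p x.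

(** A real-linear functional on a subspace, dominated by [p], is handled as its
    graph; domination at 0 makes such a graph single-valued. *)
Record dominated_graph (G : set (V * R)) : Prop := {
  graphD : forall x r y s, G (x, r) -> G (y, s) -> G (x + y, r + s);
  graphZ : forall t x r, G (x, r) -> G (t%:C *: x, t * r);
  graph_le : forall x r, G (x, r) -> r <= p x
}.

Lemma sublinear0 : p 0 = 0.
Proof. by have := pZ 0 (lexx 0); rewrite scaler0 mul0r. Qed.

Lemma dominated_graph_fun G x r s : dominated_graph G ->
  G (x, r) -> G (x, s) -> r = s.
Proof.
move=> [GD GZ Gp] xr xs.
have le r' s' : G (x, r') -> G (x, s') -> r' <= s'.
  move=> xr' xs'; rewrite -subr_le0 -sublinear0; apply: Gp.
  have := GD _ _ _ _ xr' (GZ (-1) _ _ xs').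
  by rewrite rmorphN1 scaleN1r subrr mulN1r.
by apply/le_anti; rewrite !le.
Qed.

(** The value [c] at [x0] has to lie above all [r - p (x - x0)] and below all
    [p (y + x0) - s], for (x, r) and (y, s) in the graph. *)
Lemma dominated_graph_extend G x0 : dominated_graph G -> G !=set0 ->
  exists c, dominated_graph
    [set q | exists t x r, G (x, r) /\ q = (x + t%:C *: x0, r + t * c)].
Proof.
move=> [GD GZ Gp] [[x1 r1] G1].
pose S := [set z | exists x r, G (x, r) /\ z = r - p (x - x0)].
have ubS y s : G (y, s) -> ubound S (p (y + x0) - s).
  move=> ys _ [x [r [xr ->]]]; have := Gp _ _ (GD _ _ _ _ xr ys).
  have := pD (x - x0) (y + x0); rewrite addrACA addNr addr0; lra.
have supS : has_sup S.
  split; first by exists (r1 - p (x1 - x0)), x1, r1.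
  by exists (p (x1 + x0) - r1); exact: ubS.
exists (sup S); set c := sup S; split.
- move=> x r y s [t [x' [r' [xr [-> ->]]]]] [t' [y' [s' [ys [-> ->]]]]].
  exists (t + t'), (x' + y'), (r' + s'); split; first exact: GD.
  by rewrite rmorphD /= scalerDl addrACA; congr (_, _); rewrite mulrDl addrACA.
- move=> a x r [t [x' [r' [xr [-> ->]]]]].
  exists (a * t), (a%:C *: x'), (a * r'); split; first exact: GZ.
  by rewrite scalerDr scalerA -rmorphM mulrDr mulrA.
- move=> x r [t [x' [r' [xr [-> ->]]]]].
  have [t0|t0|->] := ltgtP t 0; last first.
  + by rewrite mul0r scale0r !addr0; apply: Gp.
  + have le_c : c <= p ((t^-1)%:C *: x' + x0) - t^-1 * r'.
      by apply: ge_sup; [case: supS | exact/ubS/GZ].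
    have -> : x' + t%:C *: x0 = t%:C *: ((t^-1)%:C *: x' + x0).
      by rewrite scalerDr scalerA -rmorphM divff ?gt_eqF //= scale1r.
    rewrite pZ; last exact: ltW.
    move: le_c; rewrite -(ler_pM2l t0) mulrBr mulrA.
    by rewrite divff ?gt_eqF // mul1r lerBrDr addrC.
  + have [a a0 tE] : exists2 a, 0 < a & t = - a.
      by exists (- t); rewrite ?oppr_gt0 ?opprK.
    have le_c : a^-1 * r' - p ((a^-1)%:C *: x' - x0) <= c.
      apply: ub_le_sup; first by case: supS.
      by exists ((a^-1)%:C *: x'), (a^-1 * r'); split=> //; exact: GZ.
    have -> : x' + t%:C *: x0 = a%:C *: ((a^-1)%:C *: x' - x0).
      rewrite scalerBr scalerA -rmorphM divff ?gt_eqF //= scale1r.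
      by rewrite tE rmorphN scaleNr.
    rewrite pZ; last exact: ltW.
    have -> : r' = a * (a^-1 * r').
      by rewrite mulrA divff ?gt_eqF // mul1r.
    rewrite tE mulNr -mulrBr ler_pM2l //; lra.
Qed.

Lemma hahn_banach (b : V) : exists g : V -> R,
  [/\ forall x y, g (x + y) = g x + g y, forall t x, g (t%:C *: x) = t * g x,
      forall x, g x <= p x & g b = p b].
Proof.
pose P := [set G | dominated_graph G /\ (G !=set0 -> G (b, p b))].
have [|G [[Gdom Gb] Gmax]] := @Zorn_bigcup _ P.
  move=> F FP Ftot; split; last first.
    by move=> [q [X FX Xq]]; exists X => //; apply: (FP X FX).2; exists q.
  split.
  - move=> x r y s [X FX Xx] [Y FY Yy].
    have [XY|YX] := Ftot X Y FX FY; [exists Y|exists X] => //.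
      by apply: (graphD (FP Y FY).1) => //; exact: XY.
    by apply: (graphD (FP X FX).1) => //; exact: YX.
  - by move=> t x r [X FX Xx]; exists X => //; apply: (graphZ (FP X FX).1).
  - by move=> x r [X FX Xx]; apply: (graph_le (FP X FX).1).
have G0 : G !=set0.
  apply: contrapT => /set0P/negP/negPn/eqP GE.
  apply: (Gmax [set q | exists t, q = (t%:C *: b, t * p b)]).
    split; first by rewrite GE.
    by rewrite GE => /(_ (0%:C *: b, 0 * p b)); apply; exists 0.
  split; last by move=> _; exists 1; rewrite scale1r mul1r.
  split.
  - move=> x r y s [t [-> ->]] [t' [-> ->]]; exists (t + t').
    by rewrite rmorphD /= scalerDl mulrDl.
  - by move=> a x r [t [-> ->]]; exists (a * t); rewrite scalerA -rmorphM mulrA.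
  - move=> x r [t [-> ->]]; have [t0|t0] := leP 0 t; first by rewrite pZ.
    have := pD (t%:C *: b) ((- t)%:C *: b).
    rewrite rmorphN /= -scalerDl subrr scale0r sublinear0 -rmorphN /=.
    rewrite [p ((- t)%:C *: b)]pZ; last by lra.
    by rewrite mulNr; lra.
have G00 : G (0, 0).
  by case: G0 => [[x r] /(graphZ Gdom 0)]; rewrite scale0r mul0r.
have total x0 : exists r, G (x0, r).
  apply: contrapT => nx0; have [c cP] := dominated_graph_extend x0 Gdom G0.
  apply: (Gmax _ _ (conj cP _)).
    split.
      move=> [x r] xr; exists 0, x, r; split=> //.
      by rewrite scale0r mul0r !addr0.
    move=> /(_ (x0, c)) h; apply: nx0; exists c; apply: h.
    by exists 1, 0, 0; split=> //; rewrite scale1r mul1r !add0r.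
  move=> _; exists 0, b, (p b); split; first exact: Gb.
  by rewrite scale0r mul0r !addr0.
pose g x := projT1 (cid (total x)).
have gP x : G (x, g x) := projT2 (cid (total x)).
have gE x r : G (x, r) -> g x = r by apply: dominated_graph_fun (gP x).
exists g; split.
- by move=> x y; apply/gE/(graphD Gdom).
- by move=> t x; apply/gE/(graphZ Gdom).
- by move=> x; apply: (graph_le Gdom).
- exact/gE/Gb.
Qed.

End HahnBanach.

Section States.
Variables (R : realType) (D : cstarType R).

Record state (f : D -> R[i]) : Prop := {
  stateD : forall x y, f (x + y) = f x + f y;
  stateZ : forall (c : R[i]) x, f (c *: x) = c * f x;
  state_star : forall x, f (star x) = (f x)^*%C;
  state_ge0 : forall x, 0 <= f (star x * x);
  state1 : f 1 = 1
}.

(** For t = |1 + a|, both [a] and [t - 1 - a] are positive, so |a| <= t - 1. *)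
Lemma cnorm_1D_cpos (a : D) : cpos a -> cnorm (1 + a) = 1 + cnorm a.
Proof.
move=> ap; apply/le_anti/andP; split.
  by apply: le_trans (cnormD _ _) _; rewrite cnorm1.
have p1 : cpos (1 : D) by exists 1; rewrite ?star1 ?mulr1.
set t := cnorm (1 + a).
have ta : cpos (t%:C%:A - (1 + a)).
  by apply: cpos_alg_sub => //; apply/cpos_star/cposD.
have t0 : 0 <= t := cnorm_ge0 _.
have t1 : 1 <= t.
  rewrite -(cnorm1 D); apply: cpos_norm_le => //.
  by have := cposD ta ap; rewrite opprD addrA subrK.
rewrite -lerBrDl; apply: cpos_norm_le => //; first by lra.
by rewrite rmorphB /= scalerBl scale1r -addrA -opprD.
Qed.

(** Let [a = star x * x], and let [g] be a real functional of norm 1 with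
    g (1 + a) = |1 + a| = 1 + |a|. Then necessarily g 1 = 1 and g a = |a|. From
    g 1 = 1 and | |y| - y | <= |y| for positive [y], it follows that [g] is
    positive. The state is the complexification of [g]. *)
Lemma norm_attaining_state (x : D) :
  exists2 f, state f & f (star x * x) = (cnorm x ^+ 2)%:C.
Proof.
pose a := star x * x; have ap : cpos a := cpos_star_mul x.
have [||g [gD gZ gle gb]] := @hahn_banach R D (@cnorm R D) _ _ (1 + a).
- exact: cnormD.
- by move=> t y t0; rewrite cnormZr ger0_norm.
have [g1 ga] : g 1 = 1 /\ g a = cnorm a.
  have := gle 1; have := gle a; move: gb.
  rewrite gD cnorm_1D_cpos // cnorm1; lra.
have gN y : g (- y) = - g y.
  by rewrite -scaleN1r -(rmorphN1 (real_complex R)) gZ mulN1r.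
have gpos y : cpos y -> 0 <= g y.
  move=> yp; have := gle ((cnorm y)%:C%:A - y).
  have := cpos_norm yp (lexx _); rewrite gD gN gZ g1; lra.
(* [G] is [g] of the self-adjoint part, which makes [f] compatible with [star]. *)
pose G y := 2^-1 * g (y + star y).
have GD y z : G (y + z) = G y + G z.
  by rewrite /G starD addrACA gD mulrDr.
have GZ t y : G (t%:C *: y) = t * G y.
  by rewrite /G starZr -scalerDr gZ mulrCA.
have GN y : G (- y) = - G y.
  by rewrite -scaleN1r -(rmorphN1 (real_complex R)) GZ mulN1r.
have Gstar y : G (star y) = G y by rewrite /G starK addrC.
have Gsa y : star y = y -> G y = g y.
  by move=> ys; rewrite /G ys gD; lra.
pose f y := G y +i* - G ('i *: y).
have ii y : 'i *: ('i *: y) = - y :> D by rewrite scalerA -expr2 sqr_i scaleN1r.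
have fsa y : star y = y -> f y = (g y)%:C.
  move=> ys; have h : G ('i *: y) = 0.
    have : G ('i *: y) = - G ('i *: y).
      rewrite -GN -[in RHS]Gstar starN starZ ys -scaleNr; congr (G (_ *: _)).
      by apply/eqP; rewrite eq_complex /= opprK oppr0 !eqxx.
    lra.
  by rewrite /f h oppr0 Gsa.
have fD y z : f (y + z) = f y + f z.
  by rewrite /f scalerDr !GD opprD.
have fR t y : f (t%:C *: y) = t%:C * f y.
  rewrite /f scalerA mulrC -scalerA !GZ -mulrN.
  by apply/eqP; rewrite eq_complex /= !mul0r subr0 addr0 !eqxx.
have fi y : f ('i *: y) = 'i * f y.
  rewrite /f ii GN opprK.
  by apply/eqP; rewrite eq_complex /=; apply/andP; split; apply/eqP; ring.
exists f; last by rewrite -/a (fsa a (cpos_star ap)) ga cnorm_star.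
split=> //.
- move=> c y; rewrite [c]complexE scalerDl -scalerA fD fR fi fR.
  by rewrite mulrDl mulrA.
- move=> y; rewrite /f Gstar.
  have -> : 'i *: star y = - star ('i *: y).
    rewrite starZ -scaleNr; congr (_ *: _).
    by apply/eqP; rewrite eq_complex /= opprK oppr0 !eqxx.
  by rewrite GN Gstar.
- by move=> y; rewrite (fsa _ (cpos_star (cpos_star_mul y))) ler0c; exact/gpos/cpos_star_mul.
- by rewrite fsa ?star1 // g1.
Qed.

End States.

(** * Limits of complex sequences and semi-inner products *)

Section ComplexLimits.
Variable R : realType.
Implicit Types (z w : R[i]) (s : nat -> R[i]).

Definition cvgC s z := forall e : R, 0 < e ->
  \forall n \near \oo, cmod (s n - z) < e.

Lemma real_cauchy_lim (r : nat -> R) :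
  (forall e : R, 0 < e -> exists n0 : nat, forall m n : nat,
     (n0 <= m)%N -> (n0 <= n)%N -> `|r m - r n| < e) ->
  exists l : R, forall e : R, 0 < e -> \forall n \near \oo, `|r n - l| < e.
Proof.
move=> rC; suff /cvgrPdist_lt rl : cvgn r.
  exists (limn r) => e /rl; apply: filterS => n /=; by rewrite distrC.
apply/cauchy_cvgP/cauchy_exP => e /rC[n0 hn0].
exists (r n0); exists n0 => // n /= hn; apply: hn0 => //.
Qed.

Lemma cvgC_cauchy s :
  (forall e : R, 0 < e -> exists n0 : nat, forall m n : nat,
     (n0 <= m)%N -> (n0 <= n)%N -> cmod (s m - s n) < e) ->
  exists z, cvgC s z.
Proof.
move=> sC.
have [|a ha] := @real_cauchy_lim (fun n => complex.Re (s n)).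
  move=> e /sC[n0 hn0]; exists n0 => m n hm hn.
  by apply: le_lt_trans (hn0 m n hm hn); rewrite -raddfB /= Re_le_cmod.
have [|b hb] := @real_cauchy_lim (fun n => complex.Im (s n)).
  move=> e /sC[n0 hn0]; exists n0 => m n hm hn.
  by apply: le_lt_trans (hn0 m n hm hn); rewrite -raddfB /= Im_le_cmod.
exists (a +i* b) => e e0; near=> n.
apply: le_lt_trans (cmod_le_ReIm _) _; rewrite !raddfB /= [e]splitr.
by apply: ltrD; near: n; [apply: ha|apply: hb]; rewrite divr_gt0.
Unshelve. all: by end_near. Qed.

Lemma cvgC_unique s z w : cvgC s z -> cvgC s w -> z = w.
Proof.
move=> sz sw; apply/eqP; rewrite -subr_eq0; apply/eqP/cmod_eq0/le_anti.
rewrite cmod_ge0 andbT; apply/ler_addgt0Pl => e e0; rewrite addr0.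
near \oo => n.
have -> : z - w = (s n - w) - (s n - z) by rewrite opprB [RHS]addrC addrA subrK.
apply: le_trans (cmodD _ _) _; rewrite cmodN [e]splitr.
by apply: lerD; apply: ltW; near: n; [apply: sw|apply: sz]; rewrite divr_gt0.
Unshelve. all: by end_near. Qed.

Lemma cvgC_cst z : cvgC (fun=> z) z.
Proof. by move=> e e0; near=> n; rewrite subrr /cmod normr0. 
Unshelve. all: by end_near. Qed.

Lemma cvgC_add s s' z w : cvgC s z -> cvgC s' w ->
  cvgC (fun n => s n + s' n) (z + w).
Proof.
move=> sz sw e e0; near=> n.
rewrite opprD addrACA; apply: le_lt_trans (cmodD _ _) _; rewrite [e]splitr.
by apply: ltrD; near: n; [apply: sz|apply: sw]; rewrite divr_gt0.
Unshelve. all: by end_near. Qed.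

Lemma cvgC_scale c s z : cvgC s z -> cvgC (fun n => c * s n) (c * z).
Proof.
move=> sz e e0; have c1 : 0 < cmod c + 1 by rewrite ltr_wpDl ?cmod_ge0.
near=> n; rewrite -mulrBr cmodM.
have : cmod (s n - z) < e / (cmod c + 1).
  by near: n; apply: sz; rewrite divr_gt0.
rewrite ltr_pdivlMr // => h.
have := cmod_ge0 (s n - z); have := cmod_ge0 c; nra.
Unshelve. all: by end_near. Qed.

Lemma cvgC_conj s z : cvgC s z -> cvgC (fun n => (s n)^*%C) (z^*)%C.
Proof.
move=> sz e /sz; apply: filterS => n; by rewrite -rmorphB cmod_conj.
Qed.

Lemma cvgC_cmod_le s z (C : R) : cvgC s z -> (\forall n \near \oo, cmod (s n) <= C) ->
  cmod z <= C.
Proof.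
move=> sz hC; apply/ler_addgt0Pl => e e0; near \oo => n.
have -> : z = s n - (s n - z) by rewrite opprB addrC subrK.
apply: le_trans (cmodD _ _) _; rewrite cmodN addrC; apply: lerD.
  by apply: ltW; near: n; apply: sz.
by near: n.
Unshelve. all: by end_near. Qed.

Lemma cvgC_ge0 s z : cvgC s z -> (forall n, 0 <= s n) -> 0 <= z.
Proof.
move=> sz s0.
have snR n : s n = (cmod (s n))%:C by rewrite -cmodE ger0_norm.
have -> : z = (cmod z)%:C; last by rewrite ler0c cmod_ge0.
apply: (cvgC_unique sz) => e e0; apply: filterS (sz e e0) => n h.
rewrite snR -rmorphB cmod_real; apply: le_lt_trans h.
have := cmodD (s n - z) z; have := cmodD (z - s n) (s n).
by rewrite !subrK -(cmodN (z - _)) opprB ler_distl; move=> ? ?; apply/andP; split; lra.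
Qed.

End ComplexLimits.

Section SemiInner.
Variables (R : realType) (V : lmodType R[i]).

(** Possibly degenerate inner products. *)
Record semi_inner := SemiInner {
  sip : V -> V -> R[i];
  sipDr : forall x y z, sip x (y + z) = sip x y + sip x z;
  sipZr : forall (c : R[i]) x y, sip x (c *: y) = c * sip x y;
  sip_conj : forall x y, (sip x y)^*%C = sip y x;
  sip_ge0 : forall x, 0 <= sip x x
}.

Variable F : semi_inner.
Implicit Types x y : V.

Definition sip_norm x : R := Num.sqrt (complex.Re (sip F x x)).

Lemma sip_norm_ge0 x : 0 <= sip_norm x. Proof. exact: sqrtr_ge0. Qed.

Lemma sipxx x : sip F x x = (sip_norm x ^+ 2)%:C.
Proof.
have := sip_ge0 F x; rewrite lecE /= => /andP[/eqP i0 r0].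
by rewrite sqr_sqrtr //; apply/eqP; rewrite eq_complex /= i0 !eqxx.
Qed.

Lemma sipDl x y z : sip F (x + y) z = sip F x z + sip F y z.
Proof. by rewrite -sip_conj sipDr rmorphD /= !sip_conj. Qed.

Lemma sipZl c x y : sip F (c *: x) y = (c^*)%C * sip F x y.
Proof. by rewrite -sip_conj sipZr rmorphM /= sip_conj. Qed.

Lemma sipNr x y : sip F x (- y) = - sip F x y.
Proof. by rewrite -scaleN1r sipZr mulN1r. Qed.

Lemma sipNl x y : sip F (- x) y = - sip F x y.
Proof. by rewrite -sip_conj sipNr rmorphN /= sip_conj. Qed.

Lemma cauchy_schwarz x y : cmod (sip F x y) <= sip_norm x * sip_norm y.
Proof.
rewrite -ler_sqr ?nnegrE ?cmod_ge0 ?mulr_ge0 ?sip_norm_ge0 // exprMn.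
set z := sip F x y; set a := sip_norm x ^+ 2; set b := sip_norm y ^+ 2.
have a0 : 0 <= a by rewrite sqr_ge0.
have b0 : 0 <= b by rewrite sqr_ge0.
have n0 : 0 <= cmod z ^+ 2 by rewrite sqr_ge0.
have quad (t : R) : 0 <= a - 2 * t * cmod z ^+ 2 + t ^+ 2 * cmod z ^+ 2 * b.
  have := sip_ge0 F (x - (t%:C * z^*%C) *: y).
  rewrite sipDr !sipDl !sipNr !sipNl !sipZr !sipZl !sipxx -(sip_conj F x y) -/z -/a -/b.
  rewrite opprK cmod_sqr; case: z n0 => p q _; rewrite lecE /= => /andP[_] h.
  apply: le_trans h _; rewrite le_eqVlt; apply/orP; left; apply/eqP; ring.
have [b00|bn0] := eqVneq b 0.
  rewrite b00 mulr0; have [->//|zn0] := eqVneq (cmod z ^+ 2) 0.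
  have := quad ((a + 1) / (2 * cmod z ^+ 2)); rewrite b00 mulr0 addr0.
  have -> : 2 * ((a + 1) / (2 * cmod z ^+ 2)) * cmod z ^+ 2 = a + 1.
    by field; rewrite -sqrf_eq0 zn0.
  lra.
have bp : 0 < b by rewrite lt_neqAle eq_sym bn0.
(* The quadratic form is least at t = 1/b. *)
have := quad b^-1.
have -> : a - 2 * b^-1 * cmod z ^+ 2 + b^-1 ^+ 2 * cmod z ^+ 2 * b =
  (a * b - cmod z ^+ 2) / b by field.
by rewrite pmulr_lge0 ?invr_gt0 // subr_ge0.
Qed.

Lemma sip_normD x y : sip_norm (x + y) <= sip_norm x + sip_norm y.
Proof.
rewrite -ler_sqr ?nnegrE ?addr_ge0 ?sip_norm_ge0 //.
have : (sip_norm (x + y) ^+ 2)%:C =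
    (sip_norm x ^+ 2)%:C + (sip_norm y ^+ 2)%:C + (sip F x y + sip F y x).
  rewrite -!sipxx sipDr !sipDl -!addrA; congr (_ + _).
  by rewrite addrA [X in X + _]addrC addrC.
move=> /(congr1 (@complex.Re R)) /= ->.
rewrite -(sip_conj F x y); have := cauchy_schwarz x y.
have := Re_le_cmod (sip F x y); rewrite ler_norml => /andP[_].
by case: (sip F x y) => p q /=; nra.
Qed.

Lemma sip_normZ c x : sip_norm (c *: x) = cmod c * sip_norm x.
Proof.
apply/eqP; rewrite -(@eqrXn2 _ 2) ?mulr_ge0 ?cmod_ge0 ?sip_norm_ge0 //.
apply/eqP/complexI; rewrite -sipxx sipZr sipZl sipxx exprMn mulrA [RHS]rmorphM.
congr (_ * _); rewrite cmod_sqr; apply/eqP; case: c => p q.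
by rewrite eq_complex /=; apply/andP; split; apply/eqP; ring.
Qed.

Lemma sip_normN x : sip_norm (- x) = sip_norm x.
Proof. by rewrite -scaleN1r sip_normZ cmodN (cmod_real 1) normr1 mul1r. Qed.

Lemma sip_norm_distC x y : sip_norm (x - y) = sip_norm (y - x).
Proof. by rewrite -sip_normN opprB. Qed.

Lemma sip_norm_sub_trans y x z : sip_norm (x - z) <= sip_norm (x - y) + sip_norm (y - z).
Proof. by rewrite -{1}(subrK y x) -addrA; apply: sip_normD. Qed.

End SemiInner.

(** * Completion of a semi-inner product space *)

Section Completion.
Variables (R : realType) (V : lmodType R[i]) (F : semi_inner V).
Implicit Types (s t : nat -> V) (f g : V -> R[i]^o).

Definition sip_cauchy s := forall e : R, 0 < e -> exists n0 : nat,
  forall m n : nat, (n0 <= m)%N -> (n0 <= n)%N -> sip_norm F (s m - s n) < e.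

Definition represents s f :=
  sip_cauchy s /\ forall y, cvgC (fun n => sip F y (s n)) (f y).

Lemma sip_cauchy_bounded s : sip_cauchy s ->
  exists2 C : R, 0 <= C & \forall n \near \oo, sip_norm F (s n) <= C.
Proof.
move=> /(_ 1 ltr01)[n0 hn0]; exists (sip_norm F (s n0) + 1).
  by rewrite addr_ge0 ?sip_norm_ge0.
exists n0 => // n /= hn; have := hn0 n n0 hn (leqnn _).
have := sip_normD F (s n0) (s n - s n0); rewrite addrC subrK; lra.
Qed.

Lemma sip_cauchyD s t : sip_cauchy s -> sip_cauchy t -> sip_cauchy (fun n => s n + t n).
Proof.
move=> sC tC e e0; have e2 : 0 < e / 2 by rewrite divr_gt0.
have [n1 h1] := sC _ e2; have [n2 h2] := tC _ e2.
exists (maxn n1 n2) => m n; rewrite !geq_max => /andP[m1 m2] /andP[k1 k2].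
rewrite opprD addrACA; apply: le_lt_trans (sip_normD _ _ _) _.
by have := h1 m n m1 k1; have := h2 m n m2 k2; lra.
Qed.

Lemma sip_cauchyZ c s : sip_cauchy s -> sip_cauchy (fun n => c *: s n).
Proof.
move=> sC e e0; have c1 : 0 < cmod c + 1 by rewrite ltr_wpDl ?cmod_ge0.
have [n0 h0] := sC (e / (cmod c + 1)) (divr_gt0 e0 c1).
exists n0 => m n hm hn; rewrite -scalerBr sip_normZ.
have := h0 m n hm hn; rewrite ltr_pdivlMr //.
by have := sip_norm_ge0 F (s m - s n); have := cmod_ge0 c; nra.
Qed.

Lemma sip_cauchy_cst x : sip_cauchy (fun=> x).
Proof.
move=> e e0; exists 0%N => m n _ _.
by have := sip_normZ F 0 x; rewrite scale0r subrr (cmod_real 0) normr0 mul0r => ->.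
Qed.

Lemma represents_exists s : sip_cauchy s -> exists f, represents s f.
Proof.
move=> sC; suff lim y : exists z, cvgC (fun n => sip F y (s n)) z.
  by exists (fun y => projT1 (cid (lim y))); split=> // y; exact: projT2 (cid (lim y)).
apply: cvgC_cauchy => e e0.
have c1 : 0 < sip_norm F y + 1 by rewrite ltr_wpDl ?sip_norm_ge0.
have [n0 h0] := sC (e / (sip_norm F y + 1)) (divr_gt0 e0 c1).
exists n0 => m n hm hn; rewrite -sipNr -sipDr.
apply: le_lt_trans (cauchy_schwarz _ _ _) _.
have := h0 m n hm hn; rewrite ltr_pdivlMr //.
by have := sip_norm_ge0 F (s m - s n); have := sip_norm_ge0 F y; nra.
Qed.

Lemma representsD s t f g : represents s f -> represents t g ->
  represents (fun n => s n + t n) (f + g).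
Proof.
move=> [sC sf] [tC tg]; split; first exact: sip_cauchyD.
move=> y e /(cvgC_add (sf y) (tg y)); apply: filterS => n.
by rewrite sipDr.
Qed.

Lemma representsZ c s f : represents s f ->
  represents (fun n => c *: s n) (c *: f).
Proof.
move=> [sC sf]; split; first exact: sip_cauchyZ.
move=> y e /(cvgC_scale c (sf y)); apply: filterS => n.
by rewrite sipZr.
Qed.

(** Points of the completion are the functionals [y |-> lim <y, s_n>] with [s]
    Cauchy: this makes the completion a space of functions, on which equality
    is equality of values. *)
Definition represented : pred (V -> R[i]^o) :=
  fun f => `[< exists s, represents s f >].

Lemma represented_subsemimod : subsemimod_closed represented.
Proof.
split; first split.
- apply/asboolP; exists (fun=> 0); split; first exact: sip_cauchy_cst.
  move=> y; rewrite -[X in cvgC X]/(fun n : nat => sip F y 0).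
  have -> : sip F y 0 = 0 by rewrite -(scale0r 0) sipZr mul0r.
  exact: cvgC_cst.
- move=> f g /asboolP[s sf] /asboolP[t tg]; apply/asboolP.
  by exists (fun n => s n + t n); exact: representsD.
- move=> c f /asboolP[s sf]; apply/asboolP.
  by exists (fun n => c *: s n); exact: representsZ.
Qed.

HB.instance Definition _ :=
  GRing.isSubmodClosed.Build R[i] (V -> R[i]^o) represented represented_subsemimod.

Record completion := Completion {
  cfun :> V -> R[i]^o;
  cfunP : cfun \in represented
}.

HB.instance Definition _ := [isSub for cfun].
HB.instance Definition _ := [Choice of completion by <:].
HB.instance Definition _ := [SubChoice_isSubLmodule of completion by <:].

Implicit Types (p q : completion).

Lemma represents_cfun p : exists s, represents s (cfun p).
Proof. exact/asboolP/cfunP. Qed.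

Lemma completion_mk s : sip_cauchy s -> exists p, represents s (cfun p).
Proof.
move=> /represents_exists[f sf].
have fP : f \in represented by apply/asboolP; exists s.
by exists (Completion fP).
Qed.

Lemma completion_eq p q : (forall y, p y = q y) -> p = q.
Proof. by move=> pq; apply: val_inj; apply/funext. Qed.

Lemma cfunD p q : cfun (p + q) = cfun p + cfun q.
Proof. exact: (raddfD (val : completion -> _)). Qed.

Lemma cfunZ c p : cfun (c *: p) = c *: cfun p.
Proof. by []. Qed.

Definition cseq p : nat -> V := projT1 (cid (represents_cfun p)).

Lemma cseqP p : represents (cseq p) (cfun p).
Proof. exact: projT2 (cid (represents_cfun p)). Qed.

(** Along a Cauchy sequence [s], the functional [f] and its representing
    sequence [t] have asymptotically the same values. *)
Lemma represents_diag s t f : sip_cauchy s -> represents t f ->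
  cvgC (fun n => f (s n) - sip F (s n) (t n)) 0.
Proof.
move=> sC [tC tf] e e0; have [C C0 hC] := sip_cauchy_bounded sC.
have C1 : 0 < C + 1 by rewrite ltr_wpDl.
have e2 : 0 < e / 2 by rewrite divr_gt0.
have [n0 h0] := tC (e / 2 / (C + 1)) (divr_gt0 e2 C1).
near=> n; rewrite subr0.
apply: (@le_lt_trans _ _ (e / 2)); last by rewrite ltr_pdivrMr // ltr_pMr // ltr1n.
apply: (@cvgC_cmod_le _ (fun m => sip F (s n) (t m) - sip F (s n) (t n))).
  by apply: cvgC_add; [exact: tf | exact: cvgC_cst].
near=> m; rewrite -sipNr -sipDr; apply: le_trans (cauchy_schwarz _ _ _) _.
have hs : sip_norm F (s n) <= C by near: n.
have : sip_norm F (t m - t n) < e / 2 / (C + 1).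
  apply: h0; first by near: m; exists n0.
  by near: n; exists n0.
rewrite ltr_pdivlMr //.
by have := sip_norm_ge0 F (t m - t n); have := sip_norm_ge0 F (s n); nra.
Unshelve. all: by end_near. Qed.

Lemma cvgC_ext (u w : nat -> R[i]) z : cvgC (fun n => u n - w n) 0 ->
  cvgC w z -> cvgC u z.
Proof.
move=> uw wz e e0; apply: filterS (cvgC_add uw wz e0) => n.
by rewrite subrK add0r.
Qed.

Lemma cvgC_ext_sym (u w : nat -> R[i]) z : cvgC (fun n => u n - w n) 0 ->
  cvgC u z -> cvgC w z.
Proof.
move=> uw uz; apply: cvgC_ext uz => e /uw; apply: filterS => n.
by rewrite !subr0 -cmodN opprB.
Qed.

Lemma represents_pairing_exists p q :
  exists z, cvgC (fun n => sip F (cseq p n) (cseq q n)) z.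
Proof.
have [pC _] := cseqP p; have [qC _] := cseqP q.
have [C C0 [n1 _ h1]] := sip_cauchy_bounded pC.
have [C' C'0 [n2 _ h2]] := sip_cauchy_bounded qC.
apply: cvgC_cauchy => e e0.
have c1 : 0 < C + C' + 1 by rewrite ltr_wpDl // addr_ge0.
have ec : 0 < e / (C + C' + 1) by rewrite divr_gt0.
have [n3 h3] := pC _ ec; have [n4 h4] := qC _ ec.
exists (maxn (maxn n1 n2) (maxn n3 n4)) => m n.
rewrite !geq_max => /andP[/andP[m1 m2] /andP[m3 m4]].
move=> /andP[/andP[k1 k2] /andP[k3 k4]].
set a := cseq p in h1 h3 *; set b := cseq q in h2 h4 *.
have -> : sip F (a m) (b m) - sip F (a n) (b n) =
    sip F (a m) (b m - b n) + sip F (a m - a n) (b n).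
  by rewrite sipDr sipDl sipNr sipNl addrA subrK.
apply: le_lt_trans (cmodD _ _) _.
have A := cauchy_schwarz F (a m) (b m - b n).
have B := cauchy_schwarz F (a m - a n) (b n).
have := h3 m n m3 k3; have := h4 m n m4 k4; rewrite !ltr_pdivlMr // => A' B'.
have := h1 m m1; have := h2 n k2 => /= A'' B''.
have := sip_norm_ge0 F (a m - a n); have := sip_norm_ge0 F (b m - b n).
have := sip_norm_ge0 F (a m); have := sip_norm_ge0 F (b n).
have : sip_norm F (a m) * sip_norm F (b m - b n) <= C * sip_norm F (b m - b n).
  by rewrite ler_wpM2r ?sip_norm_ge0.
have : sip_norm F (a m - a n) * sip_norm F (b n) <= sip_norm F (a m - a n) * C'.
  by rewrite ler_wpM2l ?sip_norm_ge0.
have : 0 < e / (C + C' + 1) by [].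
set E := e / (C + C' + 1).
have eE : e = E * C + E * C' + E.
  by rewrite -{3}[E]mulr1 -!mulrDr mulrVK ?unitfE ?gt_eqF.
have := h3 m n m3 k3; have := h4 m n m4 k4; rewrite -/E.
move: (sip_norm F _) (sip_norm F _) => x y.
rewrite eE; nra.
Qed.

Definition cdot p q : R[i] := projT1 (cid (represents_pairing_exists p q)).

Lemma cdotP s t p q : represents s (cfun p) -> represents t (cfun q) ->
  cvgC (fun n => sip F (s n) (t n)) (cdot p q).
Proof.
move=> sp tq.
have h0 : cvgC (fun n => sip F (cseq p n) (cseq q n)) (cdot p q).
  exact: projT2 (cid (represents_pairing_exists p q)).
have [aC _] := cseqP p; have [sC _] := sp; have [tC _] := tq.
(* Change the representative of [q] first; conjugation then gives access to the
   representative of [p]. *)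
have h1 : cvgC (fun n => q (cseq p n)) (cdot p q).
  exact: cvgC_ext (represents_diag aC (cseqP q)) h0.
have h2 := cvgC_ext_sym (represents_diag aC tq) h1.
have h3 : cvgC (fun n => sip F (t n) (cseq p n)) ((cdot p q)^*)%C.
  by move=> e /(cvgC_conj h2); apply: filterS => n; rewrite sip_conj.
have h4 := cvgC_ext (represents_diag tC (cseqP p)) h3.
have h5 := cvgC_ext_sym (represents_diag tC sp) h4.
move=> e /(cvgC_conj h5); rewrite conjcK; apply: filterS => n.
by rewrite sip_conj.
Qed.

Lemma cdotE s t p q z : represents s (cfun p) -> represents t (cfun q) ->
  cvgC (fun n => sip F (s n) (t n)) z -> cdot p q = z.
Proof. by move=> sp tq; apply: cvgC_unique; exact: cdotP. Qed.

Lemma cdotDr p q q' : cdot p (q + q') = cdot p q + cdot p q'.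
Proof.
have [s sp] := represents_cfun p; have [t tq] := represents_cfun q.
have [t' tq'] := represents_cfun q'.
have := representsD tq tq'; rewrite -cfunD => tqq; apply: (cdotE sp tqq).
move=> e /(cvgC_add (cdotP sp tq) (cdotP sp tq')); apply: filterS => n.
by rewrite sipDr.
Qed.

Lemma cdotZr c p q : cdot p (c *: q) = c * cdot p q.
Proof.
have [s sp] := represents_cfun p; have [t tq] := represents_cfun q.
have := representsZ c tq; rewrite -cfunZ => ctq; apply: (cdotE sp ctq).
move=> e /(cvgC_scale c (cdotP sp tq)); apply: filterS => n.
by rewrite sipZr.
Qed.

Lemma cdot_conj p q : (cdot p q)^*%C = cdot q p.
Proof.
have [s sp] := represents_cfun p; have [t tq] := represents_cfun q.
apply/esym/(cdotE tq sp) => e /(cvgC_conj (cdotP sp tq)); apply: filterS => n.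
by rewrite sip_conj.
Qed.

Lemma cdot_ge0 p : 0 <= cdot p p.
Proof.
have [s sp] := represents_cfun p; apply: cvgC_ge0 (cdotP sp sp) _ => n.
exact: sip_ge0.
Qed.

Definition completion_form : semi_inner completion :=
  SemiInner cdotDr cdotZr cdot_conj cdot_ge0.

Lemma sip_norm_completion_le s p (C : R) : 0 <= C -> represents s (cfun p) ->
  (\forall n \near \oo, sip_norm F (s n) <= C) -> sip_norm completion_form p <= C.
Proof.
move=> C0 sp hC; rewrite -ler_sqr ?nnegrE ?sip_norm_ge0 //.
have := cvgC_cmod_le (cdotP sp sp) (C := C ^+ 2).
rewrite -[cdot p p]/(sip completion_form p p) sipxx cmod_real ger0_norm ?sqr_ge0 //.
apply; apply: filterS hC => n hn; rewrite sipxx cmod_real ger0_norm ?sqr_ge0 //.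
by rewrite ler_sqr ?nnegrE ?sip_norm_ge0.
Qed.

Lemma cdot_eq0 p : cdot p p = 0 -> p = 0.
Proof.
move=> pp0; have [s sp] := represents_cfun p; apply: completion_eq => y.
have [sC sf] := sp; have hpp := cdotP sp sp; rewrite pp0 in hpp.
have -> : (0 : completion) y = 0 by rewrite -(scale0r p) cfunZ; apply: mul0r.
apply: cvgC_unique (sf y) _ => e e0.
have c1 : 0 < sip_norm F y + 1 by rewrite ltr_wpDl ?sip_norm_ge0.
have ec : 0 < e / (sip_norm F y + 1) by rewrite divr_gt0.
have ec2 : 0 < (e / (sip_norm F y + 1)) ^+ 2 by rewrite exprn_gt0.
apply: filterS (hpp _ ec2) => n; rewrite !subr0 sipxx cmod_real.
rewrite ger0_norm ?sqr_ge0 // ltr_sqr ?nnegrE ?sip_norm_ge0 ?ltW // ltr_pdivlMr //.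
have := cauchy_schwarz F y (s n); have := sip_norm_ge0 F y; have := sip_norm_ge0 F (s n).
nra.
Qed.

Lemma represents_emb x : exists p, represents (fun=> x) (cfun p).
Proof. exact/completion_mk/sip_cauchy_cst. Qed.

Definition emb x : completion := projT1 (cid (represents_emb x)).

Lemma embP x : represents (fun=> x) (cfun (emb x)).
Proof. exact: projT2 (cid (represents_emb x)). Qed.

Lemma cdot_emb x y : cdot (emb x) (emb y) = sip F x y.
Proof. by apply: cdotE (embP x) (embP y) _; exact: cvgC_cst. Qed.

Lemma represents_sub_emb s p x : represents s (cfun p) ->
  represents (fun n => s n + (-1) *: x) (cfun (p - emb x)).
Proof.
move=> sp; have := representsD sp (representsZ (-1) (embP x)).
by rewrite -cfunZ -cfunD [(-1) *: emb x]scaleN1r.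
Qed.

Lemma emb_dense p (e : R) : 0 < e -> exists x, sip_norm completion_form (p - emb x) < e.
Proof.
move=> e0; have [s sp] := represents_cfun p; have e2 : 0 < e / 2 by rewrite divr_gt0.
have [n0 h0] := sp.1 _ e2; exists (s n0).
apply: (@le_lt_trans _ _ (e / 2)); last by rewrite ltr_pdivrMr // ltr_pMr // ltr1n.
apply: sip_norm_completion_le (ltW e2) (represents_sub_emb (s n0) sp) _.
exists n0 => // n /= hn; rewrite scaleN1r; apply: ltW; exact: h0.
Qed.

(** Replace the k-th term of a Cauchy sequence by a vector of [V] at distance less
    than 1/(k+1); the resulting Cauchy sequence of [V] represents the limit. *)
Lemma completion_complete :
  norm_complete (fun p => Num.sqrt (complex.Re (cdot p p))).
Proof.
move=> P PC; set N := sip_norm completion_form.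
have PC' (e : R) : 0 < e -> exists n0 : nat, forall m n : nat,
    (n0 <= m)%N -> (n0 <= n)%N -> N (P m - P n) < e by exact: PC.
have ax k : exists x, N (P k - emb x) < k.+1%:R^-1.
  by apply: emb_dense; rewrite invr_gt0 ltr0Sn.
pose x k := projT1 (cid (ax k)).
have xP k : N (P k - emb (x k)) < k.+1%:R^-1 := projT2 (cid (ax k)).
have snx m n : sip_norm F (x m - x n) = N (emb (x m) - emb (x n)).
  rewrite /N /sip_norm /=.
  have rep := represents_sub_emb (x n) (embP (x m)).
  by rewrite (cdotE rep rep (cvgC_cst _)) scaleN1r.
have xC : sip_cauchy x.
  move=> e e0; have e3 : 0 < e / 3 by rewrite divr_gt0.
  have [n1 h1] := PC' _ e3; have [n2 _ h2] := near_infty_natSinv_lt (PosNum e3).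
  exists (maxn n1 n2) => m n; rewrite !geq_max => /andP[m1 m2] /andP[k1 k2].
  rewrite snx; apply: le_lt_trans (sip_norm_sub_trans _ (P m) _ _) _.
  have := sip_norm_sub_trans completion_form (P n) (P m) (emb (x n)).
  rewrite (sip_norm_distC _ (emb (x m))) -/N.
  have := lt_trans (xP m) (h2 m m2); have := lt_trans (xP n) (h2 n k2) => /=.
  have := h1 m n m1 k1; move: (N (P m - P n)) (N (P m - emb (x n))).
  move: (N (P n - emb (x n))) (N (P m - emb (x m))) => a b c d; lra.
have [q xq] := completion_mk xC; exists q => e e0.
have e3 : 0 < e / 3 by rewrite divr_gt0.
have [n1 h1] := xC _ e3; have [n2 _ h2] := near_infty_natSinv_lt (PosNum e3).
exists (maxn n1 n2) => n; rewrite geq_max => /andP[k1 k2].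
rewrite -[X in X < e]/(N (P n - q)).
apply: le_lt_trans (sip_norm_sub_trans _ (emb (x n)) _ _) _.
rewrite (sip_norm_distC _ (emb (x n)) q) -/N.
have le3 : N (q - emb (x n)) <= e / 3.
  apply: sip_norm_completion_le (ltW e3) (represents_sub_emb (x n) xq) _.
  by exists n1 => // m /= hm; rewrite scaleN1r; apply/ltW/h1.
have /= := lt_trans (xP n) (h2 n k2).
by move: (N (P n - _)) (N (q - _)) le3 => a b; lra.
Qed.

HB.instance Definition _ := isHilbert.Build R completion
  cdotDr cdotZr cdot_conj cdot_ge0 cdot_eq0 completion_complete.

(** An operator [T] of [V] with formal adjoint [T'] extends to the completion by
    precomposing functionals with [T']. *)
Record bounded_adjoint (T T' : V -> V) : Prop := {
  bounded_adjoint_linear : forall (c : R[i]) x y, T (c *: x + y) = c *: T x + T y;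
  bounded_adjoint_le : exists2 C : R, 0 <= C & forall x, sip_norm F (T x) <= C * sip_norm F x;
  bounded_adjointP : forall x y, sip F (T x) y = sip F x (T' y)
}.

Lemma represents_op T T' s f : bounded_adjoint T T' -> represents s f ->
  represents (T \o s) (f \o T').
Proof.
move=> [Tlin [C C0 TC] adj] [sC sf]; split.
  move=> e e0; have C1 : 0 < C + 1 by rewrite ltr_wpDl.
  have [n0 h0] := sC _ (divr_gt0 e0 C1).
  exists n0 => m n hm hn /=.
  have -> : T (s m) - T (s n) = T (s m - s n).
    by rewrite addrC -scaleN1r -Tlin scaleN1r addrC.
  apply: le_lt_trans (TC _) _; have := h0 m n hm hn; rewrite ltr_pdivlMr //.
  have := sip_norm_ge0 F (s m - s n); nra.
move=> y e /(sf (T' y)); apply: filterS => n /=.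
by rewrite -(sip_conj F (s n)) -adj sip_conj.
Qed.

Lemma op_ext_subproof T T' p : bounded_adjoint T T' -> (p \o T' : V -> R[i]^o) \in represented.
Proof.
move=> TP; have [s sp] := represents_cfun p.
by apply/asboolP; exists (T \o s); exact: represents_op.
Qed.

Definition op_ext T T' (TP : bounded_adjoint T T') p :=
  Completion (op_ext_subproof p TP).

Lemma op_ext_represents T T' (TP : bounded_adjoint T T') s p :
  represents s (cfun p) -> represents (T \o s) (cfun (op_ext TP p)).
Proof. exact: represents_op. Qed.

Lemma op_ext_adjoint T T' T'' (TP : bounded_adjoint T T')
    (TP' : bounded_adjoint T' T'') p q : dot (op_ext TP p) q = dot p (op_ext TP' q).
Proof.
have [s sp] := represents_cfun p; have [t tq] := represents_cfun q.
apply: (cdotE (op_ext_represents TP sp) tq) => e e0.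
have := cdotP sp (op_ext_represents TP' tq) e0; apply: filterS => n /=.
by rewrite (bounded_adjointP TP).
Qed.

Lemma op_ext_bounded T T' (TP : bounded_adjoint T T') (C : R) p : 0 <= C ->
  (forall x, sip_norm F (T x) <= C * sip_norm F x) ->
  hnorm (op_ext TP p) <= C * hnorm p.
Proof.
move=> C0 TC.
suff : sip_norm completion_form (op_ext TP p) <= C * sip_norm completion_form p by [].
have [s sp] := represents_cfun p; have tp := op_ext_represents TP sp.
have h := cvgC_add (cvgC_scale (C ^+ 2)%:C (cdotP sp sp))
  (cvgC_scale (-1) (cdotP tp tp)).
have {h} : 0 <= (C ^+ 2)%:C * sip completion_form p p
    + (-1) * sip completion_form (op_ext TP p) (op_ext TP p).
  apply: (cvgC_ge0 h) => n; rewrite !sipxx mulN1r -rmorphM -rmorphB /= ler0c.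
  rewrite subr_ge0 -exprMn ler_sqr ?nnegrE ?mulr_ge0 ?sip_norm_ge0 //; exact: TC.
rewrite !sipxx mulN1r -rmorphM -rmorphB /= ler0c subr_ge0 -exprMn.
by rewrite ler_sqr ?nnegrE ?mulr_ge0 ?sip_norm_ge0.
Qed.

Lemma cfun_add p y y' : p (y + y') = p y + p y'.
Proof.
have [s [_ sf]] := represents_cfun p.
apply: (cvgC_unique (sf _)) => e /(cvgC_add (sf y) (sf y')); apply: filterS => n.
by rewrite sipDl.
Qed.

Lemma cfun_antilinear p (c : R[i]) y : p (c *: y) = (c^*)%C * p y.
Proof.
have [s [_ sf]] := represents_cfun p.
apply: (cvgC_unique (sf _)) => e /(cvgC_scale (c^*)%C (sf y)); apply: filterS => n.
by rewrite sipZl.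
Qed.

Lemma hnorm_op_ext_emb T T' (TP : bounded_adjoint T T') x :
  hnorm (op_ext TP (emb x)) = sip_norm F (T x).
Proof.
have rep := op_ext_represents TP (embP x).
rewrite /hnorm -[dot _ _]/(cdot _ _) (cdotE rep rep (cvgC_cst (sip F (T x) (T x)))) //.
Qed.

Lemma hnorm_emb x : hnorm (emb x) = sip_norm F x.
Proof. by rewrite /hnorm -[dot _ _]/(cdot _ _) cdot_emb. Qed.

End Completion.

(** * Operators on Hilbert spaces and the GNS construction *)

Section HilbertForm.
Variables (R : realType) (K : hilbertType R).

Definition hilbert_form : semi_inner K :=
  SemiInner (@dotDr R K) (@dotZr R K) (@dot_conj R K) (@dot_ge0 R K).

Lemma hnormE (x : K) : hnorm x = sip_norm hilbert_form x. Proof. by []. Qed.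

Lemma hnorm_ge0 (x : K) : 0 <= hnorm x. Proof. exact: sqrtr_ge0. Qed.

Lemma dotxx (x : K) : dot x x = (hnorm x ^+ 2)%:C.
Proof. exact: (sipxx hilbert_form). Qed.

Lemma Re_dot_le (x y : K) : complex.Re (dot x y) <= hnorm x * hnorm y.
Proof.
apply: le_trans (cauchy_schwarz hilbert_form x y).
by apply: le_trans (ler_norm _) _; exact: Re_le_cmod.
Qed.

(** From |f x|^2 = <x, g (f x)> <= |x| * C * |f x|. *)
Lemma adjoint_bound (f g : K -> K) (C : R) :
  (forall x y, dot (f x) y = dot x (g y)) ->
  (forall x, hnorm (g x) <= C * hnorm x) -> forall x, hnorm (f x) <= C * hnorm x.
Proof.
move=> adj gC x; have := adj x (f x); rewrite dotxx => /(congr1 (@complex.Re R)) /= h.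
have := Re_dot_le x (g (f x)); rewrite -h => le1.
have [->|f0] := eqVneq (hnorm (f x)) 0.
  by apply: le_trans (hnorm_ge0 (g x)) (gC x).
have fp : 0 < hnorm (f x) by rewrite lt_neqAle eq_sym f0 hnorm_ge0.
rewrite -(ler_pM2r fp) -expr2; apply: le_trans le1 _.
rewrite [X in _ <= X * _]mulrC -mulrA; apply: ler_wpM2l; first exact: hnorm_ge0.
exact: gC.
Qed.

(** The element |z|^2 - [star z * z] is the square of a self-adjoint element,
    hence acts as a positive operator; the unit acts as a projection. *)
Lemma star_rep_contractive (B : cstarType R) (r : B -> K -> K) :
  (forall a b x, r (a + b) x = r a x + r b x) ->
  (forall c a x, r (c *: a) x = c *: r a x) ->
  (forall a b x, r (a * b) x = r a (r b x)) ->
  (forall a x y, dot (r a x) y = dot x (r (star a) y)) ->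
  forall z x, hnorm (r z x) <= cnorm z * hnorm x.
Proof.
move=> rD rZ rM radj z x.
have sqE a : dot x (r (star a * a) x) = (hnorm (r a x) ^+ 2)%:C.
  by rewrite rM -radj dotxx.
have one_le : hnorm (r 1 x) <= hnorm x.
  have := sqE 1; rewrite star1 mulr1 => h1.
  have := Re_dot_le x (r 1 x); rewrite h1 /=.
  have := hnorm_ge0 x; have := hnorm_ge0 (r 1 x); nra.
have [k sk kE] : cpos ((cnorm z ^+ 2)%:C%:A - star z * z).
  apply: cpos_alg_sub; last by rewrite cnorm_star.
  by rewrite starM starK.
have := sqE k; rewrite sk -kE rD rZ -[- (_ * _)]scaleN1r rZ.
rewrite dotDr !dotZr sqE.
have := sqE 1; rewrite star1 mulr1 => ->.
move=> /(congr1 (@complex.Re R)) /=; rewrite !mul0r !subr0 !oppr0 mul0r subr0 mulN1r => h.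
rewrite -ler_sqr ?nnegrE ?mulr_ge0 ?hnorm_ge0 ?cnorm_ge0 // exprMn.
have := sqr_ge0 (hnorm (r k x)); rewrite -h subr_ge0 => /le_trans; apply.
by rewrite ler_wpM2l ?sqr_ge0 // ler_sqr ?nnegrE ?hnorm_ge0.
Qed.

Lemma opnorm_le (f : K -> K) (C : R) : 0 <= C ->
  (forall x, hnorm (f x) <= C * hnorm x) -> opnorm f <= C.
Proof.
move=> C0 fC; apply: ge_sup.
  exists (hnorm (f 0)); exists 0 => //=.
  by rewrite hnormE /sip_norm -(scale0r 0) sipZr mul0r sqrtr0.
move=> _ [x /= x1 <-]; apply: le_trans (fC x) _.
by rewrite ler_piMr.
Qed.

Lemma opnorm_ge (f : K -> K) (C : R) x :
  (forall x, hnorm (f x) <= C * hnorm x) -> hnorm x <= 1 -> hnorm (f x) <= opnorm f.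
Proof.
move=> fC x1; apply: ub_le_sup; last by exists x.
exists `|C| => _ [y /= y1 <-]; apply: le_trans (fC y) _.
have := ler_norm C; have := hnorm_ge0 y; have := normr_ge0 C; nra.
Qed.

End HilbertForm.

Section GNS.
Variables (R : realType) (D : cstarType R) (f : D -> R[i]).
Hypothesis fP : state f.

Lemma gns_dotDr (x y z : D) : f (star x * (y + z)) = f (star x * y) + f (star x * z).
Proof. by rewrite mulrDr (stateD fP). Qed.

Lemma gns_dotZr c (x y : D) : f (star x * (c *: y)) = c * f (star x * y).
Proof. by rewrite -scalerAr (stateZ fP). Qed.

Lemma gns_dot_conj (x y : D) : (f (star x * y))^*%C = f (star y * x).
Proof. by rewrite -(state_star fP) starM starK. Qed.

Definition gns_form : semi_inner D :=
  SemiInner gns_dotDr gns_dotZr gns_dot_conj (state_ge0 fP).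

(** With |d|^2 - [star d * d = k * k], the difference of the two squared seminorms
    is the one of [k * x]. *)
Lemma gns_mul_le (d x : D) : sip_norm gns_form (d * x) <= cnorm d * sip_norm gns_form x.
Proof.
rewrite -ler_sqr ?nnegrE ?mulr_ge0 ?sip_norm_ge0 ?cnorm_ge0 // exprMn.
have [k sk kE] : cpos ((cnorm d ^+ 2)%:C%:A - star d * d).
  apply: cpos_alg_sub; last by rewrite cnorm_star.
  by rewrite starM starK.
have E y : (sip_norm gns_form y ^+ 2)%:C = f (star y * y) by rewrite -sipxx.
have : 0 <= (cnorm d ^+ 2 * sip_norm gns_form x ^+ 2 - sip_norm gns_form (d * x) ^+ 2)%:C.
  rewrite rmorphB /= rmorphM /= !E -(stateZ fP) -mulN1r -(stateZ fP) -(stateD fP).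
  have -> : (cnorm d ^+ 2)%:C *: (star x * x) + (-1) *: (star (d * x) * (d * x)) =
      star (k * x) * (k * x).
    rewrite !starM sk -!mulrA [k * (k * x)]mulrA -kE mulrBl mulr_algl.
    by rewrite scaleN1r mulrBr -scalerAr !mulrA.
  exact: (state_ge0 fP).
by rewrite ler0c subr_ge0.
Qed.

Lemma gns_bounded_adjoint (d : D) :
  bounded_adjoint gns_form ( *%R d) ( *%R (star d)).
Proof.
split.
- by move=> c x y; rewrite mulrDr scalerAr.
- by exists (cnorm d); [exact: cnorm_ge0 | exact: gns_mul_le].
- by move=> x y /=; rewrite starM mulrA.
Qed.

Definition gns_op (d : D) := op_ext (gns_bounded_adjoint d).

Lemma gns_opE (d : D) p y : gns_op d p y = p (star d * y). Proof. by []. Qed.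

Lemma hnorm_gns_unit : hnorm (emb gns_form 1) = 1.
Proof.
rewrite hnorm_emb /sip_norm /= star1 mulr1 (state1 fP) /=; exact: sqrtr1.
Qed.

End GNS.

(** * The universal algebra and its norm *)

Section UniversalAlgebraTheory.
Variables (R : realType) (A B1 B2 : cstarType R) (E : coefficients A B1 B2).
Variables (H : lmodType R[i]) (X : quad_module E H).
Variables (M N : nat) (u : 'I_M -> H) (v : 'I_N -> H).

Let U := univ_alg X u v.
Implicit Types p q : U.

Section Eval.
Variables (Q : starAlgType R) (f1 : B1 -> Q) (f2 : B2 -> Q).
Variables (S : 'I_M -> Q) (T : 'I_N -> Q).
Hypotheses (f1P : starhom f1) (f2P : starhom f2).
Hypothesis STP : relationsH X u v f1 f2 S T.

Let ev : U -> Q := ueval f1 f2 S T.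

Lemma uevalD p q : ev (p + q) = ev p + ev q.
Proof. exact: (ueval_add f1P f2P STP). Qed.
Lemma uevalZ c p : ev (c *: p) = c *: ev p.
Proof. exact: (ueval_scale f1P f2P STP). Qed.
Lemma uevalM p q : ev (p * q) = ev p * ev q.
Proof. exact: (ueval_mul f1P f2P STP). Qed.
Lemma ueval1 : ev 1 = 1.
Proof. exact: (ueval_one f1P f2P STP). Qed.
Lemma ueval0 : ev 0 = 0.
Proof. by rewrite -(scale0r 0) uevalZ scale0r. Qed.
Lemma uevalstar p : ev (ustar p) = star (ev p).
Proof. exact: (ueval_star f1P f2P STP). Qed.
Lemma ueval_sum (I : Type) (r : seq I) (P : pred I) (F : I -> U) :
  ev (\sum_(i <- r | P i) F i) = \sum_(i <- r | P i) ev (F i).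
Proof. exact: (big_morph ev uevalD ueval0). Qed.

Definition ueval_genE := (uevalS f1P f2P STP, uevalT f1P f2P STP,
  uevalB1 f1P f2P STP, uevalB2 f1P f2P STP).
Definition ueval_opE := (uevalD, uevalZ, uevalM, ueval1, ueval0, uevalstar, ueval_sum).

End Eval.

Lemma univ_class_add (s t : starpoly R B1 B2 M N) :
  univ_class X u v (PAdd s t) = univ_class X u v s + univ_class X u v t.
Proof.
apply: univ_eqP => Q f1 f2 S T h1 h2 h.
by rewrite (ueval_opE h1 h2 h) !(ueval_class h1 h2 h).
Qed.

Lemma univ_class_scale (c : R[i]) (s : starpoly R B1 B2 M N) :
  univ_class X u v (PScale c s) = c *: univ_class X u v s.
Proof.
apply: univ_eqP => Q f1 f2 S T h1 h2 h.
by rewrite (ueval_opE h1 h2 h) !(ueval_class h1 h2 h).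
Qed.

Lemma univ_class_mul (s t : starpoly R B1 B2 M N) :
  univ_class X u v (PMul s t) = univ_class X u v s * univ_class X u v t.
Proof.
apply: univ_eqP => Q f1 f2 S T h1 h2 h.
by rewrite (ueval_opE h1 h2 h) !(ueval_class h1 h2 h).
Qed.

Lemma univ_class_star (s : starpoly R B1 B2 M N) :
  univ_class X u v (PStar s) = ustar (univ_class X u v s).
Proof.
apply: univ_eqP => Q f1 f2 S T h1 h2 h.
by rewrite (ueval_opE h1 h2 h) !(ueval_class h1 h2 h).
Qed.

Lemma uB1D a b : uB1 X u v (a + b) = uB1 X u v a + uB1 X u v b.
Proof.
apply: univ_eqP => Q f1 f2 S T h1 h2 h.
by rewrite (ueval_opE h1 h2 h) !(ueval_genE h1 h2 h) (starhomD h1).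
Qed.
Lemma uB1Z c a : uB1 X u v (c *: a) = c *: uB1 X u v a.
Proof.
apply: univ_eqP => Q f1 f2 S T h1 h2 h.
by rewrite (ueval_opE h1 h2 h) !(ueval_genE h1 h2 h) (starhomZ h1).
Qed.
Lemma uB1M a b : uB1 X u v (a * b) = uB1 X u v a * uB1 X u v b.
Proof.
apply: univ_eqP => Q f1 f2 S T h1 h2 h.
by rewrite (ueval_opE h1 h2 h) !(ueval_genE h1 h2 h) (starhomM h1).
Qed.
Lemma uB1star a : uB1 X u v (star a) = ustar (uB1 X u v a).
Proof.
apply: univ_eqP => Q f1 f2 S T h1 h2 h.
by rewrite (ueval_opE h1 h2 h) !(ueval_genE h1 h2 h) (starhom_star h1).
Qed.
Lemma uB2D a b : uB2 X u v (a + b) = uB2 X u v a + uB2 X u v b.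
Proof.
apply: univ_eqP => Q f1 f2 S T h1 h2 h.
by rewrite (ueval_opE h1 h2 h) !(ueval_genE h1 h2 h) (starhomD h2).
Qed.
Lemma uB2Z c a : uB2 X u v (c *: a) = c *: uB2 X u v a.
Proof.
apply: univ_eqP => Q f1 f2 S T h1 h2 h.
by rewrite (ueval_opE h1 h2 h) !(ueval_genE h1 h2 h) (starhomZ h2).
Qed.
Lemma uB2M a b : uB2 X u v (a * b) = uB2 X u v a * uB2 X u v b.
Proof.
apply: univ_eqP => Q f1 f2 S T h1 h2 h.
by rewrite (ueval_opE h1 h2 h) !(ueval_genE h1 h2 h) (starhomM h2).
Qed.
Lemma uB2star a : uB2 X u v (star a) = ustar (uB2 X u v a).
Proof.
apply: univ_eqP => Q f1 f2 S T h1 h2 h.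
by rewrite (ueval_opE h1 h2 h) !(ueval_genE h1 h2 h) (starhom_star h2).
Qed.

Lemma ustarK : involutive (@ustar R A B1 B2 E H X M N u v).
Proof.
move=> p; apply: univ_eqP => Q f1 f2 S T h1 h2 h.
by rewrite !(ueval_opE h1 h2 h) starK.
Qed.

Lemma univ_unit : \sum_(i < M) uS X u v i * ustar (uS X u v i)
  + \sum_(k < N) uT X u v k * ustar (uT X u v k) = 1.
Proof.
apply: univ_eqP => Q f1 f2 S T h1 h2 h.
rewrite !(ueval_opE h1 h2 h) -(relH_unit h); congr (_ + _); apply: eq_bigr => i _.
  by rewrite !(ueval_opE h1 h2 h) !(ueval_genE h1 h2 h).
by rewrite !(ueval_opE h1 h2 h) !(ueval_genE h1 h2 h).
Qed.

(** The bound depends on the polynomial only, so that the supremum defining the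
    universal norm is over a bounded set. For the generators S and T it comes
    from |x|^2 being the sum of all |S_i^* x|^2 and |T_k^* x|^2. *)
Lemma univ_rep_bound (t : starpoly R B1 B2 M N) : exists2 C : R, 0 <= C &
  forall (K : hilbertType R) (rho : U -> K -> K), hilbert_rep rho ->
    forall x, hnorm (rho (univ_class X u v t) x) <= C * hnorm x.
Proof.
have col (K : hilbertType R) (rho : U -> K -> K) (hr : hilbert_rep rho) x :
    \sum_(i < M) hnorm (rho (ustar (uS X u v i)) x) ^+ 2
    + \sum_(k < N) hnorm (rho (ustar (uT X u v k)) x) ^+ 2 = hnorm x ^+ 2.
  apply: complexI; rewrite rmorphD /= !rmorph_sum /= -(dotxx x).
  rewrite -[X in _ = dot _ X](rep1 hr x) -univ_unit (repD hr) dotDr.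
  have sumE (I : finType) (F : I -> U) :
      dot x (rho (\sum_i F i) x) = \sum_i dot x (rho (F i) x).
    apply: (big_morph (fun p => dot x (rho p x))) => [p q|].
      by rewrite (repD hr) dotDr.
    by rewrite -(scale0r 0) (repZ hr) dotZr mul0r.
  rewrite !sumE; congr (_ + _); apply: eq_bigr => i _.
    by rewrite (repM hr) -{2}(ustarK (uS X u v i)) -(rep_star hr) dotxx.
  by rewrite (repM hr) -{2}(ustarK (uT X u v i)) -(rep_star hr) dotxx.
have le_col (K : hilbertType R) (x y : K) : hnorm y ^+ 2 <= hnorm x ^+ 2 ->
    hnorm y <= 1 * hnorm x.
  by rewrite mul1r ler_sqr ?nnegrE ?hnorm_ge0.
elim: t => [i|k|z|w||s [C C0 IC] t [C' C'0 IC']|c s [C C0 IC]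
           |s [C C0 IC] t [C' C'0 IC']|s [C C0 IC]].
- exists 1 => // K rho hr; apply: (adjoint_bound (rep_star hr _)) => x.
  apply: le_col; rewrite -(col _ _ hr x) (bigD1 i) //= -addrA lerDl.
  by rewrite addr_ge0 // sumr_ge0 // => *; rewrite sqr_ge0.
- exists 1 => // K rho hr; apply: (adjoint_bound (rep_star hr _)) => x.
  apply: le_col; rewrite -(col _ _ hr x) [X in _ <= _ + X](bigD1 k) //= addrCA lerDl.
  by rewrite addr_ge0 // sumr_ge0 // => *; rewrite sqr_ge0.
- exists (cnorm z); first exact: cnorm_ge0.
  move=> K rho hr; apply: (@star_rep_contractive _ _ B1 (fun z => rho (uB1 X u v z))).
  + by move=> *; rewrite uB1D (repD hr).
  + by move=> *; rewrite uB1Z (repZ hr).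
  + by move=> *; rewrite uB1M (repM hr).
  + by move=> *; rewrite uB1star (rep_star hr).
- exists (cnorm w); first exact: cnorm_ge0.
  move=> K rho hr; apply: (@star_rep_contractive _ _ B2 (fun z => rho (uB2 X u v z))).
  + by move=> *; rewrite uB2D (repD hr).
  + by move=> *; rewrite uB2Z (repZ hr).
  + by move=> *; rewrite uB2M (repM hr).
  + by move=> *; rewrite uB2star (rep_star hr).
- by exists 1 => // K rho hr x; rewrite (rep1 hr) mul1r.
- exists (C + C'); first exact: addr_ge0.
  move=> K rho hr x.
  rewrite univ_class_add (repD hr) mulrDl; apply: le_trans (sip_normD (hilbert_form K) _ _) _.
  by apply: lerD; [apply: IC | apply: IC'].
- exists (cmod c * C); first by rewrite mulr_ge0 ?cmod_ge0.
  move=> K rho hr x.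
  rewrite univ_class_scale (repZ hr) hnormE sip_normZ -mulrA; apply: ler_wpM2l; first exact: cmod_ge0.
  exact: IC.
- exists (C * C'); first exact: mulr_ge0.
  move=> K rho hr x.
  rewrite univ_class_mul (repM hr) -mulrA; apply: le_trans (IC _ _ hr _) _.
  by apply: ler_wpM2l => //; apply: IC'.
- exists C => // K rho hr.
  rewrite univ_class_star.
  apply: (adjoint_bound (rep_star hr _)) => x; rewrite ustarK; exact: IC.
Qed.

Lemma univ_norm_ub (K : hilbertType R) (rho : U -> K -> K) p :
  hilbert_rep rho -> opnorm (rho p) <= univ_norm p.
Proof.
move=> hr; apply: ub_le_sup; last by exists K, rho.
have [C C0 hC] := univ_rep_bound (repr p).
exists C => _ [K' [rho' [hr' ->]]]; apply: opnorm_le => // x.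
have -> : p = univ_class X u v (repr p) by rewrite /univ_class reprK.
exact: hC.
Qed.

(** Take a state attaining |ev p|^2 at [star (ev p) * ev p]: in its GNS
    representation, the vector of 1 is a unit vector that [ev p] sends to a
    vector of norm |ev p|. *)
Lemma ueval_le_univ_norm (D : cstarType R) (f1 : B1 -> D) (f2 : B2 -> D)
    (S : 'I_M -> D) (T : 'I_N -> D) p :
  starhom f1 -> starhom f2 -> relationsH X u v f1 f2 S T ->
  cnorm (ueval f1 f2 S T p) <= univ_norm p.
Proof.
move=> h1 h2 hST; set ev := ueval f1 f2 S T.
have [f fP fp] := norm_attaining_state (ev p).
pose rho (q : U) := @gns_op R D f fP (ev q).
have hr : hilbert_rep rho.
  split.
  - move=> q c x y; apply: completion_eq => z.
    by rewrite cfunD cfunZ !gns_opE cfunD cfunZ.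
  - move=> q; exists (cnorm (ev q)) => x.
    by apply: op_ext_bounded; [exact: cnorm_ge0 | exact: gns_mul_le].
  - move=> q r x; apply: completion_eq => z.
    by rewrite cfunD !gns_opE /ev (uevalD h1 h2 hST) starD mulrDl cfun_add.
  - move=> c q x; apply: completion_eq => z.
    rewrite cfunZ !gns_opE /ev (uevalZ h1 h2 hST) starZ -scalerAl cfun_antilinear.
    by rewrite conjcK.
  - move=> q r x; apply: completion_eq => z.
    by rewrite !gns_opE /ev (uevalM h1 h2 hST) starM mulrA.
  - by move=> x; apply: completion_eq => z; rewrite gns_opE /ev (ueval1 h1 h2 hST) star1 mul1r.
  - move=> q x y; rewrite /rho /ev (uevalstar h1 h2 hST); exact: op_ext_adjoint.
apply: le_trans (univ_norm_ub p hr).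
have <- : hnorm (rho p (emb (gns_form fP) 1)) = cnorm (ev p).
  rewrite hnorm_op_ext_emb mulr1 /sip_norm /= fp /= sqrtr_sqr ger0_norm //.
  exact: cnorm_ge0.
apply: (@opnorm_ge _ _ _ (cnorm (ev p))); last by rewrite hnorm_gns_unit.
by move=> x; apply: op_ext_bounded; [exact: cnorm_ge0 | exact: gns_mul_le].
Qed.

End UniversalAlgebraTheory.

(** * Comparison of C*-seminorms *)

Section CStarSeminorms.
Variables (R : realType) (Q : starAlgType R).

Record cstar_seminorm (p : Q -> R) : Prop := {
  csemiD : forall x y, p (x + y) <= p x + p y;
  csemiZ : forall (c : R[i]) x, p (c *: x) = cmod c * p x;
  csemiM : forall x y, p (x * y) <= p x * p y;
  csemi_star : forall x, p (star x * x) = p x ^+ 2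
}.

Lemma csemi_ge0 p x : cstar_seminorm p -> 0 <= p x.
Proof.
move=> pP; have := csemiZ pP 0 x; rewrite scale0r (cmod_real 0) normr0 mul0r => p0.
have := csemiD pP x ((-1) *: x); rewrite (csemiZ pP) scaleN1r subrr p0.
by rewrite cmodN (cmod_real 1) normr1 mul1r; lra.
Qed.

Lemma csemi_sum p (I : finType) (F : I -> Q) : cstar_seminorm p ->
  p (\sum_i F i) <= \sum_i p (F i).
Proof.
move=> pP; elim/big_ind2: _ => //.
  by have := csemiZ pP 0 0; rewrite scaler0 (cmod_real 0) normr0 mul0r => ->.
by move=> x a y b xa yb; apply: le_trans (csemiD pP _ _) _; apply: lerD.
Qed.

(** For a > b, the powers of a / b with exponent 2^(j+1) grow at least like 4^j,
    by Bernoulli's inequality. *)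
Lemma exp_growth_le (a b C : R) : 0 <= a -> 0 <= b ->
  (forall j, a ^+ (2 ^ j.+1) <= C * 2 ^+ j * b ^+ (2 ^ j.+1)) -> a <= b.
Proof.
move=> a0 b0 h; rewrite leNgt; apply/negP => ba.
have ap : 0 < a by apply: le_lt_trans ba.
have [b00|bn0] := eqVneq b 0.
  have := h 0%N; rewrite b00 expr0n /= mulr0 => /(lt_le_trans (exprn_gt0 2 ap)).
  by rewrite ltxx.
have bp : 0 < b by rewrite lt_neqAle eq_sym bn0.
pose q := a / b; pose d := q - 1.
have d0 : 0 < d by rewrite subr_gt0 ltr_pdivlMr // mul1r.
have bern j : 1 + 2 ^+ j * d <= q ^+ (2 ^ j).
  elim: j => [|j IH]; first by rewrite expr0 mul1r expn0 expr1 /d addrC subrK.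
  rewrite expnS mulnC exprM exprS.
  have : 0 <= 2 ^+ j * d by rewrite mulr_ge0 ?exprn_ge0 // ltW.
  by move: IH; set X := q ^+ _; set Y := 2 ^+ j * d; rewrite -mulrA -/Y; nra.
have key j : 2 ^+ j * d ^+ 2 <= C.
  have p2 : 0 < 2 ^+ j :> R by rewrite exprn_gt0.
  have qC : q ^+ (2 ^ j.+1) <= C * 2 ^+ j.
    by rewrite /q exprMn exprVn ler_pdivrMr ?exprn_gt0.
  rewrite -(ler_pM2r p2); apply: le_trans qC.
  rewrite expnS mulnC exprM; have := bern j.
  have : 0 <= 2 ^+ j * d by rewrite mulr_ge0 ?ltW.
  by set X := q ^+ _; set Y := 2 ^+ j; nra.
have d2 : 0 < d ^+ 2 by rewrite exprn_gt0.
have C0 : 0 <= C by apply: le_trans (key 0%N); rewrite mulr_ge0 ?exprn_ge0 ?ltW.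
have := archi_boundP (divr_ge0 C0 (ltW d2)).
set n := Num.bound _ => hn; have := key n; rewrite -ler_pdivlMr // => le_n.
have : n%:R < 2 ^+ n :> R by rewrite -natrX ltr_nat ltn_expl.
by move/(lt_trans hn)/lt_le_trans/(_ le_n); rewrite ltxx.
Qed.

(** The elements (x^* x)^(2^j). *)
Definition sqr_iter (x : Q) j := iter j (fun y => y * y) (star x * x).

Lemma sqr_iter_star x j : star (sqr_iter x j) = sqr_iter x j.
Proof. by elim: j => [|j IH] /=; rewrite starM ?starK // IH. Qed.

Lemma csemi_sqr_iter p x j : cstar_seminorm p -> p (sqr_iter x j) = p x ^+ (2 ^ j.+1).
Proof.
move=> pP; elim: j => [|j IH]; first exact: (csemi_star pP).
rewrite /= -/(sqr_iter x j) -{1}sqr_iter_star (csemi_star pP) IH.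
by rewrite -exprM mulnC -expnS.
Qed.

(** Constants that grow slowly disappear when the root of order 2^(j+1) of the
    inequality for [sqr_iter x j] is taken. *)
Lemma csemi_le_of_growth (p q : Q -> R) x (C : R) :
  cstar_seminorm p -> cstar_seminorm q ->
  (forall j, p (sqr_iter x j) <= C * 2 ^+ j * q (sqr_iter x j)) -> p x <= q x.
Proof.
move=> pP qP h; apply: (@exp_growth_le _ _ C); rewrite ?csemi_ge0 // => j.
by rewrite -!csemi_sqr_iter.
Qed.

End CStarSeminorms.

(** * The core and the grading *)

Section Core.
Variables (R : realType) (A B1 B2 : cstarType R) (E : coefficients A B1 B2).
Variables (H : lmodType R[i]) (X : quad_module E H).
Variables (M N : nat) (u : 'I_M -> H) (v : 'I_N -> H).
Variables (Q : starAlgType R) (f1 : B1 -> Q) (f2 : B2 -> Q).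
Variables (S : 'I_M -> Q) (T : 'I_N -> Q).
Hypotheses (f1P : starhom f1) (f2P : starhom f2).
Hypothesis STP : relationsH X u v f1 f2 S T.

Let L := ('I_M + 'I_N)%type.
Implicit Types (a b c : L) (x y : Q).

Definition gen a : Q := match a with inl i => S i | inr k => T k end.

Lemma sum_gen : \sum_a gen a * star (gen a) = 1.
Proof. by rewrite big_sumType /= (relH_unit STP). Qed.

Lemma split_left x : x = \sum_a gen a * (star (gen a) * x).
Proof.
rewrite -{1}[x]mul1r -sum_gen mulr_suml; apply: eq_bigr => a _.
by rewrite mulrA.
Qed.

Lemma split_mid x y : x * y = \sum_a (x * gen a) * (star (gen a) * y).
Proof.
rewrite {1}(split_left y) mulr_sumr; apply: eq_bigr => a _.
by rewrite mulrA.
Qed.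

(** The corner of a core element between the letters [a] and [b]: it lies in
    [B1] between two [S], in [B2] between two [T], and vanishes otherwise. *)
Definition corner a b x : Prop :=
  match a, b with
  | inl _, inl _ => range f1 x
  | inr _, inr _ => range f2 x
  | _, _ => x = 0
  end.

Lemma starhom0 (B : cstarType R) (f : B -> Q) : starhom f -> f 0 = 0.
Proof. by move=> fP; rewrite -(scale0r (0 : B)) (starhomZ fP) scale0r. Qed.

Lemma corner0 a b : corner a b 0.
Proof.
by case: a b => [?|?] [?|?] //=; exists 0 => //; apply: starhom0.
Qed.

Lemma cornerD a b x y : corner a b x -> corner a b y -> corner a b (x + y).
Proof.
case: a b => [?|?] [?|?] /=.
- by move=> [z _ <-] [w _ <-]; exists (z + w); rewrite ?(starhomD f1P).
- by move=> -> ->; rewrite addr0.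
- by move=> -> ->; rewrite addr0.
- by move=> [z _ <-] [w _ <-]; exists (z + w); rewrite ?(starhomD f2P).
Qed.

Lemma cornerZ a b (k : R[i]) x : corner a b x -> corner a b (k *: x).
Proof.
case: a b => [?|?] [?|?] /=.
- by move=> [z _ <-]; exists (k *: z); rewrite ?(starhomZ f1P).
- by move=> ->; rewrite scaler0.
- by move=> ->; rewrite scaler0.
- by move=> [z _ <-]; exists (k *: z); rewrite ?(starhomZ f2P).
Qed.

Lemma cornerM a c b x y : corner a c x -> corner c b y -> corner a b (x * y).
Proof.
case: a c b => [?|?] [?|?] [?|?] /=.
- by move=> [z _ <-] [w _ <-]; exists (z * w); rewrite ?(starhomM f1P).
- by move=> _ ->; rewrite mulr0.
- by move=> -> ->; rewrite mul0r; exists 0 => //; exact: starhom0.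
- by move=> ->; rewrite mul0r.
- by move=> ->; rewrite mul0r.
- by move=> -> ->; rewrite mul0r; exists 0 => //; exact: starhom0.
- by move=> _ ->; rewrite mulr0.
- by move=> [z _ <-] [w _ <-]; exists (z * w); rewrite ?(starhomM f2P).
Qed.

Lemma corner_star a b x : corner a b x -> corner b a (star x).
Proof.
case: a b => [?|?] [?|?] /=.
- by move=> [z _ <-]; exists (star z); rewrite ?(starhom_star f1P).
- by move=> ->; rewrite star0.
- by move=> ->; rewrite star0.
- by move=> [z _ <-]; exists (star z); rewrite ?(starhom_star f2P).
Qed.

Lemma corner_sum a b (F : L -> Q) :
  (forall c, corner a b (F c)) -> corner a b (\sum_c F c).
Proof.
move=> h; elim/big_ind: _ => //; first exact: corner0.
exact: cornerD.
Qed.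

Lemma corner_gram a b : corner a b (star (gen a) * gen b).
Proof.
case: a b => [i|k] [j|l] /=.
- by rewrite (relH_SS STP); eexists.
- by rewrite (relH_ST STP).
- by rewrite -[RHS]star0 -(relH_ST STP j k) starM starK.
- by rewrite (relH_TT STP); eexists.
Qed.

(** The relations move elements of [B1] and [B2] to the right of a generator,
    where they end up in the corner of that generator. *)
Lemma f1_gen (z : B1) b : exists F : L -> Q,
  f1 z * gen b = \sum_c gen c * F c /\ forall c, corner c b (F c).
Proof.
case: b => [j|l] /=.
- exists (fun c => match c with inl i => f1 (ip1 X (u i) (phi1 X z (u j))) | _ => 0 end).
  split; last by case=> [?|?] //=; eexists.
  by rewrite big_sumType /= (relH_1S STP) [X in _ + X]big1 ?addr0 // => *; rewrite mulr0.
- exists (fun c => match c with inr k => f2 (ip2 X (v k) (phi1 X z (v l))) | _ => 0 end).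
  split; last by case=> [?|?] //=; eexists.
  by rewrite big_sumType /= (relH_1T STP) [X in X + _]big1 ?add0r // => *; rewrite mulr0.
Qed.

Lemma f2_gen (w : B2) b : exists F : L -> Q,
  f2 w * gen b = \sum_c gen c * F c /\ forall c, corner c b (F c).
Proof.
case: b => [j|l] /=.
- exists (fun c => match c with inl i => f1 (ip1 X (u i) (phi2 X w (u j))) | _ => 0 end).
  split; last by case=> [?|?] //=; eexists.
  by rewrite big_sumType /= (relH_2S STP) [X in _ + X]big1 ?addr0 // => *; rewrite mulr0.
- exists (fun c => match c with inr k => f2 (ip2 X (v k) (phi2 X w (v l))) | _ => 0 end).
  split; last by case=> [?|?] //=; eexists.
  by rewrite big_sumType /= (relH_2T STP) [X in X + _]big1 ?add0r // => *; rewrite mulr0.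
Qed.

(** The elements of degree zero on the first level: the span of the products of a
    generator, a coefficient and an adjoint generator. *)
Definition core x := forall a b, corner a b (star (gen a) * x * gen b).

Lemma core_of_gen x :
  (forall b, exists F : L -> Q,
     x * gen b = \sum_c gen c * F c /\ forall c, corner c b (F c)) -> core x.
Proof.
move=> h a b; have [F [xF FP]] := h b.
rewrite -mulrA xF mulr_sumr; apply: corner_sum => c; rewrite mulrA.
by apply: (@cornerM _ c); [exact: corner_gram | exact: FP].
Qed.

Lemma core_f1 z : core (f1 z). Proof. exact/core_of_gen/f1_gen. Qed.
Lemma core_f2 w : core (f2 w). Proof. exact/core_of_gen/f2_gen. Qed.

Lemma core0 : core 0.
Proof. by move=> a b; rewrite mulr0 mul0r; exact: corner0. Qed.

Lemma core1 : core 1.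
Proof. by move=> a b; rewrite mulr1; exact: corner_gram. Qed.

Lemma coreD x y : core x -> core y -> core (x + y).
Proof. by move=> hx hy a b; rewrite mulrDr mulrDl; apply: cornerD. Qed.

Lemma coreZ (k : R[i]) x : core x -> core (k *: x).
Proof. by move=> hx a b; rewrite -scalerAr -scalerAl; apply: cornerZ. Qed.

Lemma coreM x y : core x -> core y -> core (x * y).
Proof.
move=> hx hy a b; rewrite mulrA -mulrA split_mid; apply: corner_sum => c.
by rewrite [star (gen c) * _]mulrA; apply: (@cornerM _ c).
Qed.

Lemma core_star x : core x -> core (star x).
Proof.
move=> hx a b; have := corner_star (hx b a).
by rewrite !starM starK mulrA.
Qed.

Lemma core_corner a b x : corner a b x -> core x.
Proof.
case: a b => [?|?] [?|?] /=.
- by move=> [z _ <-]; exact: core_f1.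
- by move=> ->; exact: core0.
- by move=> ->; exact: core0.
- by move=> [w _ <-]; exact: core_f2.
Qed.

(** [bidegree m n] is the span of the [w x w'^*] with [x] in the core and [w],
    [w'] words of lengths [m] and [n]; membership is tested by stripping the
    words off, which makes all closure properties inductive. *)
Fixpoint right_degree n x : Prop :=
  if n is n'.+1 then forall b, right_degree n' (x * gen b) else core x.

Fixpoint bidegree m n x : Prop :=
  if m is m'.+1 then forall a, bidegree m' n (star (gen a) * x)
  else right_degree n x.

Lemma bidegreeSr m n x :
  bidegree m n.+1 x <-> forall b, bidegree m n (x * gen b).
Proof.
elim: m x => [|m IH] x //=; split=> h.
- by move=> b a; rewrite mulrA; have /IH := h a; exact.
- by move=> a; apply/IH => b; have := h b a; rewrite mulrA.
Qed.

Lemma bidegree0 m n : bidegree m n 0.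
Proof.
elim: m => [|m IH] /=; last by move=> a; rewrite mulr0.
by elim: n => [|n IH] /=; [exact: core0 | move=> b; rewrite mul0r].
Qed.

Lemma bidegreeD m n x y : bidegree m n x -> bidegree m n y -> bidegree m n (x + y).
Proof.
elim: m x y => [|m IH] x y /=.
  elim: n x y => [|n IH] x y /=; first exact: coreD.
  by move=> hx hy b; rewrite mulrDl; apply: IH.
by move=> hx hy a; rewrite mulrDr; apply: IH.
Qed.

Lemma bidegreeZ m n (k : R[i]) x : bidegree m n x -> bidegree m n (k *: x).
Proof.
elim: m x => [|m IH] x /=.
  elim: n x => [|n IH] x /=; first exact: coreZ.
  by move=> hx b; rewrite -scalerAl; apply: IH.
by move=> hx a; rewrite -scalerAr; apply: IH.
Qed.

Lemma bidegree_sum m n (F : L -> Q) :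
  (forall c, bidegree m n (F c)) -> bidegree m n (\sum_c F c).
Proof.
move=> h; elim/big_ind: _ => //; first exact: bidegree0.
by move=> *; apply: bidegreeD.
Qed.

Lemma bidegree_star m n x : bidegree m n x -> bidegree n m (star x).
Proof.
elim: m n x => [|m IH] n x /=.
  elim: n x => [|n IH] x /=; first exact: core_star.
  by move=> h a; rewrite -starM; apply: IH.
by move=> h; apply/bidegreeSr => b; rewrite -[gen b]starK -starM; apply: IH.
Qed.

Lemma bidegree_raise m n x : bidegree m n x -> bidegree m.+1 n.+1 x.
Proof.
elim: m x => [|m IH] x.
  elim: n x => [|n IH] x; first by move=> h a b; apply: core_corner (h a b).
  move=> h; apply/(bidegreeSr 1%N n.+1) => b; exact: (IH _ (h b)).
by move=> h a; apply: IH.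
Qed.

Lemma bidegree_raise_by j m n x : bidegree m n x -> bidegree (j + m) (j + n) x.
Proof. by move=> h; elim: j => [|j IH] //; exact: bidegree_raise. Qed.

Lemma bidegreeM m n l x y :
  bidegree m n x -> bidegree n l y -> bidegree m l (x * y).
Proof.
elim: m x => [|m IH] x; last first.
  by move=> hx hy a; rewrite mulrA; apply: IH.
elim: l y => [|l IH] y; last first.
  by move=> hx /bidegreeSr hy b; rewrite -mulrA; apply: IH.
elim: n x y => [|n IH] x y /=; first exact: coreM.
move=> hx hy; rewrite split_mid; apply: (@bidegree_sum 0 0) => a.
by apply: IH.
Qed.

Definition homogeneous (k : int) x :=
  exists m n, k = m%:Z - n%:Z /\ bidegree m n x.

Lemma homogeneous0 k : homogeneous k 0.
Proof.
case: k => n; first by exists n, 0%N; rewrite subr0; split=> //; exact: bidegree0.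
by exists 0%N, n.+1; rewrite sub0r NegzE; split=> //; exact: bidegree0.
Qed.

Lemma homogeneousD k x y : homogeneous k x -> homogeneous k y -> homogeneous k (x + y).
Proof.
move=> [m [n [kE hx]]] [m' [n' [kE' hy]]].
exists (m' + m)%N, (m' + n)%N; split; first by rewrite kE; lia.
apply: bidegreeD; first exact: bidegree_raise_by.
have -> : (m' + n = m + n')%N by lia.
by rewrite addnC; exact: bidegree_raise_by.
Qed.

Lemma homogeneousZ k (c : R[i]) x : homogeneous k x -> homogeneous k (c *: x).
Proof. by move=> [m [n [kE hx]]]; exists m, n; split=> //; exact: bidegreeZ. Qed.

Lemma homogeneousM k l x y :
  homogeneous k x -> homogeneous l y -> homogeneous (k + l) (x * y).
Proof.
move=> [m [n [kE hx]]] [m' [n' [lE hy]]].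
exists (m' + m)%N, (n + n')%N; split; first by rewrite kE lE; lia.
apply: bidegreeM (bidegree_raise_by m' hx) _.
by rewrite [(m' + n)%N]addnC; exact: bidegree_raise_by.
Qed.

Lemma homogeneous_star k x : homogeneous k x -> homogeneous (- k) (star x).
Proof.
move=> [m [n [kE hx]]]; exists n, m; split; first by rewrite kE; lia.
exact: bidegree_star.
Qed.

Lemma homogeneous_core x : core x -> homogeneous 0 x.
Proof. by move=> hx; exists 0%N, 0%N. Qed.

Lemma homogeneous_gen a : homogeneous 1 (gen a).
Proof.
exists 1%N, 0%N; split=> // b; exact: core_corner (corner_gram b a).
Qed.

Section Comparison.
Variables p1 p0 : Q -> R.
Hypotheses (p1P : cstar_seminorm p1) (p0P : cstar_seminorm p0).
Hypothesis le_f1 : forall z, p1 (f1 z) <= p0 (f1 z).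
Hypothesis le_f2 : forall w, p1 (f2 w) <= p0 (f2 w).

Let K := \sum_a \sum_b
  (p1 (gen a) * p1 (star (gen b)) * (p0 (star (gen a)) * p0 (gen b))).

(** Recover [x] from its compressions by sandwiching it between two copies of the
    identity [sum_gen]. *)
Lemma compression_bound x (C : R) : 0 <= C ->
  (forall a b, p1 (star (gen a) * x * gen b) <= C * p0 (star (gen a) * x * gen b)) ->
  p1 x <= C * K * p0 x.
Proof.
move=> C0 h.
have {1}-> : x = \sum_a \sum_b gen a * (star (gen a) * x * gen b) * star (gen b).
  rewrite {1}(split_left x); apply: eq_bigr => a _.
  rewrite -{1}[star (gen a) * x]mulr1 -sum_gen !mulr_sumr; apply: eq_bigr => b _.
  by rewrite !mulrA.
apply: le_trans (csemi_sum _ p1P) _; rewrite /K mulr_sumr mulr_suml.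
apply: ler_sum => a _; apply: le_trans (csemi_sum _ p1P) _.
rewrite mulr_sumr mulr_suml; apply: ler_sum => b _.
have g0 y : 0 <= p1 y by exact: csemi_ge0.
have g0' y : 0 <= p0 y by exact: csemi_ge0.
apply: le_trans (csemiM p1P _ _) _.
apply: (@le_trans _ _ (p1 (gen a) * p1 (star (gen a) * x * gen b) * p1 (star (gen b)))).
  by apply: ler_wpM2r => //; exact: (csemiM p1P).
rewrite mulrAC.
have -> : C * (p1 (gen a) * p1 (star (gen b)) * (p0 (star (gen a)) * p0 (gen b))) * p0 x
  = p1 (gen a) * p1 (star (gen b)) * (C * (p0 (star (gen a)) * p0 x * p0 (gen b))).
  by ring.
apply: ler_wpM2l; first exact: mulr_ge0.
apply: le_trans (h a b) _; apply: ler_wpM2l => //.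
apply: le_trans (csemiM p0P _ _) _; apply: ler_wpM2r => //; exact: (csemiM p0P).
Qed.

Let K_ge0 : 0 <= K.
Proof.
apply: sumr_ge0 => a _; apply: sumr_ge0 => b _.
by rewrite !mulr_ge0 // csemi_ge0.
Qed.

(** After [m] rounds of compression only coefficients remain, on which [p1 <= p0];
    every round multiplies the constant by [K]. *)
Lemma bidegree_bound m : exists2 C : R, 0 <= C &
  forall x, bidegree m m x -> p1 x <= C * p0 x.
Proof.
elim: m => [|m [C C0 IH]].
  exists (1 * K); first by rewrite mul1r K_ge0.
  move=> x hx; apply: compression_bound => // a b; rewrite mul1r.
  have : corner a b (star (gen a) * x * gen b) by exact: hx.
  have z0 (p : Q -> R) : cstar_seminorm p -> p 0 = 0.
    by move=> pP; have := csemiZ pP 0 0; rewrite scaler0 (cmod_real 0) normr0 mul0r.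
  case: a b => [?|?] [?|?] /=.
  - by move=> [z _ <-]; exact: le_f1.
  - by move=> ->; rewrite !z0.
  - by move=> ->; rewrite !z0.
  - by move=> [w _ <-]; exact: le_f2.
exists (C * K); first by rewrite mulr_ge0 ?K_ge0.
move=> x hx; apply: compression_bound => // a b; apply: IH.
by move: (hx a) => /bidegreeSr; exact.
Qed.

(** In bidegree (m, m) the powers of [star y * y] stay in the same bidegree, so the
    constant of [bidegree_bound] is the same for all of them. For other degrees,
    [star x * x] has degree zero. *)
Lemma homogeneous_le k x : homogeneous k x -> p1 x <= p0 x.
Proof.
have deg0 y m : bidegree m m y -> p1 y <= p0 y.
  move=> hy; have [C C0 hC] := bidegree_bound m.
  apply: (@csemi_le_of_growth _ _ _ _ _ C) => // j.
  have dj : bidegree m m (sqr_iter y j).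
    elim: j => [|j IH] /=; last exact: (bidegreeM IH IH).
    exact: (bidegreeM (bidegree_star hy) hy).
  apply: le_trans (hC _ dj) _; apply: ler_wpM2r; first exact: csemi_ge0.
  by rewrite ler_peMr // exprn_ege1 // ler1n.
move=> [m [n [_ hx]]].
rewrite -ler_sqr ?nnegrE ?csemi_ge0 // -(csemi_star p1P) -(csemi_star p0P).
exact: (deg0 _ n (bidegreeM (bidegree_star hx) hx)).
Qed.

(** An abstract grading [G], to be taken as the grading by the spectral subspaces
    of a gauge action; [fourier_le] is what the invariance of [p0] under the
    action provides. *)
Variable G : int -> Q -> Prop.
Hypothesis G0 : forall k, G k 0.
Hypothesis GD : forall k x y, G k x -> G k y -> G k (x + y).
Hypothesis GZ : forall k (c : R[i]) x, G k x -> G k (c *: x).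
Hypothesis GM : forall k l x y, G k x -> G l y -> G (k + l) (x * y).
Hypothesis Gstar : forall k x, G k x -> G (- k) (star x).
Hypothesis Ggen : forall a, G 1 (gen a).
Hypothesis Gf1 : forall z, G 0 (f1 z).
Hypothesis Gf2 : forall w, G 0 (f2 w).
Hypothesis fourier_le : forall d (c : 'I_(d.*2.+1) -> Q),
  (forall i : 'I_(d.*2.+1), G (i%:Z - d%:Z) (c i)) -> forall i, p0 (c i) <= p0 (\sum_j c j).

(** Sums of components of degrees -d, ..., d; the component number [i] has degree
    i - d. *)
Definition graded_below d x := exists c : 'I_(d.*2.+1) -> Q,
  (forall i : 'I_(d.*2.+1), homogeneous (i%:Z - d%:Z) (c i) /\ G (i%:Z - d%:Z) (c i))
  /\ x = \sum_i c i.

Lemma graded_below_hom d k x : homogeneous k x -> G k x -> `|k| <= d%:Z ->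
  graded_below d x.
Proof.
move=> hx gx kd; pose c (i : 'I_(d.*2.+1)) := if i%:Z - d%:Z == k then x else 0.
exists c; split.
  by move=> i; rewrite /c; case: eqP => [->|_]; split=> //; exact: homogeneous0.
have kn : (`|(k + d%:Z)%R|%N < d.*2.+1)%N by lia.
rewrite (bigD1 (Ordinal kn)) //= big1 ?addr0; first by rewrite /c ifT //=; lia.
move=> i ni; rewrite /c; case: eqP => // ik; case/eqP: ni; apply/val_inj => /=; lia.
Qed.

Lemma graded_below0 d : graded_below d 0.
Proof.
exists (fun=> 0); rewrite big1 //; split=> // i; split=> //; exact: homogeneous0.
Qed.

Lemma graded_belowD d x y : graded_below d x -> graded_below d y -> graded_below d (x + y).
Proof.
move=> [c [cP ->]] [c' [cP' ->]]; exists (fun i => c i + c' i).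
rewrite big_split; split=> // i; have [h g] := cP i; have [h' g'] := cP' i.
by split; [exact: homogeneousD | exact: GD].
Qed.

Lemma graded_below_sum d (I : finType) (F : I -> Q) :
  (forall i, graded_below d (F i)) -> graded_below d (\sum_i F i).
Proof.
move=> h; elim/big_ind: _ => //; first exact: graded_below0.
exact: graded_belowD.
Qed.

Lemma graded_belowZ d (k : R[i]) x : graded_below d x -> graded_below d (k *: x).
Proof.
move=> [c [cP ->]]; exists (fun i => k *: c i).
rewrite scaler_sumr; split=> // i; have [h g] := cP i.
by split; [exact: homogeneousZ | exact: GZ].
Qed.

Lemma graded_below_star d x : graded_below d x -> graded_below d (star x).
Proof.
move=> [c [cP ->]].
have -> : star (\sum_i c i) = \sum_i star (c i).
  by apply: (big_morph (@star R Q)); [exact: starD | exact: star0].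
apply: graded_below_sum => i; have [h g] := cP i.
apply: graded_below_hom (homogeneous_star h) (Gstar g) _.
by have := ltn_ord i; lia.
Qed.

Lemma graded_belowM d e x y :
  graded_below d x -> graded_below e y -> graded_below (d + e) (x * y).
Proof.
move=> [c [cP ->]] [c' [cP' ->]]; rewrite mulr_suml; apply: graded_below_sum => i.
rewrite mulr_sumr; apply: graded_below_sum => j.
have [h g] := cP i; have [h' g'] := cP' j.
apply: graded_below_hom (homogeneousM h h') (GM g g') _.
by have := ltn_ord i; have := ltn_ord j; lia.
Qed.

Lemma graded_below_le d e x : (d <= e)%N -> graded_below d x -> graded_below e x.
Proof.
move=> de [c [cP ->]]; apply: graded_below_sum => i; have [h g] := cP i.
by apply: graded_below_hom h g _; have := ltn_ord i; lia.
Qed.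

Lemma peval_graded t : exists d, graded_below d (peval f1 f2 S T t).
Proof.
elim: t => [i|k|z|w||s [d ds] t [e et]|c s [d ds]|s [d ds] t [e et]|s [d ds]] /=.
- by exists 1%N; apply: graded_below_hom (homogeneous_gen (inl i)) (Ggen (inl i)) _.
- by exists 1%N; apply: graded_below_hom (homogeneous_gen (inr k)) (Ggen (inr k)) _.
- by exists 0%N; apply: graded_below_hom (homogeneous_core (core_f1 z)) (Gf1 z) _.
- by exists 0%N; apply: graded_below_hom (homogeneous_core (core_f2 w)) (Gf2 w) _.
- exists 0%N; apply: graded_below_hom (homogeneous_core core1) _ _ => //.
  rewrite -sum_gen; elim/big_ind: _ => // [|a _]; first exact: GD.
  by rewrite -(subrr 1); apply: GM => //; apply: Gstar.
- exists (d + e)%N; apply: graded_belowD.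
    by apply: graded_below_le ds; rewrite leq_addr.
  by apply: graded_below_le et; rewrite leq_addl.
- by exists d; exact: graded_belowZ.
- by exists (d + e)%N; exact: graded_belowM.
- by exists d; exact: graded_below_star.
Qed.

(** An [x] of degree at most d has 2d+1 components, so [p1 x <= (2d+1) * p0 x]; and
    [sqr_iter x j] has degree at most 2^(j+1) d. *)
Lemma gauge_invariant_le t : p1 (peval f1 f2 S T t) <= p0 (peval f1 f2 S T t).
Proof.
have bound d x : graded_below d x -> p1 x <= d.*2.+1%:R * p0 x.
  move=> [c [cP ->]]; apply: le_trans (csemi_sum _ p1P) _.
  apply: (@le_trans _ _ (\sum_(i < d.*2.+1) p0 (\sum_j c j))).
    apply: ler_sum => i _; apply: le_trans (homogeneous_le (cP i).1) _.
    by apply: fourier_le => j; exact: (cP j).2.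
  by rewrite sumr_const card_ord mulr_natl.
have [d dt] := peval_graded t; set x := peval _ _ _ _ t in dt *.
(* For D = 2^(j+1) d, the constant 2D+1 is at most (4d+1) 2^j. *)
apply: (@csemi_le_of_growth _ _ _ _ _ (4 * d%:R + 1)) => // j.
have dj : graded_below (2 ^ j.+1 * d) (sqr_iter x j).
  elim: j => [|j IH] /=.
    by rewrite expn1 mul2n -addnn; apply: graded_belowM; first exact: graded_below_star.
  by rewrite expnS -mulnA mul2n -addnn; apply: graded_belowM.
apply: le_trans (bound _ _ dj) _; apply: ler_wpM2r; first exact: csemi_ge0.
have : 1 <= 2 ^+ j :> R by rewrite exprn_ege1 // ler1n.
have -> : (2 ^ j.+1 * d).*2.+1%:R = 4 * 2 ^+ j * d%:R + 1 :> R.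
  by rewrite -natr1 -muln2 expnS !natrM natrX; ring.
have : 0 <= d%:R :> R by [].
set Y := 2 ^+ j; nra.
Qed.

End Comparison.
End Core.

(** * Fourier coefficients of a gauge action *)

Section FourierBound.
Variable R : realType.
Implicit Types (r s : R).

Lemma expi2piD r s : expi2pi (r + s) = expi2pi r * expi2pi s.
Proof.
rewrite /expi2pi mulrDr cosD sinD; apply/eqP; rewrite eq_complex /=.
by apply/andP; split; apply/eqP; ring.
Qed.

Lemma expi2pi0 : expi2pi (0 : R) = 1.
Proof. by rewrite /expi2pi mulr0 cos0 sin0. Qed.

Lemma expi2pi_conj r : ((expi2pi r)^*)%C = expi2pi (- r).
Proof. by rewrite /expi2pi mulrN cosN sinN. Qed.

Lemma cmod_expi2pi r : cmod (expi2pi r) = 1.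
Proof.
apply/eqP; rewrite -(@eqrXn2 _ 2) ?cmod_ge0 ?ler01 // cmod_sqr expr1n /=.
by rewrite cos2Dsin2.
Qed.

Lemma expi2piX r n : expi2pi (r * n%:R) = expi2pi r ^+ n.
Proof.
elim: n => [|n IH]; first by rewrite mulr0 expi2pi0 expr0.
by rewrite -natr1 mulrDr mulr1 expi2piD IH exprSr.
Qed.

Lemma expi2pi_nat n : expi2pi (n%:R : R) = 1.
Proof.
rewrite -[n%:R]mul1r expi2piX.
suff -> : expi2pi (1 : R) = 1 by rewrite expr1n.
by rewrite /expi2pi mulr1 mulr_natl cos2pi sin2pi.
Qed.

Lemma expi2pi_neq1 r : 0 < r < 1 -> expi2pi r != 1.
Proof.
move=> /andP[r0 r1]; rewrite eq_complex /= negb_and; apply/orP; left.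
have -> : 2 * pi * r = (pi * r) *+ 2 by rewrite mulr2n; ring.
rewrite cos_mulr2n -subr_eq0 cos2sin2.
have : 0 < sin (pi * r).
  by apply: sin_gt0_pi; rewrite mulr_gt0 ?pi_gt0 //= gtr_pMr ?pi_gt0.
set x := sin _ => x0; apply/eqP => h; have := exprn_gt0 2 x0; lra.
Qed.

(** A geometric sum over the powers of a nontrivial root of unity. *)
Lemma expi2pi_sum_eq0 L (k i : nat) : (k < L)%N -> (i < L)%N -> i != k ->
  \sum_(j < L) expi2pi ((i%:R - k%:R) / L%:R * j%:R : R) = 0.
Proof.
move=> kL iL ik; have L0 : 0 < L%:R :> R by rewrite ltr0n; apply: leq_trans kL.
set t := _ / _; have tL : t * L%:R = i%:R - k%:R by rewrite divfK ?gt_eqF.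
have w1 : expi2pi t != 1.
  have [lt_ki|lt_ik|/eqP] := ltgtP k i; last by rewrite eq_sym (negPf ik).
    apply: expi2pi_neq1; rewrite divr_gt0 ?subr_gt0 ?ltr_nat //=.
    rewrite ltr_pdivrMr // mul1r ltrBlDr -natrD ltr_nat; lia.
  apply: contra_neq (expi2pi_neq1 (r := - t) _) => [h|].
    by rewrite -expi2pi_conj h conjc1.
  rewrite /t -mulNr opprB divr_gt0 ?subr_gt0 ?ltr_nat //=.
  by rewrite ltr_pdivrMr // mul1r ltrBlDr -natrD ltr_nat; lia.
have wL : expi2pi t ^+ L = 1.
  rewrite -expi2piX tL expi2piD expi2pi_nat mul1r -expi2pi_conj expi2pi_nat.
  exact: conjc1.
under eq_bigr do rewrite expi2piX.
have := subrX1 (expi2pi t) L; rewrite wL subrr => /esym/eqP.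
by rewrite mulf_eq0 subr_eq0 (negPf w1) /= => /eqP.
Qed.

(** The Fourier coefficients of an element of a finite sum of spectral subspaces
    are averages of its translates over a cyclic subgroup of the circle. *)
Lemma fourier_coefficient_le (D : cstarType R) (d : nat) (h : R -> D -> D)
    (c : 'I_(d.*2.+1) -> D) :
  (forall r, h r (\sum_i c i) = \sum_i h r (c i)) ->
  (forall r, cnorm (h r (\sum_i c i)) <= cnorm (\sum_i c i)) ->
  (forall r (i : 'I_(d.*2.+1)),
     h r (c i) = expi2pi (r * (i%:Z - d%:Z)%:~R) *: c i) ->
  forall k, cnorm (c k) <= cnorm (\sum_i c i).
Proof.
move=> hsum hle hc k; set x := \sum_i c i; set L := d.*2.+1.
have L0 : 0 < L%:R :> R by rewrite ltr0n.
pose z (j : 'I_L) : R[i] := expi2pi (- (j%:R / L%:R * (k%:Z - d%:Z)%:~R)).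
have avg : L%:R%:C *: c k = \sum_(j < L) z j *: h (j%:R / L%:R) x.
  transitivity (\sum_(i < L) (\sum_(j < L)
      expi2pi ((i%:R - k%:R) / L%:R * j%:R : R)) *: c i).
    rewrite (bigD1 k) //= [X in _ + X]big1 ?addr0.
      congr (_ *: _); under eq_bigr do rewrite subrr !mul0r expi2pi0.
      by rewrite sumr_const card_ord rmorph_nat.
    by move=> i ik; rewrite expi2pi_sum_eq0 ?scale0r.
  under eq_bigr do rewrite scaler_suml.
  rewrite exchange_big; apply: eq_bigr => j _ /=.
  rewrite /x hsum scaler_sumr; apply: eq_bigr => i _.
  rewrite hc scalerA -expi2piD; congr (expi2pi _ *: _).
  rewrite !intrB /=; ring.
have : cnorm (L%:R%:C *: c k) <= \sum_(j < L) cnorm x.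
  rewrite avg; elim/big_ind2: _ => [|a b a' b' ha hb|j _]; first by rewrite cnorm0.
    by apply: le_trans (cnormD _ _) _; apply: lerD.
  by rewrite cnormZ -/(cmod _) cmod_expi2pi mul1r hle.
rewrite cnormZr ger0_norm ?(ltW L0) // sumr_const card_ord.
rewrite -[X in _ <= X -> _]mulr_natl.
by rewrite ler_pM2l.
Qed.

End FourierBound.

Section ProductStar.
Variables (R : realType) (P Q : starAlgType R).

Definition pair_star (x : P * Q) : P * Q := (star x.1, star x.2).

Lemma pair_starD x y : pair_star (x + y) = pair_star x + pair_star y.
Proof. by rewrite /pair_star !starD. Qed.
Lemma pair_starZ (c : R[i]) x : pair_star (c *: x) = (c^*)%C *: pair_star x.
Proof. by rewrite /pair_star !starZ. Qed.
Lemma pair_starM x y : pair_star (x * y) = pair_star y * pair_star x.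
Proof. by rewrite /pair_star !starM. Qed.
Lemma pair_starK x : pair_star (pair_star x) = x.
Proof. by case: x => a b; rewrite /pair_star !starK. Qed.

HB.instance Definition _ := hasStar.Build R (P * Q)%type
  pair_starD pair_starZ pair_starM pair_starK.

End ProductStar.

(** * Extension by density and the uniqueness theorem *)

Section DenseExtension.
Variables (R : realType) (U : Type) (P Q : cstarType R).
Variables (a : U -> P) (b : U -> Q).

(** The closure of the graph of the partial map [a p |-> b p]. *)
Definition closed_graph (x : P) (y : Q) : Prop := forall e : R, 0 < e ->
  exists p, cnorm (x - a p) < e /\ cnorm (y - b p) < e.

Hypothesis iso : forall p q, cnorm (a p - a q) = cnorm (b p - b q).

(** As the hypothesis is symmetric in [a] and [b], this serves both to define the
    extension everywhere and to see that its range is closed. *)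
Lemma closed_graph_ex x : cclosure (range a) x -> exists y, closed_graph x y.
Proof.
move=> xa.
have ap n : exists p, cnorm (x - a p) < n.+1%:R^-1.
  have [|_ [p _ <-] hp] := xa n.+1%:R^-1; first by rewrite invr_gt0 ltr0Sn.
  by exists p.
pose p n := projT1 (cid (ap n)).
have pP n : cnorm (x - a (p n)) < n.+1%:R^-1 := projT2 (cid (ap n)).
have small (e : R) : 0 < e -> exists n0, forall n, (n0 <= n)%N ->
    cnorm (x - a (p n)) < e.
  move=> e0; have [n0 _ h0] := near_infty_natSinv_lt (PosNum e0).
  by exists n0 => n /h0 /=; apply: lt_trans.
have [|y yP] := @cauchy_limit _ _ (b \o p).
  move=> e e0; have [n0 h0] := small _ (divr_gt0 e0 (ltr0n _ 2)).
  exists n0 => m n /h0 hm /h0 hn /=; rewrite -iso.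
  apply: le_lt_trans (cnorm_sub_trans x _ _) _; rewrite (cnorm_distC _ x); lra.
exists y => e e0; have [n1 h1] := small e e0; have [n2 h2] := yP e e0.
exists (p (maxn n1 n2)); split; first by apply: h1; rewrite leq_maxl.
by rewrite cnorm_distC; apply: h2; rewrite leq_maxr.
Qed.

End DenseExtension.

Section Uniqueness.
Variables (R : realType) (A B1 B2 : cstarType R).
Variables (E : coefficients A B1 B2) (H : lmodType R[i]) (X : quad_module E H).
Variables (M N : nat) (u : 'I_M -> H) (v : 'I_N -> H).
Variables (OH : cstarType R) (kappa : univ_alg X u v -> OH).
Hypothesis kappaP : is_OH kappa.
Variables (D : cstarType R) (f1 : B1 -> D) (f2 : B2 -> D).
Hypotheses (f1P : starhom f1) (f2P : starhom f2).
Variables (S : 'I_M -> D) (T : 'I_N -> D).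
Hypothesis STP : relationsH X u v f1 f2 S T.

Let U := univ_alg X u v.
Let ev : U -> D := ueval f1 f2 S T.
Implicit Types p q : U.

Lemma kappa0 : kappa 0 = 0.
Proof. by rewrite -(scale0r 0) (OH_Z kappaP) scale0r. Qed.

Lemma kappa_sum (I : finType) (F : I -> U) :
  kappa (\sum_i F i) = \sum_i kappa (F i).
Proof. exact: (big_morph kappa (OH_D kappaP) kappa0). Qed.

Lemma kappa_uB1 : starhom (fun z => kappa (uB1 X u v z)).
Proof.
split=> *; rewrite ?(uB1D, uB1Z, uB1M, uB1star).
- exact: (OH_D kappaP).
- exact: (OH_Z kappaP).
- exact: (OH_M kappaP).
- exact: (OH_star kappaP).
Qed.

Lemma kappa_uB2 : starhom (fun w => kappa (uB2 X u v w)).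
Proof.
split=> *; rewrite ?(uB2D, uB2Z, uB2M, uB2star).
- exact: (OH_D kappaP).
- exact: (OH_Z kappaP).
- exact: (OH_M kappaP).
- exact: (OH_star kappaP).
Qed.

Lemma kappa_relations : relationsH X u v
  (fun z => kappa (uB1 X u v z)) (fun w => kappa (uB2 X u v w))
  (fun i => kappa (uS X u v i)) (fun k => kappa (uT X u v k)).
Proof.
split.
- rewrite -(OH_1 kappaP) -univ_unit (OH_D kappaP) !kappa_sum.
  by congr (_ + _); apply: eq_bigr => i _; rewrite (OH_M kappaP) (OH_star kappaP).
- move=> j l; rewrite -(OH_star kappaP) -(OH_M kappaP) -kappa0; congr kappa.
  apply: univ_eqP => Q g1 g2 S' T' h1 h2 h.
  by rewrite !(ueval_opE h1 h2 h) !(ueval_genE h1 h2 h) (relH_ST h).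
- move=> i j; rewrite -(OH_star kappaP) -(OH_M kappaP); congr kappa.
  apply: univ_eqP => Q g1 g2 S' T' h1 h2 h.
  by rewrite !(ueval_opE h1 h2 h) !(ueval_genE h1 h2 h) (relH_SS h).
- move=> k l; rewrite -(OH_star kappaP) -(OH_M kappaP); congr kappa.
  apply: univ_eqP => Q g1 g2 S' T' h1 h2 h.
  by rewrite !(ueval_opE h1 h2 h) !(ueval_genE h1 h2 h) (relH_TT h).
- move=> z j; rewrite -(OH_M kappaP); under eq_bigr do rewrite -(OH_M kappaP).
  rewrite -kappa_sum; congr kappa; apply: univ_eqP => Q g1 g2 S' T' h1 h2 h.
  rewrite !(ueval_opE h1 h2 h) !(ueval_genE h1 h2 h) (relH_1S h).
  by apply: eq_bigr => i _; rewrite !(ueval_opE h1 h2 h) !(ueval_genE h1 h2 h).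
- move=> z j; rewrite -(OH_M kappaP); under eq_bigr do rewrite -(OH_M kappaP).
  rewrite -kappa_sum; congr kappa; apply: univ_eqP => Q g1 g2 S' T' h1 h2 h.
  rewrite !(ueval_opE h1 h2 h) !(ueval_genE h1 h2 h) (relH_1T h).
  by apply: eq_bigr => i _; rewrite !(ueval_opE h1 h2 h) !(ueval_genE h1 h2 h).
- move=> z j; rewrite -(OH_M kappaP); under eq_bigr do rewrite -(OH_M kappaP).
  rewrite -kappa_sum; congr kappa; apply: univ_eqP => Q g1 g2 S' T' h1 h2 h.
  rewrite !(ueval_opE h1 h2 h) !(ueval_genE h1 h2 h) (relH_2S h).
  by apply: eq_bigr => i _; rewrite !(ueval_opE h1 h2 h) !(ueval_genE h1 h2 h).
- move=> z j; rewrite -(OH_M kappaP); under eq_bigr do rewrite -(OH_M kappaP).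
  rewrite -kappa_sum; congr kappa; apply: univ_eqP => Q g1 g2 S' T' h1 h2 h.
  rewrite !(ueval_opE h1 h2 h) !(ueval_genE h1 h2 h) (relH_2T h).
  by apply: eq_bigr => i _; rewrite !(ueval_opE h1 h2 h) !(ueval_genE h1 h2 h).
Qed.

(** Both solutions of the relations are handled at once in the product
    *-algebra; its two C*-seminorms are the norms of the components. *)
Let Q := (OH * D)%type.
Let g1 (z : B1) : Q := (kappa (uB1 X u v z), f1 z).
Let g2 (w : B2) : Q := (kappa (uB2 X u v w), f2 w).
Let gS i : Q := (kappa (uS X u v i), S i).
Let gT k : Q := (kappa (uT X u v k), T k).

Lemma pair_hom (B : cstarType R) (r : B -> OH) (s : B -> D) :
  starhom r -> starhom s -> starhom (fun z => (r z, s z) : Q).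
Proof.
by move=> [rD rZ rM rS] [sD sZ sM sS]; split=> *; rewrite ?rD ?rZ ?rM ?rS ?sD ?sZ ?sM ?sS.
Qed.

Lemma fst_sum (I : finType) (F : I -> Q) : (\sum_i F i).1 = \sum_i (F i).1.
Proof. exact: (big_morph (fun x : Q => x.1)). Qed.

Lemma snd_sum (I : finType) (F : I -> Q) : (\sum_i F i).2 = \sum_i (F i).2.
Proof. exact: (big_morph (fun x : Q => x.2)). Qed.

Lemma pair_relations : relationsH X u v g1 g2 gS gT.
Proof.
have [r1 r2 r3 r4 r5 r6 r7 r8] := kappa_relations.
have [s1 s2 s3 s4 s5 s6 s7 s8] := STP.
split.
- have addE (x y : Q) : ((x + y).1 = x.1 + y.1) * ((x + y).2 = x.2 + y.2) by [].
  by apply: injective_projections; rewrite addE ?fst_sum ?snd_sum; [exact: r1 | exact: s1].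
- by move=> j l; apply: injective_projections; [exact: r2 | exact: s2].
- by move=> i j; apply: injective_projections; [exact: r3 | exact: s3].
- by move=> k l; apply: injective_projections; [exact: r4 | exact: s4].
- by move=> z j; apply: injective_projections; rewrite ?fst_sum ?snd_sum; [exact: r5 | exact: s5].
- by move=> z l; apply: injective_projections; rewrite ?fst_sum ?snd_sum; [exact: r6 | exact: s6].
- by move=> w j; apply: injective_projections; rewrite ?fst_sum ?snd_sum; [exact: r7 | exact: s7].
- by move=> w l; apply: injective_projections; rewrite ?fst_sum ?snd_sum; [exact: r8 | exact: s8].
Qed.

Lemma peval_pair t : peval g1 g2 gS gT t = (kappa (univ_class X u v t), peval f1 f2 S T t).
Proof.
elim: t => [i|k|z|w||s IHs t IHt|c s IHs|s IHs t IHt|s IHs] //=.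
- by apply: injective_projections => //=; exact/esym/(OH_1 kappaP).
- by rewrite IHs IHt univ_class_add (OH_D kappaP).
- by rewrite IHs univ_class_scale (OH_Z kappaP).
- by rewrite IHs IHt univ_class_mul (OH_M kappaP).
- by rewrite IHs univ_class_star (OH_star kappaP).
Qed.

Lemma seminorm_fst : cstar_seminorm (fun x : Q => cnorm x.1).
Proof.
by split=> *; [exact: cnormD | exact: cnormZ | exact: cnormM | exact: cnorm_star].
Qed.

Lemma seminorm_snd : cstar_seminorm (fun x : Q => cnorm x.2).
Proof.
by split=> *; [exact: cnormD | exact: cnormZ | exact: cnormM | exact: cnorm_star].
Qed.

Let O := hatO f1 f2 S T.

Lemma hatO_subalgebra : cstar_subalgebra O.
Proof.
split.
- by move=> V [hV _]; exact: csub0 hV.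
- by move=> x y hx hy V hV; apply: (csubD hV.1); [exact: hx | exact: hy].
- by move=> c x hx V hV; apply: (csubZ hV.1); exact: hx.
- by move=> x y hx hy V hV; apply: (csubM hV.1); [exact: hx | exact: hy].
- by move=> x hx V hV; apply: (csub_star hV.1); exact: hx.
- move=> x hx V hV; apply: (csub_closed hV.1) => e /hx[y hy xy].
  by exists y => //; exact: hy.
Qed.

Lemma hatO_gen x : (range S `|` range T `|` range f1 `|` range f2) x -> O x.
Proof. by move=> hx V [_]; exact. Qed.

Lemma hatO_S i : O (S i). Proof. by apply: hatO_gen; do 3!left; exists i. Qed.
Lemma hatO_T k : O (T k). Proof. by apply: hatO_gen; do 2!left; right; exists k. Qed.
Lemma hatO_f1 z : O (f1 z). Proof. by apply: hatO_gen; left; right; exists z. Qed.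
Lemma hatO_f2 w : O (f2 w). Proof. by apply: hatO_gen; right; exists w. Qed.

Lemma hatO_sum (I : finType) (F : I -> D) : (forall i, O (F i)) -> O (\sum_i F i).
Proof.
move=> h; elim/big_ind: _ => //; first exact: (csub0 hatO_subalgebra).
exact: (csubD hatO_subalgebra).
Qed.

Lemma hatO_1 : O 1.
Proof.
have [_ OD _ OM Ostar _] := hatO_subalgebra.
rewrite -(relH_unit STP); apply: OD; apply: hatO_sum => i; apply: OM.
- exact: hatO_S.
- by apply: Ostar; exact: hatO_S.
- exact: hatO_T.
- by apply: Ostar; exact: hatO_T.
Qed.

Lemma hatO_peval t : O (peval f1 f2 S T t).
Proof.
have [_ OD OZ OM Ostar _] := hatO_subalgebra.
elim: t => [i|k|z|w||s IHs t IHt|c s IHs|s IHs t IHt|s IHs] /=.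
- exact: hatO_S.
- exact: hatO_T.
- exact: hatO_f1.
- exact: hatO_f2.
- exact: hatO_1.
- exact: OD.
- exact: OZ.
- exact: OM.
- exact: Ostar.
Qed.

Section Gauge.
Hypotheses (f1_inj : injective f1) (f2_inj : injective f2).
Variable h : R -> D -> D.
Hypothesis hP : gauge_action f1 f2 S T h.

(** The spectral subspaces of the gauge action. *)
Let G (k : int) (x : Q) :=
  O x.2 /\ forall r, h r x.2 = expi2pi (r * k%:~R) *: x.2.

(** On the images of [B1] and [B2] the comparison holds because [kappa] is
    contractive there while [f1] and [f2] are isometric; the translates by the
    gauge action are contractive on the closed subalgebra where it is defined. *)
Lemma kappa_le_ev p : cnorm (kappa p) <= cnorm (ev p).
Proof.
have [Ozero OD OZ OM Ostar _] := hatO_subalgebra.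
have gD := gaugeD hP; have gZ := gaugeZ hP.
have h0 r : h r 0 = 0 by rewrite -(scale0r (0 : D)) gZ // !scale0r.
have hhom r : starhom_on O (h r).
  split.
  - exact: (gaugeD hP r).
  - exact: (gaugeZ hP r).
  - exact: (gaugeM hP r).
  - exact: (gauge_star hP r).
have hle r x : O x -> cnorm (h r x) <= cnorm x.
  exact: (starhom_on_contractive hatO_subalgebra (hhom r)).
have G0 k : G k 0 by split=> // r; rewrite h0 scaler0.
have GD k x y : G k x -> G k y -> G k (x + y).
  move=> [Ox hx] [Oy hy]; split; first exact: OD.
  by move=> r; rewrite gD // hx hy scalerDr.
have GZ k (c : R[i]) x : G k x -> G k (c *: x).
  move=> [Ox hx]; split; first exact: OZ.
  by move=> r; rewrite gZ // hx !scalerA mulrC.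
have GM k l x y : G k x -> G l y -> G (k + l) (x * y).
  move=> [Ox hx] [Oy hy]; split; first exact: OM.
  move=> r; rewrite (gaugeM hP) // hx hy -scalerAl -scalerAr scalerA -expi2piD.
  by rewrite intrD mulrDr.
have Gstar k x : G k x -> G (- k) (star x).
  move=> [Ox hx]; split; first exact: Ostar.
  by move=> r; rewrite (gauge_star hP) // hx starZ expi2pi_conj intrN mulrN.
have Ggen a : G 1 (gen gS gT a).
  case: a => [i|k]; split=> [|r] /=; rewrite ?mulr1.
  - exact: hatO_S.
  - exact: (gauge_S hP).
  - exact: hatO_T.
  - exact: (gauge_T hP).
have Gf1 z : G 0 (g1 z).
  split=> [|r]; first exact: hatO_f1.
  by rewrite (gauge_f1 hP) mulr0 expi2pi0 scale1r.
have Gf2 w : G 0 (g2 w).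
  split=> [|r]; first exact: hatO_f2.
  by rewrite (gauge_f2 hP) mulr0 expi2pi0 scale1r.
have four d (c : 'I_(d.*2.+1) -> Q) :
    (forall i : 'I_(d.*2.+1), G (i%:Z - d%:Z) (c i)) ->
    forall i, cnorm (c i).2 <= cnorm (\sum_j c j).2.
  move=> cG i.
  have -> : (\sum_j c j).2 = \sum_j (c j).2 by exact: snd_sum.
  have Osum : O (\sum_j (c j).2) by apply: hatO_sum => j; exact: (cG j).1.
  apply: (@fourier_coefficient_le _ _ _ h (fun j => (c j).2)) => //.
  - move=> r.
    have : O (\sum_j (c j).2) /\ h r (\sum_j (c j).2) = \sum_j h r (c j).2.
      elim/big_ind2: _ => // [x y x' y' [Ox hx] [Oy hy]|j _].
        by split; [exact: OD | rewrite gD // hx hy].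
      by split=> //; exact: (cG j).1.
    by case.
  - by move=> r; exact: hle.
  - by move=> r j; exact: (cG j).2.
have le1 z : cnorm (g1 z).1 <= cnorm (g1 z).2.
  by rewrite /= (starhom_isometric z f1P f1_inj); exact: (starhom_contractive z kappa_uB1).
have le2 w : cnorm (g2 w).1 <= cnorm (g2 w).2.
  by rewrite /= (starhom_isometric w f2P f2_inj); exact: (starhom_contractive w kappa_uB2).
have := gauge_invariant_le (pair_hom kappa_uB1 f1P) (pair_hom kappa_uB2 f2P)
  pair_relations seminorm_fst seminorm_snd le1 le2 G0 GD GZ GM Gstar Ggen Gf1 Gf2
  four (repr p).
by rewrite peval_pair /= /univ_class reprK.
Qed.

Lemma kappa_ev_isometric p : cnorm (kappa p) = cnorm (ev p).
Proof.
apply/le_anti; rewrite kappa_le_ev (OH_norm kappaP).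
exact: ueval_le_univ_norm.
Qed.

End Gauge.

Section Extension.
Hypothesis iso : forall p, cnorm (kappa p) = cnorm (ev p).

Let evD p q : ev (p + q) = ev p + ev q. Proof. exact: uevalD. Qed.
Let ev0 : ev 0 = 0. Proof. exact: ueval0. Qed.
Let evZ c p : ev (c *: p) = c *: ev p. Proof. exact: uevalZ. Qed.
Let evM p q : ev (p * q) = ev p * ev q. Proof. exact: uevalM. Qed.
Let ev_star p : ev (ustar p) = star (ev p). Proof. exact: uevalstar. Qed.

Let Gr := closed_graph kappa ev.

Lemma iso_sub p q : cnorm (kappa p - kappa q) = cnorm (ev p - ev q).
Proof.
have := iso (p + (-1) *: q); rewrite (OH_D kappaP) (OH_Z kappaP) evD evZ.
by rewrite !scaleN1r.
Qed.

Lemma closed_graph_norm x y : Gr x y -> cnorm x = cnorm y.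
Proof.
move=> xy; apply/eqP; rewrite -subr_eq0 -normr_eq0; apply/eqP/le_anti.
rewrite normr_ge0 andbT; apply/ler_addgt0Pl => e e0; rewrite addr0.
have [p [xp yp]] := xy _ (divr_gt0 e0 (ltr0n _ 2)).
have := cnormD (x - kappa p) (kappa p); have := cnormD (kappa p - x) x.
have := cnormD (y - ev p) (ev p); have := cnormD (ev p - y) y.
rewrite !subrK (cnorm_distC _ x) (cnorm_distC _ y) iso ler_norml => *.
by apply/andP; split; lra.
Qed.

Lemma closed_graph_lin (c : R[i]) x y x' y' : Gr x y -> Gr x' y' ->
  Gr (c *: x + x') (c *: y + y').
Proof.
move=> xy xy' e e0; have c1 : 0 < cmod c + 1 by rewrite ltr_wpDl ?cmod_ge0.
have e1 : 0 < e / 2 / (cmod c + 1) by rewrite !divr_gt0.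
have [p [xp yp]] := xy _ e1; have [q [xq yq]] := xy' _ (divr_gt0 e0 (ltr0n _ 2)).
have main (Z : cstarType R) (a b a' b' : Z) :
    cnorm (a - b) < e / 2 / (cmod c + 1) -> cnorm (a' - b') < e / 2 ->
    cnorm (c *: a + a' - (c *: b + b')) < e.
  rewrite ltr_pdivlMr // => ab ab'; rewrite opprD addrACA -scalerBr.
  apply: le_lt_trans (cnormD _ _) _; rewrite cnormZ -/(cmod c).
  by have := cmod_ge0 c; have := cnorm_ge0 (a - b); nra.
exists (c *: p + q); rewrite (OH_D kappaP) (OH_Z kappaP) evD evZ.
by split; apply: main.
Qed.

Lemma closed_graph_mul x y x' y' : Gr x y -> Gr x' y' -> Gr (x * x') (y * y').
Proof.
move=> xy xy' e e0.
pose C := cnorm x + cnorm y + cnorm x' + cnorm y' + 1.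
have n1 := cnorm_ge0 x; have n2 := cnorm_ge0 y.
have n3 := cnorm_ge0 x'; have n4 := cnorm_ge0 y'.
have C0 : 0 < C by rewrite /C; lra.
(* Both terms of [(a - b) * b' + a * (a' - b')] are at most d C <= e / 4. *)
pose d := Num.min 1 (e / (4 * C)).
have d0 : 0 < d by rewrite lt_min ltr01 divr_gt0 ?mulr_gt0.
have d1 : d <= 1 by rewrite ge_min lexx.
have dC : d * (4 * C) <= e.
  by rewrite -ler_pdivlMr ?mulr_gt0 // ge_min lexx orbT.
have [p [xp yp]] := xy _ d0; have [q [xq yq]] := xy' _ d0.
have main (Z : cstarType R) (a b a' b' : Z) : cnorm a <= C -> cnorm a' <= C - 1 ->
    cnorm (a - b) < d -> cnorm (a' - b') < d -> cnorm (a * a' - b * b') < e.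
  move=> aC a'C ab ab'.
  have -> : a * a' - b * b' = (a - b) * b' + a * (a' - b').
    by rewrite mulrBl mulrBr [RHS]addrC addrA subrK.
  apply: le_lt_trans (cnormD _ _) _.
  have := cnormM (a - b) b'; have := cnormM a (a' - b').
  have b'C : cnorm b' <= C.
    by have := cnormD a' (b' - a'); rewrite (cnorm_distC b') addrC subrK; lra.
  have : cnorm (a - b) * cnorm b' <= d * C.
    by apply: ler_pM; rewrite ?cnorm_ge0 ?(ltW ab).
  have : cnorm a * cnorm (a' - b') <= C * d.
    by apply: ler_pM; rewrite ?cnorm_ge0 ?(ltW ab').
  have : 0 < d * C by rewrite mulr_gt0.
  move: (cnorm (a - b) * _) (cnorm a * _) (cnorm (_ * b')) (cnorm (a * _)).
  by move=> *; nra.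
exists (p * q); rewrite (OH_M kappaP) evM.
by split; apply: main => //; rewrite /C; lra.
Qed.

Lemma closed_graph_star x y : Gr x y -> Gr (star x) (star y).
Proof.
move=> xy e /xy[p [xp yp]]; exists (ustar p).
by rewrite (OH_star kappaP) ev_star -!starB !cnorm_starE.
Qed.

Lemma closed_graph_range p : Gr (kappa p) (ev p).
Proof. by move=> e e0; exists p; rewrite !subrr !cnorm0. Qed.

Lemma closed_graph0 : Gr 0 0.
Proof. by have := closed_graph_range 0; rewrite kappa0 ev0. Qed.

Lemma closed_graph_total x : exists y, Gr x y.
Proof. by apply: closed_graph_ex iso_sub _ _; rewrite (OH_dense kappaP). Qed.

Lemma closed_graph_inj x y x' y' : Gr x y -> Gr x' y' -> (x = x' <-> y = y').
Proof.
move=> xy xy'; have := closed_graph_norm (closed_graph_lin (-1) xy' xy).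
rewrite !scaleN1r ![- _ + _]addrC => nE.
split=> [xx'|yy']; apply/eqP; rewrite -subr_eq0; apply/eqP/cnorm0_eq0.
  by rewrite -nE xx' subrr cnorm0.
by rewrite nE yy' subrr cnorm0.
Qed.

(** The range is a C*-algebra: it is closed because a limit of values of [ev] is
    related, by [closed_graph_ex] in the other direction, to a point of the
    completion. *)
Lemma closed_graph_image : [set y | exists x, Gr x y] = O.
Proof.
apply/seteqP; split.
- move=> y [x xy]; apply: (csub_closed hatO_subalgebra) => e /xy[p [_ yp]].
  exists (ev p) => //; exact: hatO_peval.
- apply: smallest_sub; last first.
    move=> y [[[|]|]|] [i _ <-].
    + exists (kappa (uS X u v i)); rewrite -(uevalS f1P f2P STP); exact: closed_graph_range.
    + exists (kappa (uT X u v i)); rewrite -(uevalT f1P f2P STP); exact: closed_graph_range.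
    + exists (kappa (uB1 X u v i)); rewrite -(uevalB1 f1P f2P STP); exact: closed_graph_range.
    + exists (kappa (uB2 X u v i)); rewrite -(uevalB2 f1P f2P STP); exact: closed_graph_range.
  split.
  + by exists 0; exact: closed_graph0.
  + move=> y y' [x xy] [x' xy']; exists (1 *: x + x').
    by have := closed_graph_lin 1 xy xy'; rewrite !scale1r.
  + move=> c y [x xy]; exists (c *: x + 0).
    by have := closed_graph_lin c xy closed_graph0; rewrite !addr0.
  + by move=> y y' [x xy] [x' xy']; exists (x * x'); exact: closed_graph_mul.
  + by move=> y [x xy]; exists (star x); exact: closed_graph_star.
  + move=> y hy.
    have yc : cclosure (range ev) y.
      move=> e e0; have e2 := divr_gt0 e0 (ltr0n _ 2).
      have [y' [x xy'] yy'] := hy _ e2; have [p [_ y'p]] := xy' _ e2.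
      exists (ev p); first by exists p.
      by apply: le_lt_trans (cnorm_sub_trans y' _ _) _; lra.
    have [x yx] := closed_graph_ex (fun p q => esym (iso_sub p q)) yc.
    by exists x => e /yx[p [? ?]]; exists p.
Qed.

Lemma isometric_extension : exists Phi : OH -> D,
  [/\ starhom Phi, injective Phi, range Phi = O & forall p, Phi (kappa p) = ev p].
Proof.
pose Phi x := projT1 (cid (closed_graph_total x)).
have PhiP x : Gr x (Phi x) := projT2 (cid (closed_graph_total x)).
have PhiE x y : Gr x y -> Phi x = y.
  by move=> xy; apply/(closed_graph_inj (PhiP x) xy).
exists Phi; split.
- split.
  + move=> x y; apply: PhiE.
    by have := closed_graph_lin 1 (PhiP x) (PhiP y); rewrite !scale1r.
  + move=> c x; apply: PhiE; have := closed_graph_lin c (PhiP x) closed_graph0.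
    by rewrite !addr0.
  + by move=> x y; apply/PhiE/closed_graph_mul.
  + by move=> x; apply/PhiE/closed_graph_star.
- by move=> x x' xx'; apply/(closed_graph_inj (PhiP x) (PhiP x')).
- rewrite -closed_graph_image; apply/seteqP; split.
    by move=> _ [x _ <-]; exists x.
  by move=> y [x xy]; exists x => //; exact: PhiE.
- by move=> p; apply/PhiE/closed_graph_range.
Qed.

End Extension.
End Uniqueness.

Theorem theorem5p16 (R : realType) (A B1 B2 : cstarType R)
    (E : coefficients A B1 B2) (H : lmodType R[i]) (X : quad_module E H)
    (M N : nat) (u : 'I_M -> H) (v : 'I_N -> H)
    (uv_bases : finite_bases X u v)
    (OH : cstarType R) (kappa : univ_alg X u v -> OH)
    (OH_completion : is_OH kappa)
    (D : cstarType R) (Phi1 : B1 -> D) (Phi2 : B2 -> D)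
    (Phi1_hom : starhom Phi1) (Phi2_hom : starhom Phi2)
    (Phi12 : forall a : A, Phi1 (inc1 E a) = Phi2 (inc2 E a))
    (hS : 'I_M -> D) (hT : 'I_N -> D)
    (hST : relationsH X u v Phi1 Phi2 hS hT)
    (h_gauge : exists h : R -> D -> D, gauge_action Phi1 Phi2 hS hT h)
    (Phi1_inj : injective Phi1) (Phi2_inj : injective Phi2) :
  exists Phi : OH -> D,
    [/\ starhom Phi, injective Phi & range Phi = hatO Phi1 Phi2 hS hT] /\
    [/\ forall i : 'I_M, Phi (kappa (uS X u v i)) = hS i,
        forall k : 'I_N, Phi (kappa (uT X u v k)) = hT k,
        forall z : B1, Phi (kappa (uB1 X u v z)) = Phi1 z
      & forall w : B2, Phi (kappa (uB2 X u v w)) = Phi2 w].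
Proof.
have [h hP] := h_gauge.
have iso := kappa_ev_isometric OH_completion Phi1_hom Phi2_hom hST Phi1_inj Phi2_inj hP.
have [Phi [homP injP rangeP PhiE]] :=
  isometric_extension OH_completion Phi1_hom Phi2_hom hST iso.
exists Phi; split; first by split.
split=> *; rewrite PhiE.
- exact: (uevalS Phi1_hom Phi2_hom hST).
- exact: (uevalT Phi1_hom Phi2_hom hST).
- exact: (uevalB1 Phi1_hom Phi2_hom hST).
- exact: (uevalB2 Phi1_hom Phi2_hom hST).
Qed.
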